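(* Let $T>0$ and for $n\in\mathbb{N}$ let $\{\theta_n(t,x),\ (t,x)\in[0,T]\times[0,1]\}$ be stochastic processes with $\theta_n\in L^2([0,T]\times[0,1])$ a.s., satisfying: (H1) the finite dimensional distributions of $\zeta_n(t,x)=\int_0^t\int_0^x\theta_n(s,y)\,dy\,ds$ converge in law to those of a Brownian sheet $W$ on $[0,T]\times[0,1]$; (H2) for some $q\in[2,3)$ there is $C_q>0$ such that for every $n\ge1$ and every $f\in L^q([0,T]\times[0,1])$, $E\big(\int_0^T\int_0^1 f\theta_n\,dx\,dt\big)^2\le C_q\big(\int_0^T\int_0^1|f|^q\,dx\,dt\big)^{2/q}$; (H3) there exist $m>8$ and $C>0$ such that for all $s_0,s_0'\in[0,T]$, $x_0,x_0'\in[0,1]$ with $0<s_0<s_0'<2s_0$, $0<x_0<x_0'<2x_0$, and all $f\in L^2([0,T]\times[0,1])$, $\sup_{n\ge1}E\big|\int_{s_0}^{s_0'}\int_{x_0}^{x_0'}f\theta_n\,dy\,ds\big|^m\le C\big(\int_{s_0}^{s_0'}\int_{x_0}^{x_0'}f^2\,dy\,ds\big)^{m/2}$. Then $X_n(t,x)=\int_0^t\int_0^1G_{t-s}(x,y)\theta_n(s,y)\,dy\,ds$ converges in law, as $n\to\infty$, in $\mathcal{C}([0,T]\times[0,1])$, to the Gaussian process $X(t,x)=\int_0^t\int_0^1G_{t-s}(x,y)W(ds,dy)$.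
   Context: $G_t(x,y)=2\sum_{k\ge1}\sin(k\pi x)\sin(k\pi y)e^{-k^2\pi^2 t}$ is the Green function of the heat equation on $[0,1]$ with Dirichlet boundary conditions; the integral defining $X$ is a Wiener integral with respect to $W$. $X_n$ is understood as its continuous version. *)

(* Defs.v *)
From HB Require Import structures.
From mathcomp Require Import all_boot all_order all_algebra.
From mathcomp Require Import all_classical all_reals all_analysis.
From Stdlib Require Lists.List.

Set Implicit Arguments.
Unset Strict Implicit.
Unset Printing Implicit Defensive.

Import Order.TTheory GRing.Theory Num.Def Num.Theory.
Import numFieldNormedType.Exports.

Local Open Scope classical_set_scope.
Local Open Scope ring_scope.

Section Defs.
Variable R : realType.

(* Dirichlet heat kernel on [0,1]:
   G_t(x,y) = 2 sum_{k>=1} sin(k pi x) sin(k pi y) exp(-k^2 pi^2 t). *)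
Definition green (t x y : R) : R :=
  limn (fun N : nat => \sum_(1 <= k < N)
          2 * sin (k%:R * pi * x) * sin (k%:R * pi * y)
            * expR (- ((k%:R) ^+ 2 * pi ^+ 2 * t))).

Definition rectK (T : R) : set (R * R) := `[0%R, T] `*` `[0%R, 1%R].

Definition dint (A B : set R) (h : R -> R -> R) : R :=
  Rintegral lebesgue_measure A
    (fun s => Rintegral lebesgue_measure B (fun y => h s y)).

Definition enorm (A B : set R) (h : R -> R -> R) (p : R) : \bar R :=
  (\int[lebesgue_measure]_(s in A)
     \int[lebesgue_measure]_(y in B) ((`|h s y| `^ p)%:E))%E.

Definition in_Lp (A B : set R) (p : R) (h : R -> R -> R) : Prop :=
  measurable_fun (A `*` B) (fun z : R * R => h z.1 z.2) /\
  (enorm A B h p < +oo)%E.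

Definition contK (T : R) (h : R -> R -> R) : Prop :=
  {within rectK T, continuous (fun z : R * R => h z.1 z.2)}.

Definition gauss0 (v : R) : set R -> \bar R :=
  if v == 0 then @dirac _ R 0 R else normal_prob 0 (Num.sqrt v).

(* Brownian sheet on [0,T] x [0,1]: a centered Gaussian process with
   covariance E W(t,x)W(t',x') = (t /\ t')(x /\ x'); Gaussianity is the
   statement that every finite linear combination is centered normal with the
   corresponding variance. *)
Definition brownian_sheet (T : R) d (Om : measurableType d)
    (P : probability Om R) (W : Om -> R -> R -> R) : Prop :=
  (forall t x, measurable_fun setT (fun w => W w t x)) /\
  forall pts : seq (R * (R * R)),
    (forall p, p \in pts -> rectK T p.2) ->
    forall A : set R, measurable A ->
      P [set w | A (\sum_(p <- pts) p.1 * W w p.2.1 p.2.2)] =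
      gauss0 (\sum_(p <- pts) \sum_(p' <- pts)
                 p.1 * p'.1 * Num.min p.2.1 p'.2.1 * Num.min p.2.2 p'.2.2) A.

(* rectangles ]ra,rb] x ]ru,rv] with a coefficient rc, for step functions *)
Record rect := Rect { rc : R; ra : R; rb : R; ru : R; rv : R }.

Definition rect_in (T : R) (r : rect) : Prop :=
  0 <= ra r /\ ra r <= rb r /\ rb r <= T /\ 0 <= ru r /\ ru r <= rv r /\ rv r <= 1.

Definition stepfun (st : seq rect) (s y : R) : R :=
  \sum_(r <- st) rc r * (\1_(`]ra r, rb r]) s * \1_(`]ru r, rv r]) y).

Definition wstep d (Om : measurableType d) (W : Om -> R -> R -> R)
    (st : seq rect) (w : Om) : R :=
  \sum_(r <- st) rc r *
     (W w (rb r) (rv r) - W w (ra r) (rv r) - W w (rb r) (ru r)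
      + W w (ra r) (ru r)).

Definition wiener_integral (T : R) d (Om : measurableType d)
    (P : probability Om R) (W : Om -> R -> R -> R) (h : R -> R -> R)
    (Z : Om -> R) : Prop :=
  in_Lp `[0%R, T] `[0%R, 1%R] 2 h /\
  exists st : nat -> seq rect,
    (forall j, Stdlib.Lists.List.Forall (rect_in T) (st j)) /\
    (fun j => enorm `[0%R, T] `[0%R, 1%R]
                 (fun s y => h s y - stepfun (st j) s y) 2) @ \oo --> 0%E /\
    (fun j => (\int[P]_w ((Z w - wstep W (st j) w) ^+ 2)%:E)%E) @ \oo --> 0%E.

(* test functionals for convergence in law in C([0,T] x [0,1]) with the sup
   norm: bounded, depending only on the restriction to [0,T] x [0,1], and
   continuous for the uniform distance on continuous functions. *)
Definition test_functional (T : R) (F : (R -> R -> R) -> R) : Prop :=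
  (exists M : R, forall g, `|F g| <= M) /\
  (forall g h, (forall t x, rectK T (t, x) -> g t x = h t x) -> F g = F h) /\
  (forall g, contK T g -> forall e : R, 0 < e -> exists2 delta : R, 0 < delta &
     forall h, contK T h ->
       (forall t x, rectK T (t, x) -> `|g t x - h t x| < delta) ->
       `|F g - F h| < e).

Definition cvg_law_C (T : R) (d : nat -> measure_display)
    (Om : forall n, measurableType (d n)) (P : forall n, probability (Om n) R)
    (Xn : forall n, Om n -> R -> R -> R)
    dX (OmX : measurableType dX) (PX : probability OmX R)
    (X : OmX -> R -> R -> R) : Prop :=
  forall F, test_functional T F ->
    (fun n => Rintegral (P n) setT (fun w => F (Xn n w))) @ \oo -->
      Rintegral PX setT (fun w => F (X w)).

Definition fdd_cvg (T : R) (d : nat -> measure_display)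
    (Om : forall n, measurableType (d n)) (P : forall n, probability (Om n) R)
    (Z : forall n, Om n -> R -> R -> R)
    dW (OmW : measurableType dW) (PW : probability OmW R)
    (W : OmW -> R -> R -> R) : Prop :=
  forall (k : nat) (p : 'I_k -> R * R), (forall i, rectK T (p i)) ->
  forall g : 'rV[R]_k -> R, continuous g -> (exists M : R, forall v, `|g v| <= M) ->
    (fun n => Rintegral (P n) setT
                (fun w => g (\row_i Z n w (p i).1 (p i).2))) @ \oo -->
      Rintegral PW setT (fun w => g (\row_i W w (p i).1 (p i).2)).

End Defs.

(* Main.v *)
Require Import Defs.
From HB Require Import structures.
From mathcomp Require Import all_boot all_order all_algebra.
From mathcomp Require Import all_classical all_reals all_analysis.
From mathcomp Require Import measurable_realfun ring lra zify.
Import Order.TTheory GRing.Theory Num.Def Num.Theory.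
Import numFieldNormedType.Exports.
Local Open Scope classical_set_scope.
Local Open Scope ring_scope.

(** Everything rests on one moment estimate. Cut [0,T] x [0,1] into the cells
    [T r^(k+1), T r^k] x [r^(l+1), r^l] with 1/2 < r < 1, so that (H3) applies on each cell. If the
    squared L2 norm of f on the cell (k,l) is at most G sg^(4(k+l)), then
    E |int f theta_n|^m <= C' G^(m/2).
    By Bessel's inequality for the sine basis, the squared L2 norm of the heat kernel over a thin
    strip along either axis is small, so its cells decay geometrically. Interpolating this decay
    with |G_(t-.)(x,.) - G_(t'-.)(x',.)|^2 = O(|x-x'| + |t-t'|^(1/2)) bounds the m-th moments of
    the dyadic increments of X_n at level j by O(2^(-j(2+eta))); this is where m > 8 enters.
    For the finite-dimensional laws the kernel is replaced by the step functions st that define the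
    Wiener integral, after cutting them off near the axes; int st theta_n is a linear functional of
    zeta_n, to which (H1) applies, and the errors are controlled by the moment estimate for X_n and
    by the Gaussian variance for X. Finally a test functional is approximated from below by its
    Lipschitz regularisations, evaluated on piecewise constant dyadic interpolations of the paths. *)

Set Implicit Arguments.
Unset Strict Implicit.
Unset Printing Implicit Defensive.

(** * Integrals over rectangles *)

(** (H3) says nothing about rectangles that touch an axis, and its bounds, added over infinitely
    many admissible cells, converge only if the integrand decays near both axes. An approximating
    step function has no such decay, hence the cut-off. For a difference of two kernels, smallness
    of the increment and decay along the axes are separate bounds, while both are needed on every
    cell, hence the interpolation. The count behind m > 8: a dyadic step of level j changes the
    kernel by O(2^(-j/2)) in squared norm, so the m-th moment is of order 2^(-jm/4), up to the share
    of the exponent spent on decay, and this has to beat the order 4^j of grid nodes. No compactness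
    of families of laws is used: for a regularised functional, the expectations along the level-j
    interpolations form a Cauchy sequence in j, uniformly in n, and each level involves finitely
    many values of the path. *)

Notation leb2 R := ((@lebesgue_measure R) \x (@lebesgue_measure R))%E.

Lemma restrictX (R : realType) (A B : set R) (f : R * R -> \bar R) (s y : R) :
  (f \_ (A `*` B)) (s, y) = ((fun s => ((fun y => f (s, y)) \_ B) y) \_ A) s.
Proof.
have [As|nAs] := pselect (A s); have [By|nBy] := pselect (B y).
- by rewrite !patchE !mem_set.
- by rewrite !patchE [s \in A]mem_set// [y \in B]memNset// memNset// => -[].
- by rewrite !patchE [s \in A]memNset// memNset// => -[].
- by rewrite !patchE [s \in A]memNset// memNset// => -[].
Qed.

Lemma ge0_integral_setX (R : realType) (A B : set R) (f : R * R -> \bar R) :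
  measurable A -> measurable B -> measurable_fun setT f -> (forall z, 0 <= f z)%E ->
  (\int[lebesgue_measure]_(s in A) \int[lebesgue_measure]_(y in B) f (s, y) =
   \int[leb2 R]_(z in A `*` B) f z)%E.
Proof.
move=> mA mB mf f0.
rewrite [RHS]integral_mkcond fubini_tonelli1; last 2 first.
- have mAB := measurableX mA mB; apply/(measurable_restrictT _ mAB); exact: measurable_funTS.
- by move=> z; rewrite patchE; case: ifPn.
rewrite integral_mkcond; apply: eq_integral => s _.
rewrite /fubini_F patchE; case: ifPn => As.
  rewrite [LHS]integral_mkcond; apply: eq_integral => y _.
  by rewrite restrictX [RHS]patchE As.
rewrite integral0_eq// => y _.
by rewrite (restrictX) patchE (negbTE As).
Qed.

Lemma enormE (R : realType) (A B : set R) (h : R -> R -> R) :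
  measurable A -> measurable B -> measurable_fun setT (fun z : R * R => h z.1 z.2) ->
  enorm A B h 2 = (\int[leb2 R]_(z in A `*` B) ((h z.1 z.2 ^+ 2)%:E))%E.
Proof.
move=> mA mB mh.
rewrite -(@ge0_integral_setX R A B (fun z => (h z.1 z.2 ^+ 2)%:E) mA mB); last 2 first.
- by apply/measurable_EFinP; exact: measurable_funX.
- by move=> z; rewrite lee_fin sqr_ge0.
apply: eq_integral => s _; apply: eq_integral => y _ /=.
by rewrite powR_mulrn// real_normK// num_real.
Qed.

(** [Rintegral] is [fine] of the integral of the positive part minus that of the negative part, and
    both are measurable in the parameter by Tonelli. No integrability is assumed: [fine] is
    measurable on the whole extended line. *)
Lemma measurable_Rintegral_param (R : realType) d (Y : measurableType d)
    (h : Y * R -> R) (B : set R) :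
  measurable B -> measurable_fun setT h ->
  measurable_fun setT (fun w => \int[lebesgue_measure]_(y in B) h (w, y)).
Proof.
move=> mB mh.
have mhr : measurable_fun setT (fun z : Y * R => ((h z)%:E * (\1_B z.2)%:E)%E).
  apply: emeasurable_funM; first exact/measurable_EFinP.
  apply/measurable_EFinP; apply: measurableT_comp => //.
rewrite (_ : (fun w => _) = fun w => fine (\int[lebesgue_measure]_y ((h (w, y))%:E * (\1_B y)%:E)%E)); last first.
  apply/funext => w; rewrite /Rintegral integral_mkcond; congr fine.
  apply: eq_integral => y _.
  by rewrite patchE indicE; case: ifPn => _; rewrite ?mule1 ?mule0.
apply: measurableT_comp => //.
pose G (z : Y * R) := ((h z)%:E * (\1_B z.2)%:E)%E.
rewrite (_ : (fun w => _) = fun w =>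
  fubini_F lebesgue_measure G^\+%E w - fubini_F lebesgue_measure G^\-%E w)%E; last first.
  apply/funext => w; rewrite integralE; congr (_ - _)%E;
  by apply: eq_integral => y _; rewrite ?funeposE ?funenegE.
apply: emeasurable_funB; apply: measurable_fun_fubini_tonelli_F.
- exact: measurable_funepos.
- by move=> z; exact: funepos_ge0.
- exact: measurable_funeneg.
- by move=> z; exact: funeneg_ge0.
Qed.

(** Fubini, with one subtlety: the inner integral of [dint] passes through [fine], which is harmless
    when the section at [s] is integrable. This holds for almost every [s], hence the comparison
    almost everywhere. *)
Lemma dintE (R : realType) (A B : set R) (h : R -> R -> R) :
  measurable A -> measurable B -> measurable_fun setT (fun z : R * R => h z.1 z.2) ->
  (leb2 R).-integrable (A `*` B) (fun z => (h z.1 z.2)%:E) ->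
  dint A B h = \int[leb2 R]_(z in A `*` B) (h z.1 z.2).
Proof.
move=> mA mB mh ih; rewrite /dint Rintegral_mkcond.
have ih' : (leb2 R).-integrable setT ((fun z => (h z.1 z.2)%:E) \_ (A `*` B)).
  by apply/(@integrable_restrict _ _ _ (leb2 R) _ (measurableX mA mB) setT measurableT _); rewrite setTI.
rewrite [RHS]/Rintegral integral_mkcond -integral12_prod_meas1//.
rewrite /Rintegral; congr (fine _).
pose F (s : R) : R := \int[lebesgue_measure]_y fine (((fun z => (h z.1 z.2)%:E) \_ (A `*` B)) (s, y)).
transitivity (\int[lebesgue_measure]_s (F s)%:E)%E.
  apply: eq_integral => s _; congr EFin.
  rewrite patchE /F; case: ifPn => As.
    rewrite -/(Rintegral _ _ _) Rintegral_mkcond; apply: eq_Rintegral => y _.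
    by rewrite restrictX !patchE As; case: ifPn.
  rewrite /Rintegral integral0_eq// => y _.
  by rewrite restrictX patchE (negbTE As).
apply: ae_eq_integral => //.
- apply/measurable_EFinP.
  apply: (@measurable_Rintegral_param R _ _ (fun z : R * R => fine (((fun z => (h z.1 z.2)%:E) \_ (A `*` B)) z)) setT) => //.
  apply: measurableT_comp => //.
  by apply/(measurable_restrictT _ (measurableX mA mB))/measurable_funTS/measurable_EFinP.
- exact: measurable_int (integrable_fubini_F ih').
have := ae_integrable1 ih'; apply: filterS => s Hs _.
have E y : (fine (((fun z => (h z.1 z.2)%:E) \_ (A `*` B)) (s, y)))%:E =
    ((fun z => (h z.1 z.2)%:E) \_ (A `*` B)) (s, y).
  by rewrite fineK// patchE; case: ifPn.
rewrite /F /Rintegral /fubini_F fineK//.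
  by apply: eq_integral => y _; rewrite E.
by under eq_integral do rewrite E; exact: integrable_fin_num.
Qed.

Lemma measurable_dint (R : realType) d (Y : measurableType d)
    (h : Y -> R -> R -> R) (A B : set R) :
  measurable A -> measurable B ->
  measurable_fun setT (fun z : Y * (R * R) => h z.1 z.2.1 z.2.2) ->
  measurable_fun setT (fun w => dint A B (h w)).
Proof.
move=> mA mB mh; rewrite /dint.
apply: (@measurable_Rintegral_param R _ _ (fun z : Y * R => \int[lebesgue_measure]_(y in B) h z.1 z.2 y)) => //.
apply: (@measurable_Rintegral_param R _ _ (fun z : (Y * R) * R => h z.1.1 z.1.2 z.2)) => //.
pose g (z : (Y * R) * R) := (z.1.1, (z.1.2, z.2)).
rewrite (_ : (fun z : (Y * R) * R => _) = (fun z : Y * (R * R) => h z.1 z.2.1 z.2.2) \o g)//.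
apply: measurableT_comp => //.
apply: measurable_fun_pair; first exact: measurableT_comp.
apply: measurable_fun_pair => //; exact: measurableT_comp.
Qed.

(** * Sine sums *)

(** Induction needs a bound that grows with n. The majorant [4 * e * (n e / (1 + n e))] has the
    explicit increment 4 e^2 / ((1 + (n+1) e)(1 + n e)), to be compared with the new term. *)
Lemma sum_min_inv_sq (R : realType) (e : R) (N : nat) : 0 <= e ->
  \sum_(1 <= k < N) Num.min ((k%:R ^+ 2)^-1) (e ^+ 2) <= 4 * e.
Proof.
move=> e0.
have pos n : 0 < 1 + n%:R * e by rewrite ltr_wpDr// mulr_ge0.
suff H n : \sum_(1 <= k < n.+1) Num.min ((k%:R ^+ 2)^-1) (e ^+ 2)
    <= 4 * e * (n%:R * e / (1 + n%:R * e)).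
  case: N => [|n]; first by rewrite big_geq// mulr_ge0.
  apply: (le_trans (H n)); rewrite ler_piMr ?mulr_ge0//.
  by rewrite ler_pdivrMr// mul1r lerDr.
elim: n => [|n IH]; first by rewrite big_geq// !mul0r mulr0.
rewrite big_nat_recr//=; apply: (le_trans (lerD IH (lexx _))).
rewrite -lerBrDl.
have -> : 4 * e * (n.+1%:R * e / (1 + n.+1%:R * e)) - 4 * e * (n%:R * e / (1 + n%:R * e)) =
    4 * e ^+ 2 / ((1 + n.+1%:R * e) * (1 + n%:R * e)).
  have := pos n.+1; rewrite -natr1 => pS.
  by field; rewrite !lt0r_neq0.
rewrite ler_pdivlMr ?mulr_gt0//.
set k : R := n.+1%:R.
have k0 : 0 < k by rewrite ltr0n.
have le1 : 1 + n%:R * e <= 1 + k * e by rewrite lerD2l ler_wpM2r// ler_nat.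
(* For [k * e <= 1] the denominator is at most 4 and the term is bounded by [e ^+ 2]; beyond, each
   factor is at most 2 k e and the term is bounded by 1/k^2. *)
have [ke|ke] := leP (k * e) 1.
  apply: (@le_trans _ _ (e ^+ 2 * ((1 + k * e) * (1 + n%:R * e)))).
    by apply: ler_wpM2r; rewrite ?mulr_ge0 ?(ltW (pos _))// ge_min lexx orbT.
  rewrite mulrC ler_wpM2r ?sqr_ge0//.
  have := pos n; have := pos n.+1; rewrite -/k; nra.
apply: (@le_trans _ _ ((k ^+ 2)^-1 * ((1 + k * e) * (1 + n%:R * e)))).
  by apply: ler_wpM2r; rewrite ?mulr_ge0 ?(ltW (pos _))// ge_min lexx.
rewrite mulrC ler_pdivrMr ?exprn_gt0//.
have := pos n; have := pos n.+1; rewrite -/k; nra.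
Qed.

Lemma sin_lipschitz (R : realType) (x y : R) : `|sin x - sin y| <= `|x - y|.
Proof.
wlog xy : x y / y <= x.
  by move=> H; case/orP: (le_total x y) => /H//; rewrite distrC [in X in _ <= X]distrC.
have [|c _ ->] := @MVT_segment _ (@sin R) (@cos R) y x xy (fun z _ => is_derive_sin z).
  by apply: continuous_subspaceT => z; exact: continuous_sin.
by rewrite normrM ler_piMl// cos_max.
Qed.

Lemma sin_natpi (R : realType) (k : nat) : sin (k%:R * pi) = 0 :> R.
Proof.
elim: k => [|k IH]; first by rewrite mul0r sin0.
by rewrite -natr1 mulrDl mul1r sinDpi IH oppr0.
Qed.

Lemma integral_is_derive (R : realType) (f F : R -> R) (a b : R) : a < b ->
  (forall x : R, is_derive x 1 F (f x)) -> continuous f ->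
  (\int[lebesgue_measure]_(x in `[a, b]) (f x)%:E = (F b - F a)%:E)%E.
Proof.
move=> ab dF cf; rewrite (@continuous_FTC2 R f F a b) ?EFinB//.
- exact: continuous_subspaceT.
- have cF : continuous F by move=> x; apply/differentiable_continuous/derivable1_diffP; case: (dF x).
  split.
  + by move=> x _; case: (dF x).
  + by apply: cvg_at_right_filter; exact: cF.
  + by apply: cvg_at_left_filter; exact: cF.
- by move=> x _; rewrite derive1E; case: (dF x).
Qed.

Lemma integral_cos (R : realType) (c : R) : c != 0 ->
  (\int[lebesgue_measure]_(y in `[0%R, 1%R]) (cos (c * y))%:E = (sin c / c)%:E)%E.
Proof.
move=> c0.
have dF (x : R) : is_derive x 1 (fun y => c^-1 * sin (c * y)) (cos (c * x)).
  have H : is_derive x 1 (fun y : R => c * y) c.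
    by have := is_deriveZ c (is_derive_id x (1 : R)); rewrite /GRing.scale/= mulr1.
  have := is_deriveZ c^-1 (is_derive1_comp (is_derive_sin (c * x)) H).
  by rewrite /GRing.scale/= mulrCA mulVf// mulr1.
rewrite (integral_is_derive ltr01 dF).
  by rewrite mulr1 mulr0 sin0 mulr0 subr0 mulrC.
by move=> x; apply: continuous_comp; [exact: mulrl_continuous|exact: continuous_cos].
Qed.

Lemma integral_sin_sin (R : realType) (k l : nat) : (0 < k)%N -> (0 < l)%N ->
  (\int[lebesgue_measure]_(y in `[0%R, 1%R])
     (sin (k%:R * pi * y) * sin (l%:R * pi * y))%:E = ((k == l)%:R / 2 : R)%:E)%E.
Proof.
move=> k0 l0.
have Ic (c : R) : lebesgue_measure.-integrable `[0, 1] (EFin \o (fun y => cos (c * y))).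
  apply: continuous_compact_integrable; first exact: segment_compact.
  by apply: continuous_subspaceT => x; apply: continuous_comp; [exact: mulrl_continuous|exact: continuous_cos].
transitivity (\int[@lebesgue_measure R]_(y in `[0%R, 1%R]) ((2^-1)%:E *
   ((EFin \o (fun y => cos ((k%:R - l%:R) * pi * y))) y -
    (EFin \o (fun y => cos ((k%:R + l%:R) * pi * y))) y)))%E.
  apply: eq_integral => y _; rewrite /= -EFinB -EFinM; congr EFin.
  have -> : (k%:R - l%:R) * pi * y = k%:R * pi * y - l%:R * pi * y by ring.
  have -> : (k%:R + l%:R) * pi * y = k%:R * pi * y + l%:R * pi * y by ring.
  by rewrite cosB cosD; field.
rewrite integralZl//; last by apply: integrableB.
rewrite integralB//=.
have pi0 : pi != 0 :> R by rewrite gt_eqF// pi_gt0.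
rewrite (@integral_cos R ((k%:R + l%:R) * pi)); last first.
  by rewrite mulf_neq0// -natrD pnatr_eq0 -lt0n addn_gt0 k0.
have -> : sin ((k%:R + l%:R) * pi) = 0 :> R by rewrite -natrD sin_natpi.
rewrite mul0r sube0.
have [<-|kl] := eqVneq k l.
  under eq_integral do rewrite subrr !mul0r cos0.
  rewrite integral_cst//= mul1e lebesgue_measure_itv/= lte_fin ltr01.
  by rewrite sube0 -EFinM mulr1 mul1r.
rewrite (@integral_cos R ((k%:R - l%:R) * pi)); last first.
  by rewrite mulf_neq0// subr_eq0 eqr_nat.
have -> : sin ((k%:R - l%:R) * pi) = 0 :> R by rewrite mulrBl sinB !sin_natpi mul0r mulr0 subrr.
by rewrite !mul0r mule0.
Qed.

(** Parseval for finite sine sums: only the diagonal of the expanded square survives, with weight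
    1/2. *)
Lemma integral_sine_poly_sq (R : realType) (a : nat -> R) (N : nat) :
  (\int[lebesgue_measure]_(y in `[0%R, 1%R])
     ((\sum_(1 <= k < N) a k * sin (k%:R * pi * y)) ^+ 2)%:E =
   (2^-1 * \sum_(1 <= k < N) a k ^+ 2)%:E)%E.
Proof.
have Is k l : lebesgue_measure.-integrable `[0, 1]
    (EFin \o (fun y : R => a k * a l * (sin (k%:R * pi * y) * sin (l%:R * pi * y)))).
  apply: continuous_compact_integrable; first exact: segment_compact.
  apply: continuous_subspaceT => x; apply: cvgM; first exact: cvg_cst.
  by apply: cvgM; (apply: continuous_comp; [exact: mulrl_continuous|exact: continuous_sin]).
transitivity (\int[lebesgue_measure]_(y in `[0%R, 1%R])
   (\sum_(k <- index_iota 1 N) \sum_(l <- index_iota 1 N)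
     (a k * a l * (sin (k%:R * pi * y) * sin (l%:R * pi * y)))%:E))%E.
  apply: eq_integral => y _; rewrite expr2 mulr_suml -sumEFin; apply: eq_bigr => k _.
  rewrite mulr_sumr -sumEFin; apply: eq_bigr => l _; congr EFin; ring.
have IS k : lebesgue_measure.-integrable `[0, 1] (fun y : R => \sum_(l <- index_iota 1 N)
     (a k * a l * (sin (k%:R * pi * y) * sin (l%:R * pi * y)))%:E)%E.
  by apply: integrable_sum => // l _; exact: Is.
rewrite integral_sum//.
rewrite mulr_sumr -sumEFin; apply: eq_big_nat => k /andP[k1 kN].
rewrite integral_sum//; last exact: Is.
rewrite (eq_big_nat _ _ (F2 := fun l => ((k == l)%:R * (2^-1 * a k ^+ 2))%:E)); last first.
  move=> l /andP[l1 lN].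
  under eq_integral do rewrite EFinM.
  rewrite integralZl//=; last first.
    apply: continuous_compact_integrable; first exact: segment_compact.
    apply: continuous_subspaceT => x.
    by apply: cvgM; (apply: continuous_comp; [exact: mulrl_continuous|exact: continuous_sin]).
  rewrite integral_sin_sin// -EFinM; congr EFin.
  by case: eqVneq => [->|_]; rewrite ?mul0r ?mulr0//; field.
rewrite sumEFin; congr EFin; rewrite -mulr_suml -[RHS]mul1r; congr (_ * _).
rewrite (bigD1_seq k) ?mem_index_iota ?k1 ?iota_uniq//= eqxx big1 ?addr0// => l lk.
by rewrite eq_sym (negbTE lk).
Qed.

(** * L2 estimates for the heat kernel *)

(** Serves the sine series and the cell sums, where only an upper bound on the integral of the limit
    is wanted; no domination is required. *)
Lemma fatou_le (R : realType) d (Y : measurableType d) (mu : {measure set Y -> \bar R})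
    (D : set Y) (f_ : nat -> Y -> \bar R) (f : Y -> \bar R) (c : \bar R) :
  measurable D -> (forall n, measurable_fun D (f_ n)) ->
  (forall n x, D x -> 0 <= f_ n x)%E ->
  (forall x, D x -> f_ ^~ x @ \oo --> f x) ->
  (forall n, \int[mu]_(x in D) f_ n x <= c)%E -> (\int[mu]_(x in D) f x <= c)%E.
Proof.
move=> mD mf f0 ff fc.
rewrite (eq_integral (fun x => limn_einf (f_ ^~ x))); last first.
  move=> x /set_mem Dx; have /cvgP cf := ff x Dx.
  by rewrite is_cvg_limn_einfE//; apply/esym/cvg_lim => //; exact: ff.
apply: (le_trans (fatou mu mD mf f0)).
rewrite limn_einf_lim; apply: lime_le; first exact: is_cvg_einfs.
apply: nearW => n; apply: le_trans (fc n); apply: ereal_inf_lbound.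
by exists n; rewrite //=.
Qed.

Definition gterm (R : realType) (t x y : R) (k : nat) : R :=
  2 * sin (k%:R * pi * x) * sin (k%:R * pi * y) * expR (- (k%:R ^+ 2 * pi ^+ 2 * t)).

Lemma expRN_leV (R : realType) (z : R) : 0 < z -> expR (- z) <= z^-1.
Proof.
move=> z0; rewrite expRN lef_pV2 ?posrE ?expR_gt0//.
by apply: le_trans (expR_ge1Dx z); rewrite lerDr.
Qed.

Lemma expRN_le1 (R : realType) (z : R) : 0 <= z -> expR (- z) <= 1.
Proof. by move=> z0; rewrite -expR0 ler_expR oppr_le0. Qed.

Lemma heat_exp_le (R : realType) (t : R) (k : nat) : 0 < t -> (0 < k)%N ->
  expR (- (k%:R ^+ 2 * pi ^+ 2 * t)) <= t^-1 * Num.min ((k%:R ^+ 2)^-1) t.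
Proof.
move=> t0 k0; have k0' : 0 < k%:R :> R by rewrite ltr0n.
have p1 : 1 <= pi ^+ 2 :> R by have := pi_ge2 R; nra.
have kk : 0 < k%:R ^+ 2 :> R by rewrite exprn_gt0.
rewrite minr_pMr ?invr_ge0 ?(ltW t0)// le_min; apply/andP; split.
  apply: (le_trans (expRN_leV _)); first by rewrite !mulr_gt0 ?exprn_gt0 ?pi_gt0.
  rewrite -invfM lef_pV2 ?posrE ?mulr_gt0 ?exprn_gt0 ?pi_gt0//.
  by rewrite -mulrA [t * _]mulrC ler_pM2l// ler_peMl// ltW.
rewrite mulVf ?gt_eqF//; apply: expRN_le1.
by apply: mulr_ge0 (ltW t0); apply: mulr_ge0; exact: sqr_ge0.
Qed.

Lemma gterm_le (R : realType) (t x y : R) (k : nat) : 0 < t -> (0 < k)%N ->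
  `|gterm t x y k| <= 2 / t * Num.min ((k%:R ^+ 2)^-1) t.
Proof.
move=> t0 k0; rewrite /gterm !normrM (gtr0_norm (expR_gt0 _)) ger0_norm//.
rewrite -!(mulrA 2) ler_pM2l//.
apply: le_trans (heat_exp_le t0 k0).
rewrite ler_piMl ?expR_ge0//.
by rewrite -[leRHS]mulr1 ler_pM// sin_max.
Qed.

(** [sum_min_inv_sq] with [e = sqrt t]. The one bound gives both the absolute convergence of the
    series and the pointwise bound on the kernel. *)
Lemma sum_gterm_le (R : realType) (t x y : R) (N : nat) : 0 < t ->
  \sum_(1 <= k < N) `|gterm t x y k| <= 8 / Num.sqrt t.
Proof.
move=> t0; apply: (@le_trans _ _ (2 / t * \sum_(1 <= k < N) Num.min ((k%:R ^+ 2)^-1) ((Num.sqrt t) ^+ 2))).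
  rewrite mulr_sumr !big_nat; apply: ler_sum => k /andP[k1 _].
  by rewrite sqr_sqrtr ?(ltW t0)//; exact: gterm_le.
apply: (@le_trans _ _ (2 / t * (4 * Num.sqrt t))).
  by rewrite ler_wpM2l// ?divr_ge0 ?(ltW t0)//; apply: sum_min_inv_sq; exact: sqrtr_ge0.
have st : 0 < Num.sqrt t by rewrite sqrtr_gt0.
by rewrite -[in 2 / t](sqr_sqrtr (ltW t0)) le_eqVlt; apply/orP; left; apply/eqP; field; rewrite gt_eqF.
Qed.

Lemma series_from1 (R : realType) (u : nat -> R) : u 0%N = 0 ->
  series u = fun N => \sum_(1 <= k < N) u k.
Proof.
move=> u0; apply/funext => -[|n]; rewrite /series /=; first by rewrite !big_geq.
by rewrite [LHS]big_ltn// u0 add0r.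
Qed.

Lemma gterm0 (R : realType) (t x y : R) : gterm t x y 0 = 0.
Proof. by rewrite /gterm !mul0r sin0 mulr0 !mul0r. Qed.

Lemma green_cvg (R : realType) (t x y : R) : 0 < t ->
  (fun N => \sum_(1 <= k < N) gterm t x y k) @ \oo --> green t x y.
Proof.
(* [green] is a [limn], hence the actual limit as soon as the series converges. *)
move=> t0; suff : cvgn (fun N => \sum_(1 <= k < N) gterm t x y k) by [].
rewrite -series_from1 ?gterm0//; apply: normed_cvg.
apply: nondecreasing_is_cvgn.
  by move=> n m nm; rewrite [leRHS](big_cat_nat _ nm)//= lerDl sumr_ge0.
exists (8 / Num.sqrt t) => _ [n _ <-]; apply: le_trans (sum_gterm_le x y n t0).
have := @series_from1 R (fun k => `|gterm t x y k|).
by rewrite gterm0 normr0 => /(_ erefl)/(congr1 (@^~ n)) /= <-.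
Qed.

Lemma green_bound (R : realType) (t x y : R) : 0 < t -> `|green t x y| <= 8 / Num.sqrt t.
Proof.
move=> t0; have /cvg_norm H := green_cvg (x := x) (y := y) t0.
rewrite -(cvg_lim _ H)//; apply: limr_le; first by apply: cvgP H.
by apply: nearW => n; apply: le_trans (ler_norm_sum _ _ _) _; exact: sum_gterm_le.
Qed.

(** Parseval in [y] for the partial sums, then Fatou in [N]. The constant 8 is 1/2 from Parseval,
    times 4 from the coefficient bound, times 4 from [sum_min_inv_sq]. *)
Lemma bessel_enorm (R : realType) (A : set R) (f : R -> R -> R) (a : nat -> R -> R) (e : R) :
  measurable A -> measurable_fun setT (fun z : R * R => f z.1 z.2) ->
  (forall k, measurable_fun setT (a k)) -> 0 <= e ->
  (forall s y, A s -> (fun N => \sum_(1 <= k < N) a k s * sin (k%:R * pi * y)) @ \oo --> f s y) ->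
  (forall k, (0 < k)%N -> (\int[lebesgue_measure]_(s in A) (a k s ^+ 2)%:E <=
     (4 * Num.min ((k%:R ^+ 2)^-1) (e ^+ 2))%:E)%E) ->
  (enorm A `[0%R, 1%R] f 2 <= (8 * e)%:E)%E.
Proof.
move=> mA mf ma e0 cvf bd; rewrite enormE//.
pose S N (z : R * R) := \sum_(1 <= k < N) a k z.1 * sin (k%:R * pi * z.2).
have mS N : measurable_fun setT (S N).
  rewrite /S; apply: measurable_sum => k; apply: measurable_funM.
    by apply: (measurableT_comp (ma k)).
  have msin : measurable_fun setT (@sin R) by apply: continuous_measurable_fun; exact: continuous_sin.
  apply: (measurableT_comp msin); exact: measurable_funM.
have ma2 k : measurable_fun setT (fun s => a k s ^+ 2) by exact: measurable_funX.
have mS2 N : measurable_fun setT (fun z => (S N z ^+ 2)%:E).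
  by apply/measurable_EFinP; exact: measurable_funX.
apply: (@fatou_le R _ _ (leb2 R) _ (fun N z => (S N z ^+ 2)%:E)).
- exact: measurableX.
- by move=> N; apply: (measurable_funTS (mS2 N)).
- by move=> N z _; rewrite lee_fin sqr_ge0.
- move=> z [Az _]; apply: cvg_EFin; first by apply: nearW.
  apply: (@cvg_comp _ _ _ (S ^~ z) (fun x => x ^+ 2) _ _ _ (cvf _ _ Az)).
  exact: exprn_continuous.
move=> N; rewrite -(@ge0_integral_setX R A _ (fun z => (S N z ^+ 2)%:E))//; last first.
- by move=> z; rewrite lee_fin sqr_ge0.
under eq_integral do rewrite /S/= integral_sine_poly_sq.
under eq_integral do rewrite EFinM.
rewrite ge0_integralZl_EFin//; last 2 first.
- by move=> s _; rewrite lee_fin sumr_ge0// => k _; rewrite sqr_ge0.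
- apply/measurable_EFinP; apply: measurable_funTS; exact: (measurable_sum _ (fun k => ma2 k)).
under eq_integral do rewrite -sumEFin.
rewrite ge0_integral_sum//; last 2 first.
- by move=> k; apply/measurable_EFinP; exact: measurable_funTS (ma2 k).
- by move=> k s _; rewrite lee_fin sqr_ge0.
apply: (@le_trans _ _ ((2^-1)%:E * \sum_(1 <= k < N) (4 * Num.min ((k%:R ^+ 2)^-1) (e ^+ 2))%:E)%E).
  rewrite lee_pmul2l// ?lte_fin ?invr_gt0// !big_nat.
  by apply: lee_sum => k /andP[k1 _]; exact: bd.
rewrite sumEFin -EFinM lee_fin -mulr_sumr mulrA.
have := sum_min_inv_sq N e0; lra.
Qed.

(** Extension by zero to [s >= t] puts the kernels of all times on one rectangle, so that they can
    be subtracted; it is also the integrand of the Wiener integral. *)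
Definition kern (R : realType) (t x s y : R) : R := if s < t then green (t - s) x y else 0.

(** Coefficients of [kern t x s] on the functions sin(k pi y), which are orthogonal on [0,1] with
    squared norm 1/2. *)
Definition heat_coef (R : realType) (t x : R) (k : nat) (s : R) : R :=
  if s < t then 2 * sin (k%:R * pi * x) * expR (- (k%:R ^+ 2 * pi ^+ 2 * (t - s))) else 0.

Lemma kern_cvg (R : realType) (t x s y : R) :
  (fun N => \sum_(1 <= k < N) heat_coef t x k s * sin (k%:R * pi * y)) @ \oo --> kern t x s y.
Proof.
rewrite /kern /heat_coef; case: ifPn => st; last first.
  rewrite (_ : (fun N => _) = cst 0); first exact: cvg_cst.
  by apply/funext => N; rewrite big1// => k _; rewrite mul0r.
rewrite (_ : (fun N => _) = fun N => \sum_(1 <= k < N) gterm (t - s) x y k).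
  by apply: green_cvg; rewrite subr_gt0.
by apply/funext => N; apply: eq_bigr => k _; rewrite /gterm mulrAC.
Qed.

Lemma measurable_heat_coef (R : realType) (t x : R) (k : nat) :
  measurable_fun setT (heat_coef t x k).
Proof.
apply: measurable_fun_ifT => //.
  by apply: measurable_fun_ltr => //; exact: measurable_cst.
apply: measurable_funM => //.
apply: (measurableT_comp (@measurable_expR R)).
apply: measurable_funN; apply: measurable_funM => //.
by apply: measurable_funB.
Qed.

Lemma measurable_kern (R : realType) (t x : R) :
  measurable_fun setT (fun z : R * R => kern t x z.1 z.2).
Proof.
apply: (@measurable_fun_cvg _ _ _ setT
  (fun N z => \sum_(1 <= k < N) heat_coef t x k z.1 * sin (k%:R * pi * z.2))); last first.
  by move=> z _; exact: kern_cvg.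
move=> N; apply: measurable_sum => k; apply: measurable_funM.
  exact: (measurableT_comp (measurable_heat_coef t x k)).
have msin : measurable_fun setT (@sin R) by apply: continuous_measurable_fun; exact: continuous_sin.
by apply: (measurableT_comp msin); exact: measurable_funM.
Qed.

Lemma kern_bound (R : realType) (t x s y : R) : `|kern t x s y| <= 8 / Num.sqrt (t - s).
Proof.
rewrite /kern; case: ifPn => st; first by apply: green_bound; rewrite subr_gt0.
by rewrite normr0 divr_ge0// sqrtr_ge0.
Qed.

(** The majorant has the primitive [K / c * expR (c * s - c * t)], equal to [K / c] at [t] and
    nonnegative at [a]. The lower bound [a] keeps the interval of integration bounded, yet the
    estimate does not depend on it. *)
Lemma integral_exp_decay (R : realType) (A : set R) (f : R -> R) (a t c K : R) :
  measurable A -> (forall s, A s -> a <= s) -> measurable_fun setT f ->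
  0 < c -> 0 <= K -> (forall s, 0 <= f s) ->
  (forall s, t <= s -> f s = 0) -> (forall s, s < t -> f s <= K * expR (- (c * (t - s)))) ->
  (\int[lebesgue_measure]_(s in A) (f s)%:E <= (K / c)%:E)%E.
Proof.
move=> mA aA mf c0 K0 f0 ft fle.
have -> : (\int[lebesgue_measure]_(s in A) (f s)%:E =
    \int[lebesgue_measure]_(s in A) (((fun s => (f s)%:E) \_ `]-oo, t[) s))%E.
  apply: eq_integral => s _; rewrite patchE; case: ifPn => //; rewrite notin_setE/= in_itv/= => /negP.
  by rewrite -leNgt => /ft ->.
rewrite -integral_mkcondr.
have [ta|at_] := leP t a.
  rewrite [X in integral _ X _](_ : _ = set0) ?integral_set0 ?lee_fin ?divr_ge0 ?(ltW c0)//.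
  rewrite -subset0 => s [/aA as_]; rewrite /= in_itv/= => st.
  by have := lt_le_trans st ta; rewrite ltNge as_.
have mg : measurable_fun setT (fun s : R => (K * expR (- (c * (t - s))))%:E).
  apply/measurable_EFinP; apply: measurable_funM => //.
  apply: (measurableT_comp (@measurable_expR R)).
  by apply: measurable_funN; apply: measurable_funM => //; exact: measurable_funB.
have g0 s : (0 <= (K * expR (- (c * (t - s))))%:E)%E by rewrite lee_fin mulr_ge0// expR_ge0.
apply: (@le_trans _ _ (\int[lebesgue_measure]_(s in A `&` `]-oo, t[) (K * expR (- (c * (t - s))))%:E)%E).
  apply: ge0_le_integral => //.
  - exact: measurableI.
  - by move=> s _; rewrite lee_fin.
  - by apply/measurable_EFinP; exact: measurable_funTS.
  - exact: measurable_funTS.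
  - by move=> s [_]; rewrite /= in_itv/= lee_fin => /fle.
apply: (@le_trans _ _ (\int[lebesgue_measure]_(s in `[a, t]) (K * expR (- (c * (t - s))))%:E)%E).
  apply: ge0_subset_integral => //.
  - exact: measurableI.
  - exact: measurable_funTS.
  - by move=> s [/aA as_]; rewrite /= !in_itv/= as_ => /ltW.
have dF (x : R) : is_derive x 1 (fun s => K / c * expR (c * s - c * t)) (K * expR (- (c * (t - x)))).
  have H : is_derive x 1 (fun s : R => c * s - c * t) c.
    have := is_deriveB (is_deriveZ c (is_derive_id x (1 : R))) (is_derive_cst (c * t) x (1 : R)).
    by rewrite /GRing.scale/= mulr1 subr0.
  have := is_deriveZ (K / c) (@is_derive1_comp R expR (fun s => c * s - c * t) x _ _ (is_derive_expR (c * x - c * t)) H).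
  rewrite /GRing.scale/= (_ : K / c * _ = K * expR (- (c * (t - x))))//.
  rewrite (_ : - (c * (t - x)) = c * x - c * t); last by ring.
  by field; rewrite gt_eqF.
rewrite (integral_is_derive at_ dF); last first.
  move=> x; apply: cvgM; first exact: cvg_cst.
  apply: continuous_comp; last exact: continuous_expR.
  by apply: cvgN; apply: cvgM; [exact: cvg_cst|apply: cvgB; [exact: cvg_cst|exact: cvg_id]].
rewrite lee_fin subrr expR0 mulr1 gerBl mulr_ge0 ?expR_ge0//.
by rewrite divr_ge0// ltW.
Qed.

Lemma heat_coef_ge (R : realType) (t x : R) (k : nat) (s : R) : t <= s -> heat_coef t x k s = 0.
Proof. by rewrite /heat_coef ltNge => ->. Qed.

Lemma heat_coef_sq_le (R : realType) (t x : R) (k : nat) (s : R) : s < t ->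
  heat_coef t x k s ^+ 2 <= 4 * expR (- (2 * k%:R ^+ 2 * pi ^+ 2 * (t - s))).
Proof.
move=> st; rewrite /heat_coef st exprMn -expRM_natl mulrN.
rewrite (_ : 2 * (k%:R ^+ 2 * pi ^+ 2 * (t - s)) = 2 * k%:R ^+ 2 * pi ^+ 2 * (t - s)); last by ring.
rewrite ler_wpM2r ?expR_ge0// exprMn (_ : 2 ^+ 2 = 4); last by ring.
rewrite ler_piMr// -real_normK ?num_real// exprn_ile1//; exact: sin_max.
Qed.

Lemma integral_bound_le (R : realType) (A : set R) (f : R -> R) (K v : R) :
  measurable A -> measurable_fun setT f -> (forall s, 0 <= f s) -> 0 <= K ->
  (forall s, f s <= K) -> (lebesgue_measure A <= v%:E)%E ->
  (\int[lebesgue_measure]_(s in A) (f s)%:E <= (K * v)%:E)%E.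
Proof.
move=> mA mf f0 K0 fK Av.
apply: (@le_trans _ _ (\int[lebesgue_measure]_(s in A) (cst K%:E) s)%E).
  apply: ge0_le_integral => //.
  - by move=> s _; rewrite lee_fin.
  - by apply/measurable_EFinP; exact: measurable_funTS.
  - by move=> s _; rewrite lee_fin.
rewrite integral_cst//= EFinM; exact: lee_wpmul2l.
Qed.

Lemma two_pi_sq (R : realType) (k : nat) : (0 < k)%N ->
  (2 * k%:R ^+ 2 * pi ^+ 2 : R)^-1 <= (k%:R ^+ 2)^-1 / 8.
Proof.
move=> k0; have k0' : 0 < k%:R ^+ 2 :> R by rewrite exprn_gt0// ltr0n.
have p1 : 4 <= pi ^+ 2 :> R by have := pi_ge2 R; nra.
rewrite -invfM lef_pV2 ?posrE ?mulr_gt0// ?exprn_gt0 ?pi_gt0 ?ltr0n//.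
have := ler_wpM2l (ltW k0') p1; lra.
Qed.

(** Each squared coefficient has two bounds on its time integral: exponential decay in [t - s]
    integrates to order 1/k^2, and the coefficient is at most 2 in absolute value on a set of
    measure [e ^+ 2]. Summing the minimum over k gives order [e]. *)
Lemma enorm_kern_small (R : realType) (t x e : R) (A : set R) :
  measurable A -> (forall s, A s -> 0 <= s) -> 0 <= e ->
  (lebesgue_measure A <= (e ^+ 2)%:E)%E ->
  (enorm A `[0%R, 1%R] (kern t x) 2 <= (8 * e)%:E)%E.
Proof.
move=> mA A0 e0 Ae; apply: (@bessel_enorm R A (kern t x) (heat_coef t x)) => //.
- exact: measurable_kern.
- exact: measurable_heat_coef.
- by move=> s y _; exact: kern_cvg.
move=> k k0; have mf : measurable_fun setT (fun s => heat_coef t x k s ^+ 2).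
  by apply: measurable_funX; exact: measurable_heat_coef.
have c0 : 0 < 2 * k%:R ^+ 2 * pi ^+ 2 :> R by rewrite !mulr_gt0 ?exprn_gt0 ?pi_gt0 ?ltr0n.
rewrite minr_pMr// EFin_min le_min; apply/andP; split; last first.
  apply: (integral_bound_le mA mf) => // [s|s]; first exact: sqr_ge0.
  have [ts|st] := leP t s; first by rewrite heat_coef_ge// expr0n.
  apply: (le_trans (heat_coef_sq_le x k st)); rewrite ler_piMr// expRN_le1// mulr_ge0// ?(ltW c0)//.
  by rewrite subr_ge0 ltW.
apply: le_trans (integral_exp_decay (t := t) (c := 2 * k%:R ^+ 2 * pi ^+ 2) (K := 4) mA A0 mf c0 _ _ _ _) _ => //.
- by move=> s; exact: sqr_ge0.
- by move=> s ts; rewrite heat_coef_ge// expr0n.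
- by move=> s st; exact: heat_coef_sq_le.
rewrite lee_fin ler_pM2l//; apply: le_trans (two_pi_sq R k0) _.
by rewrite ler_piMr ?invr_ge0 ?sqr_ge0//; lra.
Qed.

(** The increment of sin(k pi x) is at most 2 and at most k pi |x - x'|. Divided by the decay rate 2
    k^2 pi^2, its square is therefore controlled by the minimum of 1/k^2 and |x - x'|^2. *)
Lemma enorm_kern_space (R : realType) (t x x' : R) (A : set R) :
  measurable A -> (forall s, A s -> 0 <= s) ->
  (enorm A `[0%R, 1%R] (fun s y => kern t x s y - kern t x' s y)%R 2 <= (8 * `|x - x'|)%:E)%E.
Proof.
move=> mA A0.
apply: (@bessel_enorm R A _ (fun k s => heat_coef t x k s - heat_coef t x' k s)) => //.
- by apply: measurable_funB; exact: measurable_kern.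
- by move=> k; apply: measurable_funB; exact: measurable_heat_coef.
- move=> s y _; under eq_fun do under eq_bigr do rewrite mulrBl.
  under eq_fun do rewrite sumrB.
  by apply: cvgB; exact: kern_cvg.
move=> k k0; set f := fun s => (heat_coef t x k s - heat_coef t x' k s) ^+ 2.
have mf : measurable_fun setT f.
  by apply: measurable_funX; apply: measurable_funB; exact: measurable_heat_coef.
have kk : 0 < k%:R ^+ 2 :> R by rewrite exprn_gt0// ltr0n.
have pp : 0 < pi ^+ 2 :> R by rewrite exprn_gt0// pi_gt0.
have c0 : 0 < 2 * k%:R ^+ 2 * pi ^+ 2 :> R by rewrite !mulr_gt0 ?exprn_gt0 ?pi_gt0 ?ltr0n.
pose S := (sin (k%:R * pi * x) - sin (k%:R * pi * x')) ^+ 2.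
have S0 : 0 <= S by exact: sqr_ge0.
apply: le_trans (integral_exp_decay (t := t) (c := 2 * k%:R ^+ 2 * pi ^+ 2) (K := 4 * S) mA A0 mf c0 _ _ _ _) _ => //.
- by rewrite mulr_ge0.
- by move=> s; exact: sqr_ge0.
- by move=> s ts; rewrite /f !heat_coef_ge// subrr expr0n.
- move=> s st; rewrite /f /heat_coef st -mulrBl -mulrBr exprMn -expRM_natl mulrN.
  rewrite (_ : 2 * (k%:R ^+ 2 * pi ^+ 2 * (t - s)) = 2 * k%:R ^+ 2 * pi ^+ 2 * (t - s)); last by ring.
  by rewrite ler_wpM2r ?expR_ge0// exprMn (_ : 2 ^+ 2 = 4)//; ring.
rewrite lee_fin -mulrA ler_pM2l// le_min; apply/andP; split.
  apply: (@le_trans _ _ (4 * (2 * k%:R ^+ 2 * pi ^+ 2)^-1)).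
    rewrite ler_pM2r ?invr_gt0// /S.
    have := sin_max (k%:R * pi * x); have := sin_max (k%:R * pi * x').
    rewrite !ler_norml; nra.
  have ki : 0 <= (k%:R ^+ 2)^-1 :> R by rewrite invr_ge0 ltW.
  have := two_pi_sq R k0; lra.
rewrite ler_pdivrMr// /S -real_normK ?num_real//.
apply: (@le_trans _ _ ((k%:R * pi * `|x - x'|) ^+ 2)).
  rewrite ler_sqr ?nnegrE ?mulr_ge0 ?pi_ge0//.
  by apply: (le_trans (sin_lipschitz _ _)); rewrite -mulrBr normrM ger0_norm// mulr_ge0// pi_ge0.
rewrite (_ : (_ * _) ^+ 2 = `|x - x'| ^+ 2 * (k%:R ^+ 2 * pi ^+ 2)); last by ring.
rewrite ler_wpM2l ?sqr_ge0//; have := mulr_gt0 kk pp; lra.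
Qed.

(** The scale for [bessel_enorm] is sqrt(2 (t - t')). Before [t'] the coefficients differ by the
    factor 1 - exp(- k^2 pi^2 (t - t')); between [t'] and [t] only the first is nonzero. Each piece
    is bounded both by order 1/k^2 and by order [t - t']. *)
Lemma enorm_kern_time (R : realType) (t t' x : R) (A : set R) : t' <= t ->
  measurable A -> (forall s, A s -> 0 <= s) ->
  (enorm A `[0%R, 1%R] (fun s y => kern t x s y - kern t' x s y)%R 2
     <= (8 * Num.sqrt (2 * (t - t')))%:E)%E.
Proof.
move=> tt mA A0.
have h0 : 0 <= t - t' by rewrite subr_ge0.
apply: (@bessel_enorm R A _ (fun k s => heat_coef t x k s - heat_coef t' x k s)) => //.
- by apply: measurable_funB; exact: measurable_kern.
- by move=> k; apply: measurable_funB; exact: measurable_heat_coef.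
- move=> s y _; under eq_fun do under eq_bigr do rewrite mulrBl.
  under eq_fun do rewrite sumrB.
  by apply: cvgB; exact: kern_cvg.
move=> k k0; rewrite sqr_sqrtr ?mulr_ge0//.
set f := fun s => (heat_coef t x k s - heat_coef t' x k s) ^+ 2.
have mf : measurable_fun setT f.
  by apply: measurable_funX; apply: measurable_funB; exact: measurable_heat_coef.
have f0 s : 0 <= f s by exact: sqr_ge0.
have kk : 0 < k%:R ^+ 2 :> R by rewrite exprn_gt0// ltr0n.
have c0 : 0 < 2 * k%:R ^+ 2 * pi ^+ 2 :> R by rewrite !mulr_gt0 ?exprn_gt0 ?pi_gt0 ?ltr0n.
set c := 2 * k%:R ^+ 2 * pi ^+ 2 in c0.
pose f1 s := if s < t' then f s else 0.
pose f2 s := if s < t' then 0 else f s.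
have mlt : measurable_fun setT (fun s : R => s < t').
  by apply: measurable_fun_ltr => //; exact: measurable_cst.
have mf1 : measurable_fun setT f1 by apply: measurable_fun_ifT.
have mf2 : measurable_fun setT f2 by apply: measurable_fun_ifT.
have f10 s : 0 <= f1 s by rewrite /f1; case: ifP.
have f20 s : 0 <= f2 s by rewrite /f2; case: ifP.
have -> : (\int[lebesgue_measure]_(s in A) (f s)%:E =
    \int[lebesgue_measure]_(s in A) (f1 s)%:E + \int[lebesgue_measure]_(s in A) (f2 s)%:E)%E.
  rewrite -ge0_integralD//; last 4 first.
  - by move=> s _; rewrite lee_fin.
  - by apply/measurable_EFinP; exact: measurable_funTS.
  - by move=> s _; rewrite lee_fin.
  - by apply/measurable_EFinP; exact: measurable_funTS.
  apply: eq_integral => s _; rewrite -EFinD /f1 /f2; congr EFin.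
  by case: ifP => _; rewrite ?addr0 ?add0r.
(* [q] will dominate [1 - E'], with [E'] the decay from [t'] to [t]; as [0 <= 1 - E' <= q <= 1], it
   also dominates the square. *)
pose q : R := Num.min 1 (c / 2 * (t - t')).
have q0 : 0 <= q by rewrite le_min ler01 mulr_ge0// divr_ge0// ltW.
have q1 : q <= 1 by rewrite ge_min lexx.
have f1le : (\int[lebesgue_measure]_(s in A) (f1 s)%:E <= (4 * q / c)%:E)%E.
  apply: (integral_exp_decay (t := t') mA A0 mf1 c0) => //; first by rewrite mulr_ge0.
    by move=> s ts; rewrite /f1 ltNge ts.
  move=> s st; rewrite /f1 st /f /heat_coef st (lt_le_trans st tt) -mulrBr exprMn.
  rewrite -[4 * q * _]mulrA; apply: ler_pM; rewrite ?sqr_ge0//.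
    rewrite exprMn (_ : 2 ^+ 2 = 4); last by ring.
    rewrite ler_piMr// -real_normK ?num_real// exprn_ile1//; exact: sin_max.
  pose E := expR (- (k%:R ^+ 2 * pi ^+ 2 * (t' - s))).
  pose E' := expR (- (k%:R ^+ 2 * pi ^+ 2 * (t - t'))).
  have -> : expR (- (k%:R ^+ 2 * pi ^+ 2 * (t - s))) = E * E'.
    by rewrite /E /E' -expRD; congr expR; ring.
  have -> : expR (- (c * (t' - s))) = E ^+ 2.
    by rewrite /E -expRM_natl; congr expR; rewrite /c; ring.
  have b0 : 0 <= k%:R ^+ 2 * pi ^+ 2 * (t - t') :> R.
    by rewrite mulr_ge0// mulr_ge0 ?sqr_ge0.
  have E'1 : E' <= 1 by exact: expRN_le1.
  have E'0 : 0 <= E' by exact: expR_ge0.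
  have E'q : 1 - E' <= q.
    rewrite le_min lerBlDr lerDl E'0/=.
    rewrite lerBlDr -lerBlDl; apply: le_trans (expR_ge1Dx _).
    by rewrite /c le_eqVlt; apply/orP; left; apply/eqP; field.
  rewrite -/E (_ : (E * E' - E) ^+ 2 = (1 - E') ^+ 2 * E ^+ 2); last by ring.
  rewrite ler_wpM2r ?sqr_ge0//; nra.
have f2le1 : (\int[lebesgue_measure]_(s in A) (f2 s)%:E <= (4 / c)%:E)%E.
  apply: (integral_exp_decay (t := t) mA A0 mf2 c0) => //.
    by move=> s ts; rewrite /f2 /f !heat_coef_ge ?subrr ?expr0n ?if_same//; exact: le_trans ts.
  move=> s st; rewrite /f2; case: ltP => [_|ts]; first by rewrite mulr_ge0// expR_ge0.
  by rewrite /f (heat_coef_ge x k ts) subr0; exact: heat_coef_sq_le.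
have f2le2 : (\int[lebesgue_measure]_(s in A) (f2 s)%:E <= (4 * (t - t'))%:E)%E.
  have -> : (\int[lebesgue_measure]_(s in A) (f2 s)%:E =
      \int[lebesgue_measure]_(s in A) (((fun s => (f2 s)%:E) \_ `[t', t]) s))%E.
    apply: eq_integral => s _; rewrite patchE; case: ifPn => //.
    rewrite notin_setE/= in_itv/= => /negP; rewrite negb_and -!ltNge /f2.
    case/orP => [->//|ts]; rewrite ltNge (le_trans tt (ltW ts))/=.
    by rewrite /f !heat_coef_ge ?subrr ?expr0n// ?(le_trans tt)// ltW.
  rewrite -integral_mkcondr; apply: integral_bound_le => //; first exact: measurableI.
    move=> s; rewrite /f2; case: ltP => // ts; rewrite /f (heat_coef_ge x k ts) subr0.
    have [tts|st] := leP t s; first by rewrite heat_coef_ge// expr0n.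
    apply: (le_trans (heat_coef_sq_le x k st)); rewrite ler_piMr// expRN_le1// mulr_ge0// ?(ltW c0)//.
    by rewrite subr_ge0 ltW.
  apply: (@le_trans _ _ (lebesgue_measure `[t', t])).
    by apply: le_measure; rewrite ?inE//; exact: measurableI.
  rewrite lebesgue_measure_itv/= lte_fin; case: ifPn => // _.
apply: (@le_trans _ _ ((4 * q / c)%:E + (4 * Num.min c^-1 (t - t'))%:E)%E).
  apply: leeD => //; rewrite minr_pMr// EFin_min le_min f2le1 f2le2//.
rewrite -EFinD lee_fin -mulrA -mulrDr ler_pM2l// le_min.
have tp := two_pi_sq R k0; rewrite -/c in tp.
have ki : 0 <= (k%:R ^+ 2)^-1 :> R by rewrite invr_ge0 ltW.
have ci : 0 < c^-1 by rewrite invr_gt0.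
apply/andP; split.
  have : Num.min c^-1 (t - t') <= c^-1 by rewrite ge_min lexx.
  have : q / c <= c^-1 by rewrite ler_piMl// ltW.
  lra.
have : Num.min c^-1 (t - t') <= t - t' by rewrite ge_min lexx orbT.
have : q / c <= (t - t') / 2.
  rewrite ler_pdivrMr//; have : q <= c / 2 * (t - t') by rewrite ge_min lexx orbT.
  lra.
lra.
Qed.

Lemma enorm_sqrD (R : realType) (A B : set R) (f g h : R -> R -> R) :
  measurable A -> measurable B ->
  measurable_fun setT (fun z : R * R => f z.1 z.2) ->
  measurable_fun setT (fun z : R * R => g z.1 z.2) ->
  measurable_fun setT (fun z : R * R => h z.1 z.2) ->
  (forall s y, `|h s y| <= `|f s y| + `|g s y|) ->
  (enorm A B h 2 <= 2%:E * (enorm A B f 2 + enorm A B g 2))%E.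
Proof.
move=> mA mB mf mg mh hfg; rewrite !enormE//.
have mX (u : R -> R -> R) : measurable_fun setT (fun z : R * R => u z.1 z.2) ->
    measurable_fun (A `*` B) (fun z : R * R => (u z.1 z.2 ^+ 2)%:E).
  by move=> mu; apply/measurable_EFinP/measurable_funTS; exact: measurable_funX.
rewrite -ge0_integralD//; first last.
- exact: mX.
- by move=> z _; rewrite lee_fin sqr_ge0.
- exact: mX.
- by move=> z _; rewrite lee_fin sqr_ge0.
- exact: measurableX.
rewrite -ge0_integralZl_EFin//; first last.
- by apply: emeasurable_funD; exact: mX.
- by move=> z _; rewrite -EFinD lee_fin addr_ge0 ?sqr_ge0.
- exact: measurableX.
apply: ge0_le_integral.
- exact: measurableX.
- by move=> z _; rewrite lee_fin sqr_ge0.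
- exact: mX.
- by apply: measurable_funeM; apply: emeasurable_funD; exact: mX.
- move=> [s y] _ /=; rewrite -EFinD -EFinM lee_fin.
  have := hfg s y; have := normr_ge0 (h s y); have := sqr_ge0 (`|f s y| - `|g s y|).
  rewrite -[h s y ^+ 2]real_normK ?num_real// -[f s y ^+ 2]real_normK ?num_real//.
  rewrite -[g s y ^+ 2]real_normK ?num_real//; nra.
Qed.

Lemma enorm_kern_incr (R : realType) (t t' x x' : R) (A : set R) :
  measurable A -> (forall s, A s -> 0 <= s) ->
  (enorm A `[0%R, 1%R] (fun s y => kern t x s y - kern t' x' s y)%R 2
     <= (16 * (`|x - x'| + Num.sqrt (2 * `|t - t'|)))%:E)%E.
Proof.
wlog tt : t t' x x' / t' <= t.
  move=> H mA A0; case/orP: (le_total t' t) => tt; first exact: H.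
  rewrite distrC (distrC t) (_ : enorm _ _ _ _ =
    enorm A `[0%R, 1%R] (fun s y => kern t' x' s y - kern t x s y)%R 2); first exact: H.
  by apply: eq_integral => s _; apply: eq_integral => y _; rewrite distrC.
move=> mA A0; have mk := @measurable_kern R.
have mkB a b c d : measurable_fun setT (fun z : R * R => kern a b z.1 z.2 - kern c d z.1 z.2).
  exact: measurable_funB (mk a b) (mk c d).
apply: (le_trans (@enorm_sqrD R A `[0, 1] (fun s y => kern t x s y - kern t x' s y)
  (fun s y => kern t x' s y - kern t' x' s y) _ mA _ _ _ _ _)) => //.
- by move=> s y; apply: le_trans (ler_normD _ _); rewrite addrA subrK.
rewrite (_ : 16 * _ = 2 * (8 * `|x - x'| + 8 * Num.sqrt (2 * `|t - t'|))); last by ring.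
rewrite EFinM lee_pmul2l// EFinD leeD//; first exact: enorm_kern_space.
by rewrite ger0_norm ?subr_ge0//; exact: enorm_kern_time.
Qed.

Lemma enorm_subset (R : realType) (A A' B B' : set R) (f : R -> R -> R) :
  measurable A -> measurable B -> measurable A' -> measurable B' ->
  measurable_fun setT (fun z : R * R => f z.1 z.2) ->
  A `<=` A' -> B `<=` B' -> (enorm A B f 2 <= enorm A' B' f 2)%E.
Proof.
move=> mA mB mA' mB' mf AA BB; rewrite !enormE//.
apply: ge0_subset_integral.
- exact: measurableX.
- exact: measurableX.
- by apply/measurable_EFinP/measurable_funTS; exact: measurable_funX.
- by move=> z _; rewrite lee_fin sqr_ge0.
- by move=> z [/AA ? /BB].
Qed.

(** Time is split at distance [e ^+ 2] before [t]. In the window close to [t] the strip is enlarged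
    to the full width and [enorm_kern_small] applies; earlier, the pointwise bound 64 / (t - s) is
    at most [64 / e ^+ 2], on a set of area at most [T * b]. *)
Lemma enorm_kern_strip (R : realType) (T t x b e : R) (B : set R) :
  measurable B -> B `<=` `[0, 1] -> 0 <= T -> 0 < e -> (lebesgue_measure B <= b%:E)%E ->
  (enorm `[0%R, T] B (kern t x) 2 <= (8 * e + 64 / e ^+ 2 * (T * b))%:E)%E.
Proof.
move=> mB B01 T0 e0 Bb; have mk := measurable_kern t x.
pose A := (`[0, T] `&` `]t - e ^+ 2, t[)%classic.
have mA : measurable A by exact: measurableI.
rewrite enormE//.
have m1 : measurable_fun setT (fun z : R * R => (((kern t x z.1 z.2) ^+ 2)%:E : \bar R)).
  by apply/measurable_EFinP; exact: measurable_funX.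
have mAT : measurable (A `*` [set: R] : set (R * R)) by exact: measurableX.
have m2 : measurable_fun setT ((fun z : R * R => ((kern t x z.1 z.2) ^+ 2)%:E : \bar R) \_ (A `*` setT)).
  by apply/(measurable_restrictT _ mAT); exact: measurable_funTS.
have r0 z : (0 <= ((fun z : R * R => ((kern t x z.1 z.2) ^+ 2)%:E : \bar R) \_ (A `*` setT)) z)%E.
  by rewrite patchE; case: ifPn => // _; rewrite lee_fin sqr_ge0.
apply: (@le_trans _ _ (\int[leb2 R]_(z in `[0%R, T] `*` B)
   (((fun z : R * R => ((kern t x z.1 z.2) ^+ 2)%:E : \bar R) \_ (A `*` setT)) z + (64 / e ^+ 2)%:E))%E).
  apply: ge0_le_integral.
  - exact: measurableX.
  - by move=> z _; rewrite lee_fin sqr_ge0.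
  - exact: measurable_funTS.
  - by apply: measurable_funTS; apply: emeasurable_funD.
  move=> [s y] [/= s0T By].
  have e2 : 0 < e ^+ 2 by rewrite exprn_gt0.
  have K0 : 0 <= 64 / e ^+ 2 by rewrite divr_ge0// ltW.
  have [st|ts] := leP s (t - e ^+ 2).
    apply: (@le_trans _ _ (64 / e ^+ 2)%:E); last by rewrite leeDr.
    rewrite lee_fin -real_normK ?num_real//.
    have tse : e ^+ 2 <= t - s by lra.
    apply: (@le_trans _ _ ((8 / Num.sqrt (t - s)) ^+ 2)).
      by rewrite ler_sqr ?nnegrE ?divr_ge0 ?sqrtr_ge0//; exact: kern_bound.
    rewrite exprMn exprVn sqr_sqrtr; last by apply: le_trans tse; exact: ltW.
    rewrite (_ : 8 ^+ 2 = 64); last by ring.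
    by rewrite ler_pM2l// lef_pV2 ?posrE//; apply: lt_le_trans tse.
  have [st|tles] := ltP s t; last by rewrite /kern ltNge tles/= expr0n/= adde_ge0.
  by rewrite patchE mem_set ?leeDl//; split => //=; split => //=; rewrite in_itv/= ts st.
rewrite ge0_integralD//; first last.
- by move=> z _; rewrite lee_fin divr_ge0// sqr_ge0.
- exact: measurable_funTS.
- exact: measurableX.
rewrite EFinD leeD//.
  rewrite -integral_mkcondr.
  apply: le_trans (@enorm_kern_small R t x e A mA _ (ltW e0) _).
  - rewrite enormE//; apply: ge0_subset_integral.
    + by apply: measurableI => //; exact: measurableX.
    + exact: measurableX.
    + exact: measurable_funTS.
    + by move=> z _; rewrite lee_fin sqr_ge0.
    + by move=> [s y] [[_ /= By] [/= As _]]; split => //; exact: B01.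
  - by move=> s [/=]; rewrite in_itv/= => /andP[].
  - apply: (@le_trans _ _ (lebesgue_measure `]t - e ^+ 2, t[)).
      by apply: le_measure; rewrite ?inE//; exact: subIsetr.
    rewrite lebesgue_measure_itv/= lte_fin; case: ifPn => // _.
      by rewrite -EFinB lee_fin; lra.
    by rewrite lee_fin sqr_ge0.
have mTB : measurable (`[0%R, T] `*` B : set (R * R)) by exact: measurableX.
rewrite integral_cst; last exact: measurableX.
rewrite (EFinM (64 / e ^+ 2)); apply: lee_wpmul2l; first by rewrite lee_fin divr_ge0// sqr_ge0.
apply: (@le_trans _ _ (lebesgue_measure `[0%R, T]%classic * lebesgue_measure B)%E).
  by rewrite le_eqVlt; apply/orP; left; apply/eqP; exact: product_measure1E.
rewrite (EFinM T); apply: lee_pmul => //.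
rewrite lebesgue_measure_itv/= lte_fin; case: ifPn => // _.
by rewrite -EFinB subr0.
Qed.

(** * The moment estimate *)

Lemma integrable_mul_L2 (R : realType) (A B : set R) (f g : R -> R -> R) :
  measurable A -> measurable B ->
  measurable_fun setT (fun z : R * R => f z.1 z.2) ->
  measurable_fun setT (fun z : R * R => g z.1 z.2) ->
  (enorm A B f 2 < +oo)%E -> (enorm A B g 2 < +oo)%E ->
  (leb2 R).-integrable (A `*` B) (fun z => (f z.1 z.2 * g z.1 z.2)%:E).
Proof.
move=> mA mB mf mg; rewrite !enormE// => fL gL.
have mAB : measurable (A `*` B : set (R * R)) by exact: measurableX.
have mX (u : R -> R -> R) : measurable_fun setT (fun z : R * R => u z.1 z.2) ->
    measurable_fun (A `*` B) (fun z : R * R => (u z.1 z.2 ^+ 2)%:E).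
  by move=> mu; apply/measurable_EFinP/measurable_funTS; exact: measurable_funX.
have sqi (u : R -> R -> R) : measurable_fun setT (fun z : R * R => u z.1 z.2) ->
    (\int[leb2 R]_(z in A `*` B) (u z.1 z.2 ^+ 2)%:E < +oo)%E ->
    (leb2 R).-integrable (A `*` B) (fun z => (u z.1 z.2 ^+ 2)%:E).
  move=> mu uL; apply/integrableP; split; first exact: mX.
  by under eq_integral do rewrite gee0_abs ?lee_fin ?sqr_ge0//.
have I : (leb2 R).-integrable (A `*` B) (fun z => (f z.1 z.2 ^+ 2)%:E + (g z.1 z.2 ^+ 2)%:E)%E.
  by apply: integrableD; [exact: measurableX|exact: sqi|exact: sqi].
apply: (le_integrable _ _ _ I); first exact: measurableX.
  by apply/measurable_EFinP/measurable_funTS; exact: measurable_funM.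
move=> z _; rewrite -EFinD !abse_EFin lee_fin normrM [leRHS]ger0_norm ?addr_ge0 ?sqr_ge0//.
have := sqr_ge0 (`|f z.1 z.2| - `|g z.1 z.2|).
rewrite -[f z.1 z.2 ^+ 2]real_normK ?num_real// -[g z.1 z.2 ^+ 2]real_normK ?num_real//.
have := normr_ge0 (f z.1 z.2); have := normr_ge0 (g z.1 z.2); nra.
Qed.

(** Half-open intervals tile without overlap, as additivity requires, whereas the moment hypothesis
    speaks of closed ones. *)
Lemma dint_itv_oc (R : realType) (a b u v : R) (h : R -> R -> R) :
  measurable_fun setT (fun z : R * R => h z.1 z.2) ->
  dint `[a, b] `[u, v] h = dint `]a, b] `]u, v] h.
Proof.
move=> mh; rewrite /dint.
have E s : \int[lebesgue_measure]_(y in `[u, v]) h s y = \int[lebesgue_measure]_(y in `]u, v]) h s y.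
  rewrite /Rintegral; congr fine; apply/esym; apply: integral_itv_obnd_cbnd.
  apply/measurable_EFinP; apply: measurable_funTS.
  exact: (measurable_fun_pair2 s mh).
under eq_Rintegral do rewrite E.
rewrite /Rintegral; congr fine; apply/esym; apply: integral_itv_obnd_cbnd.
apply/measurable_EFinP; apply: measurable_funTS.
exact: (@measurable_Rintegral_param R _ _ (fun z : R * R => h z.1 z.2)).
Qed.

Lemma setXUl (S U : Type) (A B : set S) (C : set U) :
  (A `|` B) `*` C = (A `*` C) `|` (B `*` C).
Proof. by apply/seteqP; split => -[x y] /=; tauto. Qed.

Lemma setXUr (S U : Type) (A B : set S) (C : set U) :
  C `*` (A `|` B) = (C `*` A) `|` (C `*` B).
Proof. by apply/seteqP; split => -[x y] /=; tauto. Qed.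

Lemma dint_corner (R : realType) (T a b u v : R) (h : R -> R -> R) :
  measurable_fun setT (fun z : R * R => h z.1 z.2) ->
  (leb2 R).-integrable (`[0, T] `*` `[0, 1]) (fun z => (h z.1 z.2)%:E) ->
  0 <= a -> a <= b -> b <= T -> 0 <= u -> u <= v -> v <= 1 ->
  dint `[a, b] `[u, v] h = dint `[0, b] `[0, v] h - dint `[0, a] `[0, v] h
    - dint `[0, b] `[0, u] h + dint `[0, a] `[0, u] h.
Proof.
move=> mh ih a0 ab bT u0 uv v1.
have mX (a' b' u' v' : R) : measurable (`]a', b'] `*` `]u', v'] : set (R * R)) by exact: measurableX.
have iX (a' b' u' v' : R) : 0 <= a' -> b' <= T -> 0 <= u' -> v' <= 1 ->
    (leb2 R).-integrable (`]a', b'] `*` `]u', v']) (fun z => (h z.1 z.2)%:E).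
  move=> a'0 b'T u'0 v'1; apply: integrableS ih.
  - exact: measurableX.
  - exact: mX.
  move=> [s y] [/=]; rewrite !in_itv/= => /andP[as_ sb] /andP[uy yv]; split => /=.
    by rewrite (le_trans a'0 (ltW as_)) (le_trans sb b'T).
  by rewrite (le_trans u'0 (ltW uy)) (le_trans yv v'1).
have a1 := le_trans ab bT; have b0 := le_trans a0 ab.
have u1 := le_trans uv v1; have v0 := le_trans u0 uv.
rewrite !dint_itv_oc// !dintE//; try exact: iX.
pose J (s s' y y' : R) := \int[leb2 R]_(z in `]s, s'] `*` `]y, y']) h z.1 z.2.
have iJ y y' : 0 <= y -> y' <= 1 -> 0 <= y -> J 0 b y y' = J 0 a y y' + J a b y y'.
  move=> y0 y'1 _.
  have E : `]0, b] `*` `]y, y'] = (`]0, a] `*` `]y, y']) `|` (`]a, b] `*` `]y, y']) :> set (R * R).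
    by rewrite -setXUl -itv_bndbnd_setU ?bnd_simp.
  rewrite {1}/J E Rintegral_setU//; try exact: mX.
  - by rewrite -E; exact: iX.
  - apply/disj_setPRL => -[s z] [/= + _] [/= + _]; rewrite !in_itv/= => /andP[+ _] /andP[_].
    by rewrite ltNge => /negP.
have iJ2 : J a b 0 v = J a b 0 u + J a b u v.
  have E : `]a, b] `*` `]0, v] = (`]a, b] `*` `]0, u]) `|` (`]a, b] `*` `]u, v]) :> set (R * R).
    by rewrite -setXUr -itv_bndbnd_setU ?bnd_simp.
  rewrite {1}/J E Rintegral_setU//; try exact: mX.
  - by rewrite -E; exact: iX.
  - apply/disj_setPRL => -[s z] [/= _ +] [/= _ +]; rewrite !in_itv/= => /andP[+ _] /andP[_].
    by rewrite ltNge => /negP.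
rewrite -!/(J _ _ _ _) (iJ 0 v)// (iJ 0 u)// iJ2; ring.
Qed.

(** Absolute continuity of the integral. Since only the area [a * v] matters, one statement covers
    thin strips along either axis as well as small corners. *)
Lemma dint_corner_cvg0 (R : realType) (T : R) (h : R -> R -> R) :
  measurable_fun setT (fun z : R * R => h z.1 z.2) ->
  (leb2 R).-integrable (`[0, T] `*` `[0, 1]) (fun z => (h z.1 z.2)%:E) ->
  forall e, 0 < e -> exists2 del, 0 < del &
    forall a v, 0 <= a -> a <= T -> 0 <= v -> v <= 1 -> a * v < del -> `|dint `[0, a] `[0, v] h| < e.
Proof.
move=> mh ih e e0.
have mK : measurable (`[0, T] `*` `[0, 1] : set (R * R)) by exact: measurableX.
have ih' : (leb2 R).-integrable setT (EFin \o ((fun z : R * R => h z.1 z.2) \_ (`[0, T] `*` `[0, 1]))).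
  rewrite -restrict_EFin; apply/(@integrable_restrict _ _ _ (leb2 R) _ (measurableX _ _) setT measurableT _) => //.
  by rewrite setTI.
have [del [del0 H]] := integral_normr_continuous ih' e0.
exists del => // a v a0 aT v0 v1 av.
have sub : `[0, a] `*` `[0, v] `<=` (`[0, T] `*` `[0, 1] : set (R * R)).
  move=> [s y] [/=]; rewrite !in_itv/= => /andP[s0 sa] /andP[y0 yv].
  by split; rewrite /= ?s0 ?y0/= ?(le_trans sa aT) ?(le_trans yv v1).
have iav : (leb2 R).-integrable (`[0, a] `*` `[0, v]) (fun z => (h z.1 z.2)%:E).
  by apply: integrableS ih => //; exact: measurableX.
rewrite dintE//; apply: (le_lt_trans (le_normr_Rintegral _ iav)); first exact: measurableX.
have E : (lebesgue_measure `[0%R, a]%classic * lebesgue_measure `[0%R, v]%classic)%E = (a * v)%:E.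
  rewrite !lebesgue_measure_itv/= !lte_fin.
  by case: ltP => a0'; case: ltP => v0'; rewrite -?EFinB ?subr0 -?EFinM ?mul0e ?mule0//; congr EFin; nra.
apply: le_lt_trans (H (`[0, a] `*` `[0, v]) (measurableX (measurable_itv _) (measurable_itv _)) _); last first.
  apply: (@le_lt_trans _ _ (a * v)%:E); last by rewrite lte_fin.
  by rewrite -E le_eqVlt; apply/orP; left; apply/eqP; exact: product_measure1E.
rewrite le_eqVlt; apply/orP; left; apply/eqP; apply: eq_Rintegral => z /set_mem zav.
by rewrite patchE mem_set//; exact: sub.
Qed.

Definition cell_sum (R : realType) (T r : R) (h : R -> R -> R) (N : nat) : R :=
  \sum_(k < N) \sum_(l < N) dint `[T * r ^+ k.+1, T * r ^+ k] `[r ^+ l.+1, r ^+ l] h.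

(** Inclusion-exclusion on each cell, then telescoping in [l] and in [k]. The correction terms are
    the integrals over the two strips left along the axes and over their common corner. *)
Lemma cell_sumE (R : realType) (T r : R) (h : R -> R -> R) (N : nat) :
  0 <= T -> 0 < r -> r < 1 ->
  measurable_fun setT (fun z : R * R => h z.1 z.2) ->
  (leb2 R).-integrable (`[0, T] `*` `[0, 1]) (fun z => (h z.1 z.2)%:E) ->
  cell_sum T r h N = dint `[0, T] `[0, 1] h - dint `[0, T * r ^+ N] `[0, 1] h
    - dint `[0, T] `[0, r ^+ N] h + dint `[0, T * r ^+ N] `[0, r ^+ N] h.
Proof.
move=> T0 r0 r1 mh ih.
have rn n : 0 <= r ^+ n by rewrite exprn_ge0// ltW.
have rn1 n : r ^+ n <= 1 by rewrite exprn_ile1// ltW.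
have rS n : r ^+ n.+1 <= r ^+ n by rewrite exprS ler_piMl// ltW.
have [J JE] : exists J : R -> R -> R, forall a v, dint `[0, a] `[0, v] h = J a v by eexists.
have corner := dint_corner (T := T) mh ih.
have row (k n : nat) : \sum_(l < n) dint `[T * r ^+ k.+1, T * r ^+ k] `[r ^+ l.+1, r ^+ l] h =
    (J (T * r ^+ k) 1 - J (T * r ^+ k.+1) 1) - (J (T * r ^+ k) (r ^+ n) - J (T * r ^+ k.+1) (r ^+ n)).
  elim: n => [|n IH]; first by rewrite big_ord0 expr0 subrr.
  rewrite big_ord_recr/= IH corner ?mulr_ge0 ?ler_piMr ?ler_wpM2l// !JE; ring.
rewrite /cell_sum; under eq_bigr do rewrite row.
rewrite !JE; suff H n : \sum_(k < n) (J (T * r ^+ k) 1 - J (T * r ^+ k.+1) 1 - (J (T * r ^+ k) (r ^+ N) - J (T * r ^+ k.+1) (r ^+ N))) =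
    J T 1 - J (T * r ^+ n) 1 - J T (r ^+ N) + J (T * r ^+ n) (r ^+ N) by exact: H.
elim: n => [|n IH]; first by rewrite big_ord0 expr0 mulr1; ring.
by rewrite big_ord_recr/= IH; ring.
Qed.

Lemma cell_sum_cvg (R : realType) (T r : R) (h : R -> R -> R) :
  0 <= T -> 0 < r -> r < 1 ->
  measurable_fun setT (fun z : R * R => h z.1 z.2) ->
  (leb2 R).-integrable (`[0, T] `*` `[0, 1]) (fun z => (h z.1 z.2)%:E) ->
  cell_sum T r h @ \oo --> dint `[0, T] `[0, 1] h.
Proof.
move=> T0 r0 r1 mh ih.
have rn n : 0 <= r ^+ n by rewrite exprn_ge0// ltW.
have rn1 n : r ^+ n <= 1 by rewrite exprn_ile1// ltW.
have rN : r ^+ n @[n --> \oo] --> 0 by apply: cvg_expr; rewrite gtr0_norm.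
have small (u v : nat -> R) : (forall n, 0 <= u n <= T) -> (forall n, 0 <= v n <= 1) ->
    u n * v n @[n --> \oo] --> 0 -> dint `[0, u n] `[0, v n] h @[n --> \oo] --> 0.
  move=> u0 v0 uv; apply/cvgrPdist_lt => e e0.
  have [del del0 H] := dint_corner_cvg0 mh ih e0.
  have /cvgrPdist_lt/(_ del del0) := uv; apply: filterS => n; rewrite !sub0r !normrN => uvn.
  have /andP[? ?] := u0 n; have /andP[? ?] := v0 n.
  by apply: H => //; apply: le_lt_trans uvn; exact: ler_norm.
rewrite (_ : cell_sum T r h = fun N => dint `[0, T] `[0, 1] h - dint `[0, T * r ^+ N] `[0, 1] h
    - dint `[0, T] `[0, r ^+ N] h + dint `[0, T * r ^+ N] `[0, r ^+ N] h); last first.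
  by apply/funext => N; exact: cell_sumE.
rewrite -[X in _ --> X]addr0 -[X in _ --> X + _]subr0 -[X in _ --> X - _ + _]subr0.
have TrN : T * r ^+ n @[n --> \oo] --> 0 by rewrite -(mulr0 T); apply: cvgM => //; exact: cvg_cst.
apply: cvgD; first apply: cvgB; first apply: cvgB.
- exact: cvg_cst.
- apply: small => [n|n|]; rewrite ?ler01 ?lexx ?mulr_ge0 ?ler_piMr//.
  by under eq_fun do rewrite mulr1.
- by apply: small => [n|n|//]; rewrite ?T0 ?lexx ?rn ?rn1.
- apply: small => [n|n|]; rewrite ?rn ?rn1 ?mulr_ge0 ?ler_piMr//.
  by rewrite -(mulr0 0); apply: cvgM.
Qed.

(** If [M] is the right-hand side, each [|a i|] is at most [w i] times the m-th root of [M], and the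
    weights sum to at most 1. Being pointwise, the inequality can be integrated term by term. *)
Lemma norm_sum_powR_le (R : realType) (I : Type) (s : seq I) (a w : I -> R) (m : R) : 0 < m ->
  (forall i, 0 < w i) -> \sum_(i <- s) w i <= 1 ->
  `|\sum_(i <- s) a i| `^ m <= \sum_(i <- s) (`|a i| / w i) `^ m.
Proof.
move=> m0 w0 w1; set M := \sum_(i <- s) _.
have M0 : 0 <= M by apply: sumr_ge0 => i _; exact: powR_ge0.
have -> : M = (M `^ m^-1) `^ m by rewrite -powRrM mulVf ?gt_eqF// powRr1.
apply: ge0_ler_powR; rewrite ?nnegrE ?(ltW m0) ?powR_ge0//.
apply: (@le_trans _ _ (\sum_(i <- s) w i * M `^ m^-1)); last first.
  by rewrite -mulr_suml ler_piMl// powR_ge0.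
apply: (le_trans (ler_norm_sum _ _ _)).
rewrite /M; clear M M0 w1; elim: s => [|i s IH]; first by rewrite !big_nil.
have S0 (t : seq I) : 0 <= \sum_(i <- t) (`|a i| / w i) `^ m.
  by apply: sumr_ge0 => j _; exact: powR_ge0.
have mono x y : 0 <= x -> x <= y -> x `^ m^-1 <= y `^ m^-1.
  move=> x0 xy; apply: ge0_ler_powR; rewrite ?nnegrE ?invr_ge0 ?(ltW m0)//.
  exact: le_trans xy.
rewrite !big_cons; apply: lerD.
  rewrite mulrC -ler_pdivrMr//.
  have {1}-> : `|a i| / w i = ((`|a i| / w i) `^ m) `^ m^-1.
    by rewrite -powRrM mulfV ?gt_eqF// powRr1// divr_ge0// ltW.
  by apply: mono; rewrite ?powR_ge0// lerDl.
apply: (le_trans IH); apply: ler_sum => j _; rewrite ler_wpM2l ?(ltW (w0 j))//.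
by apply: mono => //; rewrite lerDr powR_ge0.
Qed.

(** Away from zero [powR] is an exponential of a logarithm. At [l = 0] that formula fails, and
    [1 <= m] gives domination by [|u n|] itself once this is at most 1. *)
Lemma cvg_norm_powR (R : realType) (m : R) (u : nat -> R) (l : R) : 1 <= m ->
  u @ \oo --> l -> (fun n => `|u n| `^ m) @ \oo --> `|l| `^ m.
Proof.
move=> m1 ul; have m0 : 0 < m by lra.
have nul : `|u n| @[n --> \oo] --> `|l| by exact: cvg_norm.
have [l0|ln0] := eqVneq l 0.
  rewrite l0 normr0 powR0 ?gt_eqF//.
  apply: (@squeeze_cvgr _ _ _ _ (fun=> 0) (fun n => `|u n|)); last 2 first.
  - exact: cvg_cst.
  - by rewrite -(@normr0 R R) -l0.
  have /cvgrPdist_lt/(_ 1 ltr01) := ul; apply: filterS => n; rewrite l0 sub0r normrN => un1.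
  rewrite powR_ge0/=; have [->|un0] := eqVneq (u n) 0; first by rewrite normr0 powR0 ?gt_eqF.
  by apply: ge1r_powR => //; rewrite normr_gt0 un0 ltW.
have l0 : 0 < `|l| by rewrite normr_gt0.
rewrite {2}/powR gt_eqF//.
have H : (fun n => expR (m * ln `|u n|)) @ \oo --> expR (m * ln `|l|).
  apply: (@continuous_cvg nat R R \oo _ (fun n => m * ln `|u n|) expR); first exact: continuous_expR.
  apply: cvgM; first exact: cvg_cst.
  by apply: (@continuous_cvg nat R R \oo _ (fun n => `|u n|) (@ln R)) => //; exact: continuous_ln.
apply: cvg_trans H; apply: near_eq_cvg.
have /cvgrPdist_lt/(_ `|l| l0) := nul; apply: filterS => n; rewrite /powR.
case: eqVneq => // ->; rewrite subr0 normr_id ltxx//.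
Qed.

(** (H3) for a single process, with [f] measurable on the whole plane so that sections and products
    need no restriction. *)
Definition moment_hyp (R : realType) (T m C : R) d (Om : measurableType d)
    (P : probability Om R) (th : Om -> R -> R -> R) :=
  forall s0 s0' x0 x0' : R,
    0 < s0 -> s0 < s0' -> s0' < 2 * s0 -> s0' <= T ->
    0 < x0 -> x0 < x0' -> x0' < 2 * x0 -> x0' <= 1 ->
    forall f : R -> R -> R, measurable_fun setT (fun z : R * R => f z.1 z.2) ->
    (enorm `[0%R, T] `[0%R, 1%R] f 2 < +oo)%E ->
    (\int[P]_w ((`| dint `[s0, s0'] `[x0, x0'] (fun s y => f s y * th w s y) | `^ m)%:E)
      <= (C * fine (enorm `[s0, s0'] `[x0, x0'] f 2) `^ (m / 2))%:E)%E.

(** The first factor is the price of normalising the weights (1 - sg)^2 sg^(k+l); the second bounds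
    the double geometric sum of the remaining sg^(k+l). *)
Definition cell_const (R : realType) (sg m : R) : R :=
  (((1 - sg)^-1) ^+ 2) `^ m * ((1 - sg)^-1) ^+ 2.

Lemma sum_geom_le (R : realType) (sg : R) (n : nat) : 0 < sg -> sg < 1 ->
  \sum_(k < n) sg ^+ k <= (1 - sg)^-1.
Proof.
move=> s0 s1; have p : 0 < 1 - sg by rewrite subr_gt0.
rewrite -[leRHS]mul1r ler_pdivlMr// mulrC -[X in X <= _]opprK -mulNr opprB.
by rewrite -subrX1 opprB gerBl exprn_ge0// ltW.
Qed.

Lemma measurable_dint_mul (R : realType) d (Om : measurableType d)
    (th : Om -> R -> R -> R) (f : R -> R -> R) (A B : set R) :
  measurable A -> measurable B ->
  measurable_fun setT (fun z : Om * (R * R) => th z.1 z.2.1 z.2.2) ->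
  measurable_fun setT (fun z : R * R => f z.1 z.2) ->
  measurable_fun setT (fun w => dint A B (fun s y => f s y * th w s y)).
Proof.
move=> mA mB mth mf.
apply: (@measurable_dint R _ _ (fun w s y => f s y * th w s y)) => //.
apply: measurable_funM => //.
exact: (measurableT_comp mf measurable_snd).
Qed.

(** Origin of the exponent 4: the power m/2 turns sg^(4n) into sg^(2nm), the weight consumes
    sg^(nm), and what remains, sg^(nm) <= sg^n, is still summable. *)
Lemma cell_algebra (R : realType) (sg m C G : R) (n : nat) :
  0 < sg -> sg < 1 -> 1 <= m -> 0 <= C -> 0 <= G ->
  ((1 - sg) ^+ 2 * sg ^+ n)^-1 `^ m * (C * (G * sg ^+ (4 * n)) `^ (m / 2)) <=
  C * G `^ (m / 2) * (((1 - sg)^-1) ^+ 2) `^ m * sg ^+ n.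
Proof.
move=> s0 s1 m1 C0 G0; have p : 0 < 1 - sg by rewrite subr_gt0.
have q : 0 < (1 - sg) ^+ 2 * sg ^+ n by rewrite mulr_gt0// exprn_gt0.
rewrite (_ : 4 * n = (2 * n) * 2)%N; last by lia.
rewrite exprM powRM ?sqr_ge0//.
have -> : (sg ^+ (2 * n) ^+ 2) `^ (m / 2) = (sg ^+ (2 * n)) `^ m.
  by rewrite -powR_mulrn ?exprn_ge0 ?(ltW s0)// -powRrM; congr (_ `^ _); field.
rewrite [leLHS](_ : _ = C * G `^ (m / 2) *
  (((1 - sg) ^+ 2 * sg ^+ n)^-1 `^ m * (sg ^+ (2 * n)) `^ m)); last by ring.
rewrite -!(mulrA (C * _)) ler_wpM2l ?mulr_ge0 ?powR_ge0//.
rewrite -powRM ?invr_ge0 ?exprn_ge0 ?(ltW s0) ?(ltW q)//.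
rewrite (_ : (_)^-1 * _ = ((1 - sg)^-1) ^+ 2 * (sg ^+ n)); last first.
  by rewrite mul2n -addnn exprD; field; rewrite expf_neq0 ?gt_eqF.
rewrite powRM ?exprn_ge0 ?invr_ge0 ?(ltW s0) ?(ltW p)// ler_wpM2l ?powR_ge0//.
by apply: ge1r_powR => //; rewrite exprn_gt0// exprn_ile1// ltW.
Qed.

(* The cell (k,l) receives the weight [(1 - sg)^2 sg^(k+l)] in [norm_sum_powR_le]. *)
Lemma moment_bound (R : realType) (T m C sg r : R) d (Om : measurableType d)
    (P : probability Om R) (th : Om -> R -> R -> R) (f : R -> R -> R) (G : R) :
  0 < T -> 1 <= m -> 0 <= C -> 0 < sg -> sg < 1 -> 1 < 2 * r -> r < 1 ->
  measurable_fun setT (fun z : Om * (R * R) => th z.1 z.2.1 z.2.2) ->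
  (forall w, enorm `[0%R, T] `[0%R, 1%R] (th w) 2 < +oo)%E ->
  moment_hyp T m C P th ->
  measurable_fun setT (fun z : R * R => f z.1 z.2) ->
  (enorm `[0%R, T] `[0%R, 1%R] f 2 < +oo)%E -> 0 <= G ->
  (forall k l : nat, enorm `[(T * r ^+ k.+1)%R, (T * r ^+ k)%R] `[(r ^+ l.+1)%R, (r ^+ l)%R] f 2
      <= (G * sg ^+ (4 * (k + l)))%:E)%E ->
  (\int[P]_w ((`| dint `[0%R, T] `[0%R, 1%R] (fun s y => f s y * th w s y) | `^ m)%:E)
      <= (C * cell_const sg m * G `^ (m / 2))%:E)%E.
Proof.
move=> T0 m1 C0 s0 s1 r2 r1 mth thL H3 mf fL G0 fc.
have r0 : 0 < r by lra.
have m0 : 0 < m by lra.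
have mfth w : measurable_fun setT (fun z : R * R => f z.1 z.2 * th w z.1 z.2).
  apply: measurable_funM => //.
  exact: (@measurable_fun_pair2 _ _ _ _ _ _ (fun z : Om * (R * R) => th z.1 z.2.1 z.2.2) w mth).
have mthw w : measurable_fun setT (fun z : R * R => th w z.1 z.2).
  exact: (@measurable_fun_pair2 _ _ _ _ _ _ (fun z : Om * (R * R) => th z.1 z.2.1 z.2.2) w mth).
have ifth w : (leb2 R).-integrable (`[0, T] `*` `[0, 1]) (fun z => (f z.1 z.2 * th w z.1 z.2)%:E).
  exact (@integrable_mul_L2 R `[0, T] `[0, 1] f (th w) (measurable_itv _) (measurable_itv _) mf (mthw w) fL (thL w)).
pose a (k l : nat) w := dint `[T * r ^+ k.+1, T * r ^+ k] `[r ^+ l.+1, r ^+ l] (fun s y => f s y * th w s y).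
have ma k l : measurable_fun setT (a k l) by exact: measurable_dint_mul.
have mpow (u : Om -> R) : measurable_fun setT u -> measurable_fun setT (fun w => (`|u w| `^ m)%:E).
  move=> mu; apply/measurable_EFinP.
  apply: (measurableT_comp (measurable_powR m)); exact: measurableT_comp.
pose b (k l : nat) := (1 - sg) ^+ 2 * sg ^+ (k + l).
have p : 0 < 1 - sg by rewrite subr_gt0.
have b0 k l : 0 < b k l by rewrite mulr_gt0// exprn_gt0.
have aC k l : (\int[P]_w ((`|a k l w| / b k l) `^ m)%:E <=
    (C * G `^ (m / 2) * (((1 - sg)^-1) ^+ 2) `^ m * (sg ^+ k * sg ^+ l))%:E)%E.
  under eq_integral do rewrite powRM ?normr_ge0 ?invr_ge0 ?(ltW (b0 k l))// mulrC EFinM.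
  rewrite ge0_integralZl_EFin//; [|exact: mpow|exact: powR_ge0].
  have rk n : 0 < r ^+ n by rewrite exprn_gt0.
  have rk1 n : r ^+ n <= 1 by rewrite exprn_ile1// ltW.
  have rS n : r ^+ n.+1 < r ^+ n by rewrite exprS gtr_pMl.
  (* The condition that the upper end is less than twice the lower one; here [r > 1/2] is used. *)
  have rS2 n : r ^+ n < 2 * r ^+ n.+1 by rewrite exprS mulrA ltr_pMl.
  have H := H3 (T * r ^+ k.+1) (T * r ^+ k) (r ^+ l.+1) (r ^+ l) _ _ _ _ _ _ _ _ f mf fL.
  apply: (@le_trans _ _ ((((b k l)^-1) `^ m)%:E * (C * (G * sg ^+ (4 * (k + l))) `^ (m / 2))%:E)%E).
    rewrite lee_wpmul2l ?lee_fin ?powR_ge0//.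
    apply: (le_trans (H _ _ _ _ _ _ _ _)) => //; rewrite ?mulr_gt0 ?ltr_pM2l//.
    - by rewrite mulrCA ltr_pM2l.
    - by rewrite ler_piMr// ltW.
    rewrite lee_fin ler_wpM2l// ge0_ler_powR ?nnegrE ?divr_ge0 ?(ltW m0)//.
    - by rewrite fine_ge0// integral_ge0// => s _; apply: integral_ge0 => y _; rewrite lee_fin powR_ge0.
    - by rewrite mulr_ge0// exprn_ge0// ltW.
    - rewrite -lee_fin fineK; first exact: fc.
      rewrite ge0_fin_numE; first by apply: le_lt_trans (fc k l) _; rewrite ltry.
      by apply: integral_ge0 => s _; apply: integral_ge0 => y _; rewrite lee_fin powR_ge0.
  by rewrite -EFinM lee_fin -exprD; exact: cell_algebra.
pose S (N : nat) w := cell_sum T r (fun s y => f s y * th w s y) N.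
have mS N : measurable_fun setT (S N).
  apply: measurable_sum => k; apply: measurable_sum => l; exact: ma.
have Scv w : S ^~ w @ \oo --> dint `[0, T] `[0, 1] (fun s y => f s y * th w s y).
  by apply: (cell_sum_cvg (T := T)) => //; rewrite ltW.
(* The moment of the whole integral is reached from the finite cell sums by Fatou, so uniform bounds
   in [N] suffice. *)
apply: (@fatou_le R _ _ P _ (fun N w => (`|S N w| `^ m)%:E)) => //.
- by move=> N; exact: mpow.
- move=> w _; apply: cvg_EFin; first by apply: nearW.
  exact: cvg_norm_powR.
move=> N.
pose I := [seq (k, l) | k <- index_iota 0 N, l <- index_iota 0 N].
pose F := C * G `^ (m / 2) * (((1 - sg)^-1) ^+ 2) `^ m.
have F0 : 0 <= F by rewrite !mulr_ge0 ?powR_ge0.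
apply: (@le_trans _ _ (\int[P]_w \sum_(i <- I) ((`|a i.1 i.2 w| / b i.1 i.2) `^ m)%:E)%E).
  have mab i : measurable_fun setT (fun w => ((`|a i.1 i.2 w| / b i.1 i.2) `^ m)%:E).
    apply/measurable_EFinP; apply: (measurableT_comp (measurable_powR m)).
    by apply: measurable_funM => //; apply: measurableT_comp => //; exact: ma.
  apply: ge0_le_integral => //.
  - exact: mpow.
  - by apply: emeasurable_sum => i; exact: mab.
  move=> w _; rewrite sumEFin lee_fin.
  have -> : S N w = \sum_(i <- I) a i.1 i.2 w.
    rewrite /S /cell_sum big_allpairs/= big_mkord; apply: eq_bigr => k _.
    by rewrite big_mkord.
  apply: (@norm_sum_powR_le R _ I (fun i => a i.1 i.2 w) (fun i => b i.1 i.2)) => //.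
  rewrite big_allpairs/= big_mkord.
  under eq_bigr do rewrite big_mkord /b.
  under eq_bigr do (under eq_bigr do rewrite exprD mulrA; rewrite -mulr_sumr).
  rewrite -mulr_suml -mulr_sumr -mulrA.
  have g0 : 0 <= \sum_(k < N) sg ^+ k by apply: sumr_ge0 => k _; rewrite exprn_ge0// ltW.
  have := sum_geom_le N s0 s1; rewrite -[(1 - sg)^-1]mul1r ler_pdivlMr//.
  set g := \sum_(k < N) sg ^+ k in g0 *; move=> g1.
  rewrite (_ : _ ^+ 2 * _ = (g * (1 - sg)) ^+ 2); last by ring.
  by rewrite exprn_ile1// mulr_ge0// ltW.
rewrite ge0_integral_sum//; last 2 first.
- move=> i; apply/measurable_EFinP; apply: (measurableT_comp (measurable_powR m)).
  by apply: measurable_funM => //; apply: measurableT_comp => //; exact: ma.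
- by move=> i w _; rewrite lee_fin powR_ge0.
apply: (@le_trans _ _ (\sum_(i <- I) (F * (sg ^+ i.1 * sg ^+ i.2))%:E)%E).
  by apply: lee_sum => i _; exact: aC.
rewrite sumEFin lee_fin -mulr_sumr /cell_const.
rewrite (_ : C * _ * _ = F * ((1 - sg)^-1) ^+ 2); last by rewrite /F; ring.
rewrite ler_wpM2l// big_allpairs/= big_mkord.
under eq_bigr do rewrite big_mkord -mulr_sumr.
rewrite -mulr_suml expr2; apply: ler_pM; try exact: sum_geom_le.
- by apply: sumr_ge0 => k _; rewrite exprn_ge0// ltW.
- by apply: sumr_ge0 => k _; rewrite exprn_ge0// ltW.
Qed.

(** * Lipschitz regularisation and dyadic interpolation *)

Lemma integrable_bounded (R : realType) d (Om : measurableType d) (P : probability Om R)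
    (f : Om -> R) (M : R) :
  measurable_fun setT f -> (forall w, `|f w| <= M) -> P.-integrable setT (EFin \o f).
Proof.
move=> mf fM; apply: measurable_bounded_integrable => //.
  by rewrite [X in (X < _)%E](_ : _ = 1%E) ?ltry//; exact: probability_setT.
by exists M; split; [exact: num_real|move=> x Mx w _; apply: le_trans (fM w) (ltW Mx)].
Qed.

Lemma bounded_cvg_Rintegral (R : realType) d (Om : measurableType d) (P : probability Om R)
    (f_ : nat -> Om -> R) (f : Om -> R) (M : R) :
  (forall n, measurable_fun setT (f_ n)) -> (forall n w, `|f_ n w| <= M) ->
  (forall w, f_ ^~ w @ \oo --> f w) ->
  \int[P]_w f_ n w @[n --> \oo] --> \int[P]_w f w.
Proof.
move=> mf fM ff.
have mff : measurable_fun setT f by apply: measurable_fun_cvg mf _ => w _; exact: ff.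
have fM' w : `|f w| <= M.
  have /cvg_norm H := ff w; rewrite -(cvg_lim _ H)//.
  by apply: limr_le; [exact: cvgP H|exact: nearW].
have iM : P.-integrable setT (EFin \o (cst M : Om -> R)).
  by apply: (@integrable_bounded _ _ _ _ _ `|M|).
have [] := @dominated_convergence _ _ _ P setT measurableT (fun n => EFin \o f_ n) (EFin \o f) (EFin \o cst M).
- by move=> n; apply/measurable_EFinP.
- exact/measurable_EFinP.
- by apply: aeW => w _; apply: cvg_EFin; [exact: nearW|exact: ff].
- exact: iM.
- by apply: aeW => w n _; rewrite lee_fin.
move=> _ _ H; rewrite /Rintegral.
apply: (fine_cvg (f := fun n => (\int[P]_x (EFin \o f_ n) x)%E)).
rewrite fineK//; apply: integrable_fin_num => //.
exact: (integrable_bounded P mff fM').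
Qed.

Lemma measurable_countable_fiber (R : realType) d (Om : measurableType d) (C : countType)
    (code : Om -> C) (phi : C -> R) :
  (forall c, measurable [set w | code w = c]) -> measurable_fun setT (phi \o code).
Proof.
move=> mc _ Y mY; rewrite setTI.
rewrite (_ : _ @^-1` _ = \bigcup_(n in [set n | exists2 c, unpickle n = Some c & Y (phi c)])
    [set w | unpickle n = Some (code w)]).
  apply: bigcup_measurable => n [c nc Yc].
  rewrite (_ : [set w | _] = [set w | code w = c])//.
  by apply/seteqP; split => w /=; rewrite nc; [case=> ->|move=> ->].
apply/seteqP; split => [w /= Yw|w [n [c nc Yc] /= nw]].
  by exists (pickle (code w)); [exists (code w)|]; rewrite /= ?pickleK.
by move: nw; rewrite nc => -[<-].
Qed.

(** The vector is rounded down to the grid of mesh 1/(n+1). The rounded vector takes countably many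
    values on measurable fibres, so any function of it is measurable, and continuity of [g] recovers
    the limit; no sigma-algebra on row vectors intervenes. *)
Lemma measurable_continuous_row (R : realType) d (Om : measurableType d) (k : nat)
    (Y : 'I_k -> Om -> R) (g : 'rV[R]_k -> R) :
  (forall i, measurable_fun setT (Y i)) -> continuous g ->
  measurable_fun setT (fun w => g (\row_i Y i w)).
Proof.
move=> mY cg.
pose code n w : {ffun 'I_k -> int} := [ffun i => Num.floor (n.+1%:R * Y i w)].
pose dec (n : nat) (c : {ffun 'I_k -> int}) : 'rV[R]_k := \row_i ((c i)%:~R / n.+1%:R).
apply: (@measurable_fun_cvg _ _ _ setT (fun n w => g (dec n (code n w)))).
  move=> n; apply: (@measurable_countable_fiber _ _ _ _ (code n) (g \o dec n)) => c.
  rewrite (_ : [set w | _] = \bigcap_(i in [set: 'I_k]) [set w | Num.floor (n.+1%:R * Y i w) = c i]).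
    apply: fin_bigcap_measurable; first exact: finite_finset.
    move=> i _.
    rewrite (_ : [set w | _] = setT `&` (fun w => n.+1%:R * Y i w) @^-1` `[(c i)%:~R, (c i + 1)%:~R[%classic).
      by apply: measurable_funM => //; exact: measurable_cst.
    apply/seteqP; split => w /=; rewrite in_itv/=.
      by move=> <-; split => //; rewrite floor_le floorD1_gt.
    by move=> [_ /andP[a b]]; apply: floor_def; rewrite a b.
  apply/seteqP; split => w /= => [<- i _|H]; first by rewrite ffunE.
  by apply/ffunP => i; rewrite ffunE; exact: H.
move=> w _; apply: (@continuous_cvg nat _ _ \oo _ (fun n => dec n (code n w)) g); first exact: cg.
apply/cvg_ballP => e e0.
have [N _ HN] := near_infty_natSinv_lt (PosNum e0).
exists N => // n /= /HN /= ne; split=> // i j; rewrite !mxE ffunE /ball/=.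
have n0 : 0 < n.+1%:R :> R by rewrite ltr0n.
have /andP[lo up] := floor_itv (n.+1%:R * Y j w).
move: lo up; rewrite intrD; set q := (Num.floor _)%:~R => lo up.
rewrite ltr_norml; apply/andP; split.
  apply: (@lt_le_trans _ _ 0); first by rewrite oppr_lt0.
  by rewrite subr_ge0 ler_pdivrMr// mulrC.
apply: le_lt_trans ne; rewrite -(ler_pM2l n0) mulrBr [_ * (q / _)]mulrCA !divff ?gt_eqF// mulr1.
by rewrite lerBlDr addrC ltW.
Qed.

Lemma compact_rectK (R : realType) (T : R) : compact (rectK T).
Proof. by apply: compact_setX; exact: segment_compact. Qed.

Lemma contK_bounded (R : realType) (T : R) (g : R -> R -> R) : contK T g ->
  exists B, forall t x, rectK T (t, x) -> `|g t x| <= B.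
Proof.
move=> cg; have /compact_bounded [B [_ HB]] := continuous_compact cg (@compact_rectK R T).
exists (B + 1) => t x Ktx; apply: (HB (B + 1)); first by rewrite ltrDl.
by exists (t, x).
Qed.

Lemma contK_unif (R : realType) (T : R) (g : R -> R -> R) (e : R) : contK T g -> 0 < e ->
  exists2 del, 0 < del & forall t x t' x', rectK T (t, x) -> rectK T (t', x') ->
    `|t - t'| < del -> `|x - x'| < del -> `|g t x - g t' x'| < e.
Proof.
move=> cg e0; have /compact_near_coveringP cK := @compact_rectK R T.
pose P (del : R) (z : R * R) := rectK T z -> forall z', rectK T z' ->
  `|z.1 - z'.1| < del -> `|z.2 - z'.2| < del -> `|g z.1 z.2 - g z'.1 z'.2| < e.
have [] := cK R (0 : R)^'+ P _.
  move=> z Kz.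
  have /(_ z Kz) /cvgrPdist_lt/(_ (e / 2)) := (subspace_continuousP _ _).1 cg.
  rewrite divr_gt0// => /(_ isT) /nbhs_ballP[d /= d0 Hd].
  refine (ex_intro2 _ _ (ball z (d / 2), `]0, (d / 2)[%classic) _ _) => /=.
    split; first by apply: nbhsx_ballx; rewrite divr_gt0.
    by near=> x; rewrite /= in_itv/=; apply/andP; split; near: x; [exact: nbhs_right_gt|apply: nbhs_right_lt; rewrite divr_gt0].
  move=> [z1 del] /= [[B1 B2]]; rewrite in_itv/= => /andP[del0 deld] Kz1 z' Kz' D1 D2.
  have A1 : `|g z.1 z.2 - g z1.1 z1.2| < e / 2.
    apply: Hd => //; split; rewrite /ball/= in B1 B2 *; lra.
  have A2 : `|g z.1 z.2 - g z'.1 z'.2| < e / 2.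
    apply: Hd => //; split; rewrite /ball/= in B1 B2 *.
      rewrite -(subrK z1.1 z.1) -addrA; apply: (le_lt_trans (ler_normD _ _)); lra.
    rewrite -(subrK z1.2 z.2) -addrA; apply: (le_lt_trans (ler_normD _ _)); lra.
  rewrite -(subrK (g z.1 z.2) (g z1.1 z1.2)) -addrA; apply: (le_lt_trans (ler_normD _ _)).
  rewrite distrC; lra.
move=> del /= del0 H.
exists (del / 2); first by rewrite divr_gt0.
move=> t x t' x' K1 K2 D1 D2.
apply: (H (del / 2) _ _ (t, x) K1 K1 (t', x') K2 D1 D2).
- by rewrite /ball_/= sub0r normrN gtr0_norm ?divr_gt0//; lra.
- by rewrite divr_gt0.
Unshelve. all: by end_near.
Qed.

(** An upper bound for the sup distance stands in for the distance itself, which also makes sense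
    for discontinuous interpolations and avoids suprema. *)
Definition sup_le (R : realType) (T : R) (g h : R -> R -> R) (d : R) : Prop :=
  0 <= d /\ forall t x, rectK T (t, x) -> `|g t x - h t x| <= d.

(* Infimal convolution of [F] with [k] times the sup distance on [rectK T], the penalty being capped
   so that it stays bounded; [g] itself need not be continuous. *)
Definition lip_reg (R : realType) (T : R) (F : (R -> R -> R) -> R) (M k : R) (g : R -> R -> R) : R :=
  inf [set F p.1 + Num.min (k * p.2) (2 * M) | p in
    [set p : (R -> R -> R) * R | contK T p.1 /\ sup_le T g p.1 p.2]].

Definition boundedK (R : realType) (T : R) (g : R -> R -> R) : Prop :=
  exists B, forall t x, rectK T (t, x) -> `|g t x| <= B.

Lemma contK0 (R : realType) (T : R) : contK T (fun _ _ : R => 0).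
Proof. by apply: continuous_subspaceT => x; exact: cvg_cst. Qed.

Lemma lip_reg_has_inf (R : realType) (T : R) (F : (R -> R -> R) -> R) (M k : R) (g : R -> R -> R) :
  0 <= T -> 0 <= k -> (forall g, `|F g| <= M) -> boundedK T g ->
  has_inf [set F p.1 + Num.min (k * p.2) (2 * M) | p in
    [set p : (R -> R -> R) * R | contK T p.1 /\ sup_le T g p.1 p.2]].
Proof.
move=> T0 k0 FM [B gB]; have M0 : 0 <= M by apply: le_trans (FM (fun _ _ => 0)).
split.
  exists (F (fun _ _ => 0) + Num.min (k * B) (2 * M)); exists (fun _ _ => 0, B) => //=.
  split; first exact: contK0.
  split; last by move=> t x K; rewrite subr0; exact: gB.
  by apply: le_trans (gB 0 0 _) => //; split; rewrite /= ?in_itv/= ?lexx ?T0 ?ler01.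
exists (- M) => _ [[h d] /= [_ [d0 _]] <-].
have /ler_normlP [+ _] := FM h; have : 0 <= Num.min (k * d) (2 * M) by rewrite le_min !mulr_ge0.
lra.
Qed.

Lemma lip_reg_bounds (R : realType) (T : R) (F : (R -> R -> R) -> R) (M k : R) (g : R -> R -> R) :
  0 <= T -> 0 <= k -> (forall g, `|F g| <= M) -> boundedK T g ->
  `|lip_reg T F M k g| <= 3 * M.
Proof.
move=> T0 k0 FM bg; have [[_ [[h d] /= hd _]] hlb] := lip_reg_has_inf T0 k0 FM bg.
have M0 : 0 <= M by apply: le_trans (FM (fun _ _ => 0)).
have /ler_normlP [F1 F2] := FM h.
rewrite ler_norml; apply/andP; split.
  apply: lb_le_inf; first by eexists; exists (h, d).
  move=> _ [[h' d'] /= [_ [d0 _]] <-].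
  have /ler_normlP [+ _] := FM h'; have : 0 <= Num.min (k * d') (2 * M) by rewrite le_min !mulr_ge0.
  lra.
apply: (@le_trans _ _ (F h + Num.min (k * d) (2 * M))).
  by apply: ge_inf => //; exists (h, d).
have : Num.min (k * d) (2 * M) <= 2 * M by rewrite ge_min lexx orbT.
lra.
Qed.

(** A competitor [(h, e)] for [v] yields the competitor [(h, e + d)] for [u], at an extra cost of at
    most [k * d], since capping at [2 * M] does not increase differences. *)
Lemma lip_reg_lipschitz (R : realType) (T : R) (F : (R -> R -> R) -> R) (M k d : R) (g g' : R -> R -> R) :
  0 <= T -> 0 <= k -> (forall g, `|F g| <= M) -> boundedK T g -> boundedK T g' -> sup_le T g g' d ->
  `|lip_reg T F M k g - lip_reg T F M k g'| <= k * d.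
Proof.
move=> T0 k0 FM.
suff H (u v : R -> R -> R) : boundedK T u -> boundedK T v -> sup_le T u v d ->
    lip_reg T F M k u <= lip_reg T F M k v + k * d.
  move=> bg bg' [d0 gd]; rewrite ler_distl; apply/andP; split.
    rewrite lerBlDr; apply: H => //; split => // t x K.
    by rewrite distrC; exact: gd.
  by apply: H.
move=> bu bv [d0 ud]; rewrite -lerBlDr; apply: lb_le_inf.
  by have [] := lip_reg_has_inf T0 k0 FM bv.
move=> _ [[h e] /= [ch [e0 he]] <-]; rewrite lerBlDr.
have [_ hlb] := lip_reg_has_inf T0 k0 FM bu.
apply: (@le_trans _ _ (F h + Num.min (k * (e + d)) (2 * M))).
  apply: ge_inf => //; exists (h, e + d) => //; split => //; split; first exact: addr_ge0.
  move=> t x K; rewrite /= [e + d]addrC -(subrK (v t x) (u t x)) -addrA.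
  by apply: (le_trans (ler_normD _ _)); apply: lerD; [exact: ud|exact: he].
rewrite -addrA lerD2l mulrDr; have kd : 0 <= k * d by exact: mulr_ge0.
by case: (leP (k * e) (2 * M)) => _; rewrite ge_min ?lexx// lerDl kd orbT.
Qed.

Lemma lip_reg_le (R : realType) (T : R) (F : (R -> R -> R) -> R) (M k : R) (g : R -> R -> R) :
  0 <= T -> 0 <= k -> (forall g, `|F g| <= M) -> contK T g -> lip_reg T F M k g <= F g.
Proof.
move=> T0 k0 FM cg; have [_ hlb] := lip_reg_has_inf T0 k0 FM (contK_bounded cg).
have M0 : 0 <= M by apply: le_trans (FM (fun _ _ => 0)).
apply: ge_inf => //; exists (g, 0) => /=.
  by split => //; split => // t x _; rewrite subrr normr0.
by rewrite mulr0 min_l ?addr0// mulr_ge0.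
Qed.

(** The cap [2 * M] is the largest possible oscillation of [F]. Once [k * del >= 2 * M], a
    competitor at distance at least [del] pays the full cap and cannot go below [F g]; closer ones
    are within [e] by continuity of [F] at [g]. *)
Lemma lip_reg_cvg (R : realType) (T : R) (F : (R -> R -> R) -> R) (M : R) (g : R -> R -> R) :
  0 <= T -> test_functional T F -> (forall g, `|F g| <= M) -> contK T g ->
  (fun k : nat => lip_reg T F M k%:R g) @ \oo --> F g.
Proof.
move=> T0 [_ [_ Fc]] FM cg; have M0 : 0 <= M by apply: le_trans (FM (fun _ _ => 0)).
apply/cvgrPdist_le => e e0; have [del del0 Hdel] := Fc g cg e e0.
near=> k.
have kb : 2 * M / del <= k%:R by near: k; exact: nbhs_infty_ger.
rewrite ger0_norm ?subr_ge0; last by apply: lip_reg_le.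
rewrite lerBlDr -lerBlDl; have bg := contK_bounded cg.
apply: lb_le_inf; first by have [] := lip_reg_has_inf T0 (ler0n _ k) FM bg.
move=> _ [[h d] /= [ch [d0 hd]] <-].
have [ddel|deld] := ltP d del.
  have := Hdel h ch (fun t x K => le_lt_trans (hd t x K) ddel).
  have : 0 <= Num.min (k%:R * d) (2 * M) by rewrite le_min !mulr_ge0.
  rewrite ltr_norml => ? /andP[]; lra.
rewrite min_r; last first.
  by move: kb; rewrite ler_pdivrMr// => /le_trans; apply; rewrite ler_wpM2l.
have /ler_normlP [+ _] := FM h; have /ler_normlP [_ +] := FM g; lra.
Unshelve. all: by end_near.
Qed.

(** The index is capped at [2 ^ j], so every natural number gives a point of [0,T] and the increment
    bounds carry no side condition on indices. *)
Definition tnode (R : realType) (T : R) (j i : nat) : R := T * ((minn i (2 ^ j))%:R / (2 ^ j)%:R).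

Definition dyadic_interp (R : realType) (T : R) (j : nat) (g : R -> R -> R) (t x : R) : R :=
  g (tnode T j (Num.truncn ((2 ^ j)%:R * (t / T)))) (tnode 1 j (Num.truncn ((2 ^ j)%:R * x))).

Lemma tnode_itv (R : realType) (T : R) (j i : nat) : 0 <= T -> 0 <= tnode T j i <= T.
Proof.
move=> T0; have n0 : 0 < (2 ^ j)%:R :> R by rewrite ltr0n expn_gt0.
rewrite /tnode mulr_ge0 ?divr_ge0//= ler_piMr// ler_pdivrMr// mul1r ler_nat geq_minr//.
Qed.

Lemma rectK_tnode (R : realType) (T : R) (j i i' : nat) : 0 <= T ->
  rectK T (tnode T j i, tnode 1 j i').
Proof. by move=> T0; split; rewrite /= in_itv/= tnode_itv. Qed.

Lemma trunc_le (R : realType) (j : nat) (u : R) : 0 <= u <= 1 ->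
  (Num.truncn ((2 ^ j)%:R * u) <= 2 ^ j)%N.
Proof.
move=> /andP[u0 u1]; rewrite -(ler_nat R).
apply: le_trans (_ : (2 ^ j)%:R * u <= _); last by rewrite ler_piMr.
by rewrite truncn_le mulr_ge0.
Qed.

Lemma tnode_trunc (R : realType) (T : R) (j : nat) (t : R) : 0 < T -> 0 <= t <= T ->
  `|t - tnode T j (Num.truncn ((2 ^ j)%:R * (t / T)))| <= T / (2 ^ j)%:R.
Proof.
move=> T0 /andP[t0 tT]; have n0 : 0 < (2 ^ j)%:R :> R by rewrite ltr0n expn_gt0.
have u01 : 0 <= t / T <= 1 by rewrite divr_ge0 ?(ltW T0)//= ler_pdivrMr// mul1r.
rewrite /tnode (minn_idPl _) ?trunc_le//.
have {1}-> : t = T * ((2 ^ j)%:R * (t / T) / (2 ^ j)%:R) by field; rewrite !gt_eqF.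
rewrite -mulrBr normrM gtr0_norm// ler_pM2l// -mulrBl normrM [X in _ * X]gtr0_norm ?invr_gt0//.
rewrite ler_piMl ?invr_ge0 ?(ltW n0)//.
have /andP[] := truncn_itv (mulr_ge0 (ltW n0) (andP u01).1).
set q := Num.truncn _ => lo up; rewrite ger0_norm ?subr_ge0//.
by rewrite lerBlDr -natr1 in up *; rewrite addrC ltW.
Qed.

Lemma dyadic_interp_cvg (R : realType) (T : R) (g : R -> R -> R) : 0 < T -> contK T g ->
  forall e, 0 < e -> \forall j \near \oo, sup_le T g (dyadic_interp T j g) e.
Proof.
move=> T0 cg e e0; have [del del0 H] := contK_unif cg e0.
near=> j; split; first exact: ltW.
have j2 : (T + 1) / del < (2 ^ j)%:R.
  apply: lt_le_trans (_ : j%:R <= _); first by near: j; exact: nbhs_infty_gtr.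
  by rewrite ler_nat ltnW// ltn_expl.
have n0 : 0 < (2 ^ j)%:R :> R by rewrite ltr0n expn_gt0.
move=> t x [/=]; rewrite !in_itv/= => tT x1; apply/ltW/H.
- by split; rewrite /= in_itv/=.
- by apply: rectK_tnode; exact: ltW.
- apply: (le_lt_trans (tnode_trunc j T0 tT)).
  by rewrite ltr_pdivrMr// mulrC -ltr_pdivrMr//; apply: le_lt_trans j2; rewrite ler_pM2r ?invr_gt0// lerDl.
- have := tnode_trunc (T := 1) j ltr01 x1; rewrite divr1 => H1; apply: (le_lt_trans H1).
  rewrite ltr_pdivrMr// mulrC -ltr_pdivrMr//; apply: le_lt_trans j2; rewrite ler_pM2r ?invr_gt0// lerDr.
  exact: ltW.
Unshelve. all: by end_near.
Qed.

(** Nodes form a binary tree in each coordinate: the node read at level [j] is the parent, of halved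
    index, of the one read at level [j.+1]. *)
Lemma trunc_half (R : realType) (j : nat) (u : R) : 0 <= u ->
  Num.truncn ((2 ^ j)%:R * u) = (Num.truncn ((2 ^ j.+1)%:R * u))./2.
Proof.
move=> u0; set q := Num.truncn ((2 ^ j.+1)%:R * u).
have /andP[lo up] : q%:R <= (2 ^ j.+1)%:R * u < q.+1%:R by apply: truncn_itv; rewrite mulr_ge0.
have E : (2 ^ j.+1)%:R * u = 2 * ((2 ^ j)%:R * u) :> R by rewrite expnS natrM mulrA.
move: lo up; rewrite E => lo up; apply: truncn_def.
have h1 : (q./2 * 2 <= q)%N by have := odd_double_half q; lia.
have h2 : (q.+1 <= q./2.+1 * 2)%N by have := odd_double_half q; case: (odd q) => /=; lia.
move: h1 h2; rewrite -!(ler_nat R) !natrM => h1 h2.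
by apply/andP; split; lra.
Qed.

Lemma dyadic_interp_bounded (R : realType) (T : R) (j : nat) (g : R -> R -> R) : 0 <= T ->
  boundedK T g -> boundedK T (dyadic_interp T j g).
Proof. by move=> T0 [B gB]; exists B => t x _; apply: gB; exact: rectK_tnode. Qed.

(** If [y > lam], then y = y^(1-m) y^m with y^(1-m) <= lam^(1-m). This trades a maximum over nodes
    for a sum of m-th powers, whose expectation is computable. *)
Lemma le_lam_powR (R : realType) (m lam y : R) : 1 <= m -> 0 < lam -> 0 <= y ->
  y <= lam + lam `^ (1 - m) * y `^ m.
Proof.
move=> m1 l0 y0; have [yl|ly] := leP y lam; first by rewrite ler_wpDr// mulr_ge0// powR_ge0.
have yp : 0 < y by exact: lt_trans ly.
apply: ler_wpDl; first exact: ltW.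
have {1}-> : y = y `^ (1 - m) * y `^ m by rewrite -powRD ?subrK ?powRr1//; apply/implyP; rewrite gt_eqF.
rewrite ler_wpM2r ?powR_ge0// -[1 - m]opprB !powRN lef_pV2 ?posrE ?powR_gt0//.
by rewrite ge0_ler_powR ?nnegrE ?subr_ge0// ltW.
Qed.

(** * Tightness *)

Definition lip_row (R : realType) (k : nat) (L : R) (g : 'rV[R]_k -> R) : Prop :=
  forall (v v' : 'rV[R]_k) (d : R), 0 <= d -> (forall i, `|v 0 i - v' 0 i| <= d) ->
    `|g v - g v'| <= L * d.

Lemma lip_row_continuous (R : realType) (k : nat) (L : R) (g : 'rV[R]_k -> R) :
  0 <= L -> lip_row L g -> continuous g.
Proof.
move=> L0 Lg v A /nbhs_ballP[e /= e0 eA].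
have d0 : 0 < e / (L + 1) by rewrite divr_gt0// ltr_wpDl.
apply/nbhs_ballP; exists (e / (L + 1)) => //= v' [_ /= vv']; apply: eA; rewrite /ball/=.
apply: (@le_lt_trans _ _ (L * (e / (L + 1)))).
  by apply: Lg => [|i]; [exact: ltW|apply/ltW; exact: vv'].
by rewrite mulrA ltr_pdivrMr ?ltr_wpDl// mulrC ltr_pM2l// ltrDl.
Qed.

(** At each point the two interpolations differ by one parent-child increment; [le_lam_powR] bounds
    it by its m-th power, and adding the powers at all other nodes makes the bound uniform in the
    point. *)
Lemma dyadic_step_le (R : realType) (T m lam : R) (j : nat) (g : R -> R -> R) :
  0 < T -> 1 <= m -> 0 < lam ->
  sup_le T (dyadic_interp T j.+1 g) (dyadic_interp T j g)
    (lam + lam `^ (1 - m) * \sum_(a < (2 ^ j.+1).+1) \sum_(b < (2 ^ j.+1).+1)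
      `|g (tnode T j.+1 a) (tnode 1 j.+1 b) - g (tnode T j a./2) (tnode 1 j b./2)| `^ m).
Proof.
move=> T0 m1 l0; set D := fun a b : nat => `|g (tnode T j.+1 a) (tnode 1 j.+1 b) - g (tnode T j a./2) (tnode 1 j b./2)| `^ m.
have D0 a b : 0 <= D a b by exact: powR_ge0.
have S0 (a : nat) : 0 <= \sum_(b < (2 ^ j.+1).+1) D a b by apply: sumr_ge0.
split.
  by rewrite addr_ge0 ?(ltW l0)// mulr_ge0 ?powR_ge0//; apply: sumr_ge0 => a _; exact: S0.
move=> t x [/=]; rewrite !in_itv/= => tT x1.
have u01 : 0 <= t / T <= 1.
  by case/andP: tT => t0 tT; rewrite divr_ge0 ?(ltW T0)//= ler_pdivrMr// mul1r.
rewrite /dyadic_interp (@trunc_half _ j (t / T)) ?(andP u01).1// (@trunc_half _ j x) ?(andP x1).1//.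
have ia := trunc_le j.+1 u01; have ib := trunc_le j.+1 x1.
set a := Num.truncn _ in ia *; set b := Num.truncn _ in ib *.
apply: (le_trans (le_lam_powR m1 l0 (normr_ge0 _))).
rewrite lerD2l ler_wpM2l ?powR_ge0//.
rewrite (bigD1 (Ordinal (ia : (a < (2 ^ j.+1).+1)%N)))//=.
rewrite (bigD1 (Ordinal (ib : (b < (2 ^ j.+1).+1)%N)))//=.
rewrite -addrA lerDl addr_ge0//; first by apply: sumr_ge0.
by apply: sumr_ge0 => a' _; exact: S0.
Qed.

(** The square grid is flattened by Euclidean division by [(2 ^ j).+1]. One spare index makes the
    dimension a successor, as [inord] expects; the cap in [tnode] keeps its point in the
    rectangle. *)
Definition grid_pt (R : realType) (T : R) (j : nat) (i : 'I_((2 ^ j).+1 * (2 ^ j).+1).+1) : R * R :=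
  (tnode T j (i %/ (2 ^ j).+1), tnode 1 j (i %% (2 ^ j).+1)).

Definition grid_fun (R : realType) (T : R) (j : nat)
    (v : 'rV[R]_((2 ^ j).+1 * (2 ^ j).+1).+1) (t x : R) : R :=
  v 0 (inord (minn (Num.truncn ((2 ^ j)%:R * (t / T))) (2 ^ j) * (2 ^ j).+1
              + minn (Num.truncn ((2 ^ j)%:R * x)) (2 ^ j))).

Lemma dyadic_interp_grid (R : realType) (T : R) (j : nat) (g : R -> R -> R) :
  dyadic_interp T j g = grid_fun T (\row_i g (@grid_pt R T j i).1 (grid_pt T i).2).
Proof.
apply/funext => t; apply/funext => x; rewrite /grid_fun mxE /grid_pt/=.
set a := minn _ _; set b := minn _ _.
have bN : (b < (2 ^ j).+1)%N by rewrite ltnS geq_minr.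
have aN : (a < (2 ^ j).+1)%N by rewrite ltnS geq_minr.
have abN : (a * (2 ^ j).+1 + b < ((2 ^ j).+1 * (2 ^ j).+1).+1)%N.
  rewrite ltnS; apply: (@leq_trans (a.+1 * (2 ^ j).+1)).
    by rewrite mulSn addnC leq_add2r ltnW.
  by rewrite leq_mul2r aN orbT.
rewrite inordK// divnMDl// divn_small// addn0 modnMDl modn_small//.
by rewrite /dyadic_interp /tnode /a /b -!minnA !minnn.
Qed.

Lemma grid_fun_bounded (R : realType) (T : R) (j : nat) (v : 'rV[R]_((2 ^ j).+1 * (2 ^ j).+1).+1) :
  boundedK T (grid_fun T v).
Proof.
exists (\sum_i `|v 0 i|) => t x _; rewrite /grid_fun.
set i := inord _; by rewrite [leRHS](bigD1 i)//= lerDl sumr_ge0.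
Qed.

Lemma lip_reg_grid (R : realType) (T M k : R) (F : (R -> R -> R) -> R) (j : nat) :
  0 <= T -> 0 <= k -> (forall g, `|F g| <= M) ->
  lip_row k (fun v => lip_reg T F M k (@grid_fun R T j v)).
Proof.
move=> T0 k0 FM v v' d d0 vd; apply: lip_reg_lipschitz => //; try exact: grid_fun_bounded.
by split => // t x _; exact: vd.
Qed.

Lemma measurable_lip_reg_dyadic (R : realType) (T M k : R) (F : (R -> R -> R) -> R) (j : nat)
    d (Om : measurableType d) (X : Om -> R -> R -> R) :
  0 <= T -> 0 <= k -> (forall g, `|F g| <= M) ->
  (forall t x, measurable_fun setT (fun w => X w t x)) ->
  measurable_fun setT (fun w => lip_reg T F M k (dyadic_interp T j (X w))).
Proof.
move=> T0 k0 FM mX; under eq_fun do rewrite dyadic_interp_grid.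
apply: (@measurable_continuous_row _ _ _ _ (fun i w => X w (grid_pt T i).1 (grid_pt T i).2)
  (fun v => lip_reg T F M k (grid_fun T v))) => //.
by apply: (lip_row_continuous k0); exact: lip_reg_grid.
Qed.

Lemma lip_reg_dyadic_cvg (R : realType) (T M k : R) (F : (R -> R -> R) -> R) (g : R -> R -> R) :
  0 < T -> 0 <= k -> (forall g, `|F g| <= M) -> contK T g ->
  (fun j => lip_reg T F M k (dyadic_interp T j g)) @ \oo --> lip_reg T F M k g.
Proof.
move=> T0 k0 FM cg; apply/cvgrPdist_le => e e0.
have e1 : 0 < e / (k + 1) by rewrite divr_gt0// ltr_wpDl.
apply: filterS (dyadic_interp_cvg T0 cg e1) => j gj.
have bg := contK_bounded cg.
apply: (le_trans (lip_reg_lipschitz (ltW T0) k0 FM bg (dyadic_interp_bounded j (ltW T0) bg) gj)).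
by rewrite mulrA ler_pdivrMr ?ltr_wpDl// mulrC ler_pM2l// lerDl.
Qed.

Lemma measurable_lip_reg (R : realType) (T M k : R) (F : (R -> R -> R) -> R)
    d (Om : measurableType d) (X : Om -> R -> R -> R) :
  0 < T -> 0 <= k -> (forall g, `|F g| <= M) ->
  (forall t x, measurable_fun setT (fun w => X w t x)) -> (forall w, contK T (X w)) ->
  measurable_fun setT (fun w => lip_reg T F M k (X w)).
Proof.
move=> T0 k0 FM mX cX.
apply: (@measurable_fun_cvg _ _ _ setT (fun j w => lip_reg T F M k (dyadic_interp T j (X w)))).
  by move=> j; apply: measurable_lip_reg_dyadic => //; exact: ltW.
by move=> w _; exact: lip_reg_dyadic_cvg.
Qed.

Lemma Rintegral_norm_le (R : realType) d (Om : measurableType d) (P : probability Om R)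
    (f : Om -> R) (g : Om -> \bar R) (c : R) :
  P.-integrable setT (EFin \o f) -> measurable_fun setT g ->
  (forall w, (`|f w|)%:E <= g w)%E -> (\int[P]_w g w <= c%:E)%E -> `|\int[P]_w f w| <= c.
Proof.
move=> fi mg fg gc; have mf : measurable_fun setT f by apply/measurable_EFinP; case/integrableP: fi.
apply: (le_trans (le_normr_Rintegral measurableT fi)).
rewrite -lee_fin /Rintegral fineK; last first.
  by apply: integrable_fin_num => //; exact: (integrable_norm fi).
apply: le_trans gc; apply: ge0_le_integral => //.
by apply/measurable_EFinP; exact: measurableT_comp.
Qed.

Lemma dyadic_count_le (j : nat) : ((2 ^ j.+1).+1 * (2 ^ j.+1).+1 <= 16 * 4 ^ j)%N.
Proof.
have -> : (4 ^ j = 2 ^ j * 2 ^ j)%N by rewrite -expnMn.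
by rewrite expnS; have := expn_gt0 2 j; move: (2 ^ j)%N => a /= a0; nia.
Qed.

(** With threshold [lam = nu ^+ j] and moments of order [(nu ^ m / 4) ^ j], each node contributes
    nu^j / 4^j: the factor 1/4 in the moment bound is there to pay for the 4^j nodes. *)
Lemma powR_scale_step (R : realType) (nu m : R) (j : nat) : 0 < nu ->
  (nu ^+ j) `^ (1 - m) * (nu `^ m / 4) ^+ j = nu ^+ j / 4 ^+ j.
Proof.
move=> nu0; have l0 : 0 < nu ^+ j by rewrite exprn_gt0.
have -> : (nu `^ m / 4) ^+ j = (nu ^+ j) `^ m / 4 ^+ j.
  rewrite expr_div_n; congr (_ / _).
  by rewrite -(powR_mulrn j (powR_ge0 nu m)) -(powR_mulrn j (ltW nu0)) -!powRrM mulrC.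
rewrite mulrA -powRD; last by apply/implyP => _; rewrite gt_eqF.
by rewrite subrK powRr1// ltW.
Qed.

(** The threshold [lam = nu ^+ j] makes both terms of [dyadic_step_le] of order nu^j in expectation;
    16 comes from counting at most 16 * 4^j nodes at level [j.+1]. *)
Lemma dyadic_step_expect (R : realType) (T m nu K M k : R) (F : (R -> R -> R) -> R) (j : nat)
    d (Om : measurableType d) (P : probability Om R) (X : Om -> R -> R -> R) :
  0 < T -> 1 <= m -> 0 < nu -> 0 <= K -> 0 <= k -> (forall g, `|F g| <= M) ->
  (forall t x, measurable_fun setT (fun w => X w t x)) -> (forall w, contK T (X w)) ->
  (forall a b : nat, \int[P]_w ((`| X w (tnode T j.+1 a) (tnode 1 j.+1 b) -
      X w (tnode T j a./2) (tnode 1 j b./2) | `^ m)%:E) <= (K * (nu `^ m / 4) ^+ j)%:E)%E ->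
  `| \int[P]_w lip_reg T F M k (dyadic_interp T j.+1 (X w)) -
     \int[P]_w lip_reg T F M k (dyadic_interp T j (X w)) | <= k * (1 + 16 * K) * nu ^+ j.
Proof.
move=> T0 m1 nu0 K0 k0 FM mX cX inc.
have T0' := ltW T0.
pose G i w := lip_reg T F M k (dyadic_interp T i (X w)).
have bG i w : `|G i w| <= 3 * M.
  by apply: lip_reg_bounds => //; apply: dyadic_interp_bounded => //; exact: contK_bounded.
have mG i : measurable_fun setT (G i) by exact: measurable_lip_reg_dyadic.
have iG i : P.-integrable setT (EFin \o G i) by exact: integrable_bounded (mG i) (bG i).
rewrite -(RintegralB measurableT (iG j.+1) (iG j)).
pose D (a b : nat) w := `|X w (tnode T j.+1 a) (tnode 1 j.+1 b) - X w (tnode T j a./2) (tnode 1 j b./2)| `^ m.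
have mD a b : measurable_fun setT (D a b).
  apply: (measurableT_comp (measurable_powR m)); apply: measurableT_comp => //.
  exact: measurable_funB.
pose N := (2 ^ j.+1).+1.
pose I := [seq (a, b) | a <- index_iota 0 N, b <- index_iota 0 N].
pose lam := nu ^+ j.
have lam0 : 0 < lam by rewrite exprn_gt0.
have lm0 : 0 <= lam `^ (1 - m) by exact: powR_ge0.
apply: (@Rintegral_norm_le _ _ _ _ _ (fun w => (k * lam)%:E + (k * lam `^ (1 - m))%:E *
    \sum_(i <- I) (D i.1 i.2 w)%:E)%E).
- have -> : EFin \o (fun w => G j.+1 w - G j w) = ((EFin \o G j.+1) \- (EFin \o G j))%E by [].
  exact: integrableB.
- apply: emeasurable_funD => //; apply: measurable_funeM.
  by apply: emeasurable_sum => i; apply/measurable_EFinP; exact: mD.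
- move=> w; rewrite sumEFin -EFinM -EFinD lee_fin.
  have st := dyadic_step_le j (X w) T0 m1 lam0.
  have bX := contK_bounded (cX w).
  apply: (le_trans (lip_reg_lipschitz T0' k0 FM (dyadic_interp_bounded _ T0' bX) (dyadic_interp_bounded _ T0' bX) st)).
  rewrite mulrDr mulrA lerD2l ler_wpM2l ?mulr_ge0//.
  rewrite /I big_allpairs/= big_mkord; apply: ler_sum => a _.
  by rewrite big_mkord.
rewrite ge0_integralD//; first last.
- apply: measurable_funeM; apply: emeasurable_sum => i; apply/measurable_EFinP; exact: mD.
- move=> w _; rewrite mule_ge0 ?lee_fin ?mulr_ge0// sumEFin lee_fin.
  by apply: sumr_ge0 => i _; exact: powR_ge0.
- by move=> w _; rewrite lee_fin mulr_ge0// ltW.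
rewrite integral_cst//= [X in (_ * X)%E](_ : _ = 1%E); last exact: probability_setT.
rewrite mule1 ge0_integralZl_EFin ?mulr_ge0//; last 2 first.
- by move=> w _; rewrite sumEFin lee_fin; apply: sumr_ge0 => i _; exact: powR_ge0.
- by apply: emeasurable_sum => i; apply/measurable_EFinP; exact: mD.
rewrite ge0_integral_sum//; last 2 first.
- by move=> i; apply/measurable_EFinP; exact: mD.
- by move=> i w _; rewrite lee_fin powR_ge0.
apply: (@le_trans _ _ ((k * lam)%:E + (k * lam `^ (1 - m))%:E *
    \sum_(i <- I) (K * (nu `^ m / 4) ^+ j)%:E)%E).
  rewrite leeD2l// lee_wpmul2l ?lee_fin ?mulr_ge0//.
  by apply: lee_sum => i _; exact: inc.
rewrite sumEFin -EFinM -EFinD lee_fin.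
rewrite big_const_seq count_predT size_allpairs !size_iota iter_addr addr0 subn0.
have E : lam `^ (1 - m) * (nu `^ m / 4) ^+ j = lam / 4 ^+ j by exact: powR_scale_step.
have N2 : (N * N)%:R <= 16 * 4 ^+ j :> R.
  by rewrite -natrX -natrM ler_nat; exact: dyadic_count_le.
rewrite (_ : k * (1 + 16 * K) * nu ^+ j = k * lam + k * K * (lam / 4 ^+ j) * (16 * 4 ^+ j)); last first.
  by rewrite /lam; field; rewrite expf_neq0.
rewrite lerD2l -[K * _ *+ _]mulr_natr.
rewrite [leLHS](_ : _ = k * K * (lam `^ (1 - m) * (nu `^ m / 4) ^+ j) * (N * N)%:R); last first.
  by ring.
rewrite E; apply: ler_wpM2l N2.
by apply: mulr_ge0; [exact: mulr_ge0|apply: divr_ge0; [exact: ltW|exact: exprn_ge0]].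
Qed.

(** Bounded Lipschitz observables suffice: a regularised functional is Lipschitz in the node values,
    and a Lipschitz constant is what controls the replacement of kernels by step functions. *)
Definition fdd_lip_cvg (R : realType) (T : R) (d : nat -> measure_display)
    (Om : forall n, measurableType (d n)) (P : forall n, probability (Om n) R)
    (Z : forall n, Om n -> R -> R -> R)
    dW (OmW : measurableType dW) (PW : probability OmW R) (W : OmW -> R -> R -> R) : Prop :=
  forall (k : nat) (p : 'I_k -> R * R), (forall i, rectK T (p i)) ->
  forall (g : 'rV[R]_k -> R) (L M : R), 0 <= L -> lip_row L g -> (forall v, `|g v| <= M) ->
    (fun n => \int[P n]_w g (\row_i Z n w (p i).1 (p i).2)) @ \oo -->
      \int[PW]_w g (\row_i W w (p i).1 (p i).2).

(** Measurability is not part of being a test functional. Along continuous paths [F] is the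
    pointwise limit of its regularisations, which are themselves limits of functions of finitely
    many path values. *)
Lemma measurable_test_functional (R : realType) (T : R) (F : (R -> R -> R) -> R)
    d (Om : measurableType d) (Z : Om -> R -> R -> R) :
  0 < T -> test_functional T F ->
  (forall t x, measurable_fun setT (fun w => Z w t x)) -> (forall w, contK T (Z w)) ->
  measurable_fun setT (fun w => F (Z w)).
Proof.
move=> T0 tF mZ cZ; have [[M FM] _] := tF.
apply: (@measurable_fun_cvg _ _ _ setT (fun k w => lip_reg T F M k%:R (Z w))).
  by move=> k; apply: measurable_lip_reg.
by move=> w _; apply: lip_reg_cvg => //; exact: ltW.
Qed.

Section tightness.
Variables (R : realType) (T m nu K : R) (d : nat -> measure_display)
  (Om : forall n, measurableType (d n)) (P : forall n, probability (Om n) R)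
  (X : forall n, Om n -> R -> R -> R)
  (dY : measure_display) (OmY : measurableType dY) (PY : probability OmY R)
  (Y : OmY -> R -> R -> R).
Arguments X : clear implicits.
Hypotheses (T0 : 0 < T) (m1 : 1 <= m) (nu0 : 0 < nu) (nu1 : nu < 1) (K0 : 0 <= K).
Hypothesis mX : forall n t x, measurable_fun setT (fun w => X n w t x).
Hypothesis cX : forall n w, contK T (X n w).
Hypothesis mY : forall t x, measurable_fun setT (fun w => Y w t x).
Hypothesis cY : forall w, contK T (Y w).
Hypothesis inc : forall n j a b : nat, (0 < n)%N ->
  (\int[P n]_w ((`| X n w (tnode T j.+1 a) (tnode 1 j.+1 b) -
      X n w (tnode T j a./2) (tnode 1 j b./2) | `^ m)%:E) <= (K * (nu `^ m / 4) ^+ j)%:E)%E.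
Hypothesis fdd : fdd_lip_cvg T P X PY Y.

(** The one-step bounds form a geometric series in [nu], kept in [tel] as a difference of two tails
    so that the induction closes. The limit in the level is taken for fixed [n], yet the bound does
    not involve [n]. *)
Lemma lip_reg_dyadic_unif (F : (R -> R -> R) -> R) (M k : R) (n j : nat) :
  0 <= k -> (forall g, `|F g| <= M) -> (0 < n)%N ->
  `| \int[P n]_w lip_reg T F M k (X n w) -
     \int[P n]_w lip_reg T F M k (dyadic_interp T j (X n w)) | <= k * (1 + 16 * K) * (nu ^+ j / (1 - nu)).
Proof.
move=> k0 FM n0; have T0' := ltW T0.
pose c := k * (1 + 16 * K).
have c0 : 0 <= c by rewrite mulr_ge0// addr_ge0// mulr_ge0.
pose e i := \int[P n]_w lip_reg T F M k (dyadic_interp T i (X n w)).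
have p : 0 < 1 - nu by rewrite subr_gt0.
have tel i : `|e (j + i)%N - e j| <= c * (nu ^+ j / (1 - nu)) - c * (nu ^+ (j + i) / (1 - nu)).
  elim: i => [|i IH]; first by rewrite addn0 !subrr normr0.
  have st := dyadic_step_expect T0 m1 nu0 K0 k0 FM (@mX n) (@cX n) (fun a b => @inc n (j + i)%N a b n0).
  rewrite addnS -(subrK (e (j + i)%N) (e (j + i).+1)) -addrA.
  apply: (le_trans (ler_normD _ _)); apply: (le_trans (lerD st IH)); rewrite -/c.
  rewrite le_eqVlt; apply/orP; left; apply/eqP; rewrite exprS; field.
  by rewrite gt_eqF.
have ecv : (fun i => `|e (j + i)%N - e j|) @ \oo --> `|\int[P n]_w lip_reg T F M k (X n w) - e j|.
  have E : e @ \oo --> \int[P n]_w lip_reg T F M k (X n w); last first.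
    apply: cvg_norm; apply: cvgB; last exact: cvg_cst.
    under eq_fun do rewrite addnC.
    by move: E; rewrite -(cvg_shiftn j e).
  apply: (@bounded_cvg_Rintegral _ _ _ _ _ _ (3 * M)).
  - by move=> i; apply: measurable_lip_reg_dyadic.
  - move=> i w; apply: lip_reg_bounds => //; apply: dyadic_interp_bounded => //.
    exact: contK_bounded.
  - by move=> w; exact: lip_reg_dyadic_cvg.
rewrite -(cvg_lim _ ecv)//; apply: limr_le; first exact: cvgP ecv.
apply: nearW => i; apply: (le_trans (tel i)); rewrite gerBl mulr_ge0// divr_ge0 ?exprn_ge0 ?ltW//.
Qed.

(** The level [j] is fixed before [n]: it must serve all [X n] at once, by the uniform estimate, and
    [Y], for which bounded convergence is enough. At that level only finitely many path values
    remain. *)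
Lemma lip_reg_expect_cvg (F : (R -> R -> R) -> R) (M k : R) :
  0 <= k -> (forall g, `|F g| <= M) ->
  (fun n => \int[P n]_w lip_reg T F M k (X n w)) @ \oo --> \int[PY]_w lip_reg T F M k (Y w).
Proof.
move=> k0 FM; have T0' := ltW T0; apply/cvgrPdist_lt => e e0.
have p : 0 < 1 - nu by rewrite subr_gt0.
have e4 : 0 < e / 4 by rewrite divr_gt0.
have H1 : (fun j => k * (1 + 16 * K) * (nu ^+ j / (1 - nu))) @ \oo --> 0.
  rewrite -(mulr0 (k * (1 + 16 * K))); apply: cvgM; first exact: cvg_cst.
  rewrite -(mul0r (1 - nu)^-1); apply: cvgM; last exact: cvg_cst.
  by apply: cvg_expr; rewrite gtr0_norm.
have H2 : (fun j => \int[PY]_w lip_reg T F M k (dyadic_interp T j (Y w))) @ \oo -->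
    \int[PY]_w lip_reg T F M k (Y w).
  apply: (@bounded_cvg_Rintegral _ _ _ _ _ _ (3 * M)).
  - by move=> i; apply: measurable_lip_reg_dyadic.
  - move=> i w; apply: lip_reg_bounds => //; apply: dyadic_interp_bounded => //.
    exact: contK_bounded.
  - by move=> w; exact: lip_reg_dyadic_cvg.
have [j [J1 J2]] : exists j, `|0 - k * (1 + 16 * K) * (nu ^+ j / (1 - nu))| < e / 4 /\
    `|\int[PY]_w lip_reg T F M k (Y w) - \int[PY]_w lip_reg T F M k (dyadic_interp T j (Y w))| < e / 4.
  move/cvgrPdist_lt : H1 => /(_ _ e4) H1; move/cvgrPdist_lt : H2 => /(_ _ e4) H2.
  by have [N _ HN] := filterI H1 H2; exists N; exact: HN (leqnn N).
have H3 : (fun n => \int[P n]_w lip_reg T F M k (dyadic_interp T j (X n w))) @ \oo -->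
    \int[PY]_w lip_reg T F M k (dyadic_interp T j (Y w)).
  have H := @fdd _ (@grid_pt R T j) (fun i => @rectK_tnode R T j _ _ T0') (fun v => lip_reg T F M k (grid_fun T v))
    k (3 * M) k0 (@lip_reg_grid R T M k F j T0' k0 FM) (fun v => @lip_reg_bounds R T F M k _ T0' k0 FM (grid_fun_bounded T v)).
  rewrite [X in _ --> X](_ : _ = \int[PY]_w lip_reg T F M k (grid_fun T
      (\row_i Y w (@grid_pt R T j i).1 (grid_pt T i).2))); last first.
    by apply: eq_Rintegral => w _; rewrite dyadic_interp_grid.
  apply: cvg_trans H; apply: near_eq_cvg; apply: nearW => n.
  by apply: eq_Rintegral => w _; rewrite dyadic_interp_grid.
move/cvgrPdist_lt : H3 => /(_ _ e4) H3.
near=> n.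
have n0 : (0 < n)%N by near: n; exact: nbhs_infty_gt.
have A := lip_reg_dyadic_unif j k0 FM n0.
have B : `|\int[PY]_w lip_reg T F M k (dyadic_interp T j (Y w)) -
   \int[P n]_w lip_reg T F M k (dyadic_interp T j (X n w))| < e / 4 by near: n.
move: J1; rewrite sub0r normrN ger0_norm; last first.
  by rewrite !mulr_ge0 ?addr_ge0 ?mulr_ge0 ?exprn_ge0 ?invr_ge0// ltW.
move: J2 A B; rewrite !ltr_norml ler_norml => /andP[? ?] /andP[? ?] /andP[? ?] ?.
apply/andP; split; lra.
Unshelve. all: by end_near.
Qed.

(** One-sided because the regularisations lie below [F]: their order [k] is tuned on the limit
    process alone, and for [X n] the inequality goes the right way at no cost. *)
Lemma cvg_law_lower (F : (R -> R -> R) -> R) (e : R) : test_functional T F -> 0 < e ->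
  \forall n \near \oo, \int[PY]_w F (Y w) - e <= \int[P n]_w F (X n w).
Proof.
move=> tF e0; have T0' := ltW T0; have [[M FM] _] := tF.
have e2 : 0 < e / 2 by rewrite divr_gt0.
have H1 : (fun k : nat => \int[PY]_w lip_reg T F M k%:R (Y w)) @ \oo --> \int[PY]_w F (Y w).
  apply: (@bounded_cvg_Rintegral _ _ _ _ _ _ (3 * M)).
  - by move=> k; apply: measurable_lip_reg.
  - by move=> k w; apply: lip_reg_bounds => //; exact: contK_bounded.
  - by move=> w; exact: lip_reg_cvg.
have [k Hk] : exists k : nat, `|\int[PY]_w F (Y w) - \int[PY]_w lip_reg T F M k%:R (Y w)| < e / 2.
  by move/cvgrPdist_lt : H1 => /(_ _ e2) [N _ HN]; exists N; exact: HN (leqnn N).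
have /cvgrPdist_lt/(_ _ e2) H2 := lip_reg_expect_cvg (ler0n R k) FM.
apply: filterS H2 => n H2.
have H3 : \int[P n]_w lip_reg T F M k%:R (X n w) <= \int[P n]_w F (X n w).
  apply: le_Rintegral => //.
  - apply: (@integrable_bounded _ _ _ _ _ (3 * M)); first exact: measurable_lip_reg.
    by move=> w; apply: lip_reg_bounds => //; exact: contK_bounded.
  - exact: (integrable_bounded (P n) (measurable_test_functional T0 tF (@mX n) (@cX n)) (fun w => FM _)).
  - by move=> w _; exact: lip_reg_le.
move: Hk H2; rewrite !ltr_norml => /andP[? ?] /andP[? ?]; lra.
Qed.

(** The missing upper bound for [F] is the lower bound for [- F], again a test functional. *)
Lemma tight_fdd_cvg_law : cvg_law_C T P X PY Y.
Proof.
move=> F tF; have tNF : test_functional T (fun g => - F g).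
  move: tF => [[M FM] [Fe Fc]]; split; first by exists M => g; rewrite normrN.
  split; first by move=> g h gh; rewrite (Fe g h gh).
  move=> g cg e e0; have [del del0 H] := Fc g cg e e0; exists del => // h ch gh.
  by rewrite -opprD normrN; exact: H.
have [[M FM] _] := tF.
have RN d' (O : measurableType d') (Q : probability O R) (Z : O -> R -> R -> R) :
    (forall t x, measurable_fun setT (fun w => Z w t x)) -> (forall w, contK T (Z w)) ->
    \int[Q]_w (- F (Z w)) = - \int[Q]_w F (Z w).
  move=> mZ cZ.
  have i : Q.-integrable setT (EFin \o (fun w => F (Z w))).
    exact: (integrable_bounded Q (measurable_test_functional T0 tF mZ cZ) (fun w => FM _)).
  rewrite /Rintegral -fineN -integralN//; exact: integrable_add_def.
apply/cvgrPdist_le => e e0.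
have H1 := cvg_law_lower tF e0; have H2 := cvg_law_lower tNF e0.
apply: filterS2 H1 H2 => n; rewrite !RN// => ? ?.
rewrite ler_norml; apply/andP; split; lra.
Qed.
End tightness.

(** * Step functions and the Brownian sheet *)

(* The density with standard deviation [s] is compared with the one for [sqrt 2 * s], which avoids
   computing a second moment. *)
Lemma normal_tail (R : realType) (s e : R) : 0 < s -> 0 < e ->
  (normal_prob 0 s [set x : R | (e < `|x|)%R] <= (8 * s ^+ 2 / e ^+ 2)%:E)%E.
Proof.
move=> s0 e0; have e2 : 0 < e ^+ 2 by rewrite exprn_gt0.
pose r := Num.sqrt 2 * s.
have r0 : 0 < r by rewrite mulr_gt0// sqrtr_gt0.
have r2 : r ^+ 2 = 2 * s ^+ 2 by rewrite exprMn sqr_sqrtr.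
have mS : measurable [set x : R | e < `|x|].
  rewrite (_ : [set x | _] = setT `&` (normr @^-1` `]e, +oo[)); first exact: normr_measurable.
  by rewrite setTI; apply/seteqP; split => x /=; rewrite in_itv/= andbT.
(* With y = x^2 / (4 s^2), the exponentials of the two densities are exp(-2y) and exp(-y). The spare
   exp(-y) is at most 1/y <= 4 s^2 / e^2, and a factor 2 covers the ratio sqrt 2 of the
   normalisations. *)
have pdf_le x : e < `|x| -> normal_pdf 0 s x <= 8 * s ^+ 2 / e ^+ 2 * normal_pdf 0 r x.
  move=> ex; rewrite !normal_pdfE ?gt_eqF// /normal_fun !subr0 r2.
  pose y := x ^+ 2 / (4 * s ^+ 2).
  have s2 : 0 < s ^+ 2 by rewrite exprn_gt0.
  have -> : - x ^+ 2 / (s ^+ 2 *+ 2) = - (y + y) by rewrite /y; field; rewrite gt_eqF.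
  have -> : - x ^+ 2 / (2 * s ^+ 2 *+ 2) = - y by rewrite /y; field; rewrite gt_eqF.
  have pk : normal_peak s <= 2 * normal_peak r.
    rewrite /normal_peak r2.
    have -> (b : R) : 2 * (Num.sqrt b)^-1 = (2^-1 * Num.sqrt b)^-1 by rewrite invfM invrK.
    rewrite lef_pV2; last 2 first.
    - by rewrite posrE sqrtr_gt0 -mulr_natr !mulr_gt0 ?pi_gt0.
    - by rewrite posrE mulr_gt0 ?invr_gt0// sqrtr_gt0 -mulr_natr !mulr_gt0 ?pi_gt0.
    have h2 : Num.sqrt (2 ^+ 2) = 2 :> R by rewrite sqrtr_sqr ger0_norm.
    rewrite ler_pdivrMl// -[X in X * Num.sqrt _]h2 -sqrtrM ?sqr_ge0// ler_wsqrtr//.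
    rewrite -[2 * s ^+ 2 * pi]mulrA -mulrnAr ler_wpM2r//; last by rewrite expr2 -natrM ler_nat.
    by rewrite mulrn_wge0// mulr_ge0 ?ltW// pi_gt0.
  have y0 : 0 <= y by rewrite /y divr_ge0 ?sqr_ge0// mulr_ge0// sqr_ge0.
  have ey : e ^+ 2 <= 4 * s ^+ 2 * expR y.
    apply: (@le_trans _ _ (x ^+ 2)).
      by rewrite -[x ^+ 2]real_normK ?num_real// ler_sqr ?nnegrE// ltW.
    have -> : x ^+ 2 = 4 * s ^+ 2 * y by rewrite /y; field; rewrite gt_eqF.
    rewrite ler_pM2l; last by rewrite mulr_gt0.
    by apply: le_trans (expR_ge1Dx y); lra.
  rewrite opprD expRD.
  have E0 : 0 < expR (- y) by exact: expR_gt0.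
  have pk0 : 0 <= normal_peak r by rewrite invr_ge0 sqrtr_ge0.
  have key : expR (- y) <= 4 * s ^+ 2 / e ^+ 2.
    by rewrite expRN ler_pdivlMr// ler_pdivrMl ?expR_gt0// mulrC.
  apply: (@le_trans _ _ ((2 * normal_peak r) * (4 * s ^+ 2 / e ^+ 2 * expR (- y)))).
    by apply: ler_pM => //; rewrite ?invr_ge0 ?sqrtr_ge0 ?mulr_ge0 ?expR_ge0// ler_wpM2r ?expR_ge0.
  by rewrite le_eqVlt; apply/orP; left; apply/eqP; field; rewrite gt_eqF.
rewrite /normal_prob.
apply: (@le_trans _ _ (\int[lebesgue_measure]_(x in [set x | (e < `|x|)%R]) ((8 * s ^+ 2 / e ^+ 2)%:E * (normal_pdf 0 r x)%:E))%E).
  apply: ge0_le_integral => //.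
  - by move=> x _; rewrite lee_fin normal_pdf_ge0.
  - by apply/measurable_EFinP; apply: measurable_funTS; exact: measurable_normal_pdf.
  - apply/measurable_EFinP; apply: measurable_funTS; apply: measurable_funM => //; exact: measurable_normal_pdf.
rewrite ge0_integralZl_EFin//; first last.
- by rewrite divr_ge0 ?sqr_ge0// mulr_ge0// sqr_ge0.
- by apply/measurable_EFinP; apply: measurable_funTS; exact: measurable_normal_pdf.
- by move=> x _; rewrite lee_fin normal_pdf_ge0.
rewrite -[X in (_ <= X)%E]mule1; apply: lee_wpmul2l.
  by rewrite lee_fin divr_ge0 ?sqr_ge0// mulr_ge0// sqr_ge0.
rewrite -(integral_normal_pdf 0 r); apply: ge0_subset_integral => //.
- by apply/measurable_EFinP; exact: measurable_normal_pdf.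
- by move=> x _; rewrite lee_fin normal_pdf_ge0.
Qed.

Lemma gauss0_tail (R : realType) (v e : R) : 0 <= v -> 0 < e ->
  (gauss0 v [set x : R | (e < `|x|)%R] <= (8 * v / e ^+ 2)%:E)%E.
Proof.
move=> v0 e0; rewrite /gauss0; case: eqVneq => [->|vn0].
  rewrite mulr0 mul0r diracE memNset//= normr0; apply/negP; rewrite -leNgt; exact: ltW.
by rewrite -{2}(sqr_sqrtr v0); apply: normal_tail => //; rewrite sqrtr_gt0 lt_neqAle eq_sym vn0.
Qed.

(** Rectangular increments as signed evaluations at four corners. [wstep] and [stepfun] then run
    over the same list, the latter with indicators of rectangles based at the origin, and [wstep]
    takes the form whose law [brownian_sheet] prescribes. *)
Definition corners (R : realType) (r : rect R) : seq (R * (R * R)) :=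
  [:: (rc r, (rb r, rv r)); (- rc r, (ra r, rv r)); (- rc r, (rb r, ru r)); (rc r, (ra r, ru r))].

Definition corner_pts (R : realType) (st : seq (rect R)) := flatten (map (@corners R) st).

Lemma wstep_corners (R : realType) d (Om : measurableType d) (W : Om -> R -> R -> R)
    (st : seq (rect R)) (w : Om) :
  wstep W st w = \sum_(p <- corner_pts st) p.1 * W w p.2.1 p.2.2.
Proof.
rewrite /wstep /corner_pts big_flatten big_map; apply: eq_bigr => r _.
by rewrite !big_cons big_nil/=; ring.
Qed.

Lemma indic_oc_diff (R : realType) (a b s : R) : 0 <= a -> a <= b ->
  \1_(`]a, b]) s = \1_(`]0, b]) s - \1_(`]0, a]) s :> R.
Proof.
move=> a0 ab; rewrite !indicE !mem_setE !in_itv/=.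
have [as_|sa] := ltP a s; have [sb|bs] := leP s b => /=.
- by rewrite (le_lt_trans a0 as_) subr0.
- by rewrite !andbF subr0.
- by have [s0|s0] := ltP 0 s; rewrite /= ?sa ?subrr.
- by have := lt_le_trans bs sa; rewrite ltNge ab.
Qed.

Lemma stepfun_corners (R : realType) (T : R) (st : seq (rect R)) (s y : R) :
  Stdlib.Lists.List.Forall (rect_in T) st ->
  stepfun st s y = \sum_(p <- corner_pts st) p.1 * (\1_(`]0, p.2.1]) s * \1_(`]0, p.2.2]) y).
Proof.
move=> Hst; rewrite /stepfun /corner_pts big_flatten big_map.
elim: Hst => [|r l [a0 [ab [bT [u0 [uv v1]]]]] _ IH]; first by rewrite !big_nil.
rewrite !big_cons IH big_nil/= (indic_oc_diff _ a0 ab) (indic_oc_diff _ u0 uv); ring.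
Qed.

Lemma corner_pts_in (R : realType) (T : R) (st : seq (rect R)) :
  Stdlib.Lists.List.Forall (rect_in T) st -> forall p, p \in corner_pts st -> rectK T p.2.
Proof.
elim=> [|r l [a0 [ab [bT [u0 [uv v1]]]]] _ IH] p; first by rewrite in_nil.
have b0 := le_trans a0 ab; have v0 := le_trans u0 uv.
have aT := le_trans ab bT; have u1 := le_trans uv v1.
rewrite /corner_pts /corners /= -/(corner_pts l) !inE => /or4P[/eqP->|/eqP->|/eqP->|/orP[/eqP->|/IH//]];
by split; rewrite /= in_itv/= ?a0 ?b0 ?u0 ?v0 ?aT ?u1.
Qed.

Lemma indic_oc_min (R : realType) (t t' s : R) :
  \1_(`]0, t]) s * \1_(`]0, t']) s = \1_(`]0, Num.min t t']) s :> R.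
Proof.
rewrite !indicE !mem_setE !in_itv/= le_min -natrM mulnb; congr (_%:R); congr nat_of_bool.
by case: (0 < s).
Qed.

Lemma measurable_stepfun (R : realType) (st : seq (rect R)) :
  measurable_fun setT (fun z : R * R => stepfun st z.1 z.2).
Proof.
have H (r : rect R) : measurable_fun setT (fun z : R * R => rc r * ((\1_(`]ra r, rb r]) z.1) * (\1_(`]ru r, rv r]) z.2))).
  apply: measurable_funM; last apply: measurable_funM.
  - exact: measurable_cst.
  - by apply: measurableT_comp; [exact: measurable_indic|exact: measurable_fst].
  - by apply: measurableT_comp; [exact: measurable_indic|exact: measurable_snd].
by rewrite /stepfun; exact (measurable_sum st H).
Qed.

Lemma integral_indicX (R : realType) (T a b c : R) : 0 <= a -> a <= T -> 0 <= b -> b <= 1 ->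
  (leb2 R).-integrable (rectK T) (fun z => (c * (\1_(`]0, a]) z.1 * \1_(`]0, b]) z.2))%:E) /\
  (\int[leb2 R]_(z in rectK T) (c * (\1_(`]0, a]) z.1 * \1_(`]0, b]) z.2))%:E = (c * a * b)%:E)%E.
Proof.
move=> a0 aT b0 b1.
have mAB : measurable (`]0, a] `*` `]0, b] : set (R * R)) by exact: measurableX.
have mK : measurable (rectK T : set (measurableTypeR R * measurableTypeR R)) by exact: measurableX.
have mI : measurable_fun (rectK T) (fun z : R * R => (\1_(`]0, a] `*` `]0, b]) z : R)%:E).
  by apply: measurable_funTS; apply/measurable_EFinP.
have E z : \1_(`]0, a]) z.1 * \1_(`]0, b]) z.2 = \1_(`]0, a] `*` `]0, b]) z :> R.
  by rewrite !indicE in_setX -natrM mulnb.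
have V : (\int[leb2 R]_(z in rectK T) (\1_(`]0, a] `*` `]0, b]) z : R)%:E = (a * b)%:E)%E.
  rewrite integral_indic// setIidl; last first.
    move=> z [] /=; rewrite !in_itv/= => /andP[z0 za] /andP[w0 wb].
    by split; rewrite /= in_itv/= ltW//= ?(le_trans za)// (le_trans wb).
  apply: etrans; first exact: product_measure1E.
  have L (x : R) : 0 <= x -> lebesgue_measure (`]0, x] : set R) = x%:E.
    move=> x0; rewrite lebesgue_measure_itv/= lte_fin oppr0 adde0.
    by case: ltP => // x0'; congr EFin; apply/le_anti/andP.
  by rewrite EFinM; congr (_ * _)%E; exact: L.
have iI : (leb2 R).-integrable (rectK T) (fun z => (\1_(`]0, a] `*` `]0, b]) z : R)%:E).
  apply/integrableP; split => //.
  under eq_integral do rewrite gee0_abs ?lee_fin//.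
  by rewrite V ltry.
split.
  rewrite (_ : (fun z => (c * _)%:E) = (fun z => (c%:E * (\1_(`]0, a] `*` `]0, b]) z : R)%:E)%E)).
    exact: integrableZl.
  by apply/funext => z; rewrite E EFinM.
transitivity (\int[leb2 R]_(z in rectK T) (c%:E * (\1_(`]0, a] `*` `]0, b]) z : R)%:E))%E.
  by apply: eq_integral => z _; rewrite E EFinM.
by rewrite (integralZl mK iI) V -EFinM mulrA.
Qed.

Lemma integral_sum_in (R : realType) d (Y : measurableType d) (mu : {measure set Y -> \bar R}) (D : set Y)
    (I : eqType) (s : seq I) (F : I -> Y -> \bar R) (v : I -> R) : measurable D ->
  (forall i, i \in s -> mu.-integrable D (F i) /\ (\int[mu]_(z in D) F i z = (v i)%:E)%E) ->
  mu.-integrable D (fun z => \sum_(i <- s) F i z) /\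
  (\int[mu]_(z in D) (\sum_(i <- s) F i z) = (\sum_(i <- s) v i)%:E)%E.
Proof.
move=> mD; elim: s => [|i s IH] H.
  have -> : (fun z => \sum_(i <- [::]) F i z) = cst 0%E by apply/funext => z; rewrite big_nil.
  by rewrite big_nil integral0; split => //; exact: integrable0.
have [i1 e1] := H i (mem_head _ _).
have [i2 e2] := IH (fun x xl => H x (mem_behead (s := i :: s) xl)).
have -> : (fun z => \sum_(i <- i :: s) F i z) = (F i \+ (fun z => \sum_(i <- s) F i z))%E.
  by apply/funext => z; rewrite big_cons.
by rewrite big_cons (integralD mD i1 i2) e1 e2; split => //; exact: integrableD.
Qed.

(** The isometry of the Wiener integral on step functions: a product of indicators of origin-based
    rectangles is the indicator with the minima as corner, so the squared norm is the variance in
    [brownian_sheet]. *)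
Lemma enorm_stepfun (R : realType) (T : R) (st : seq (rect R)) :
  Stdlib.Lists.List.Forall (rect_in T) st ->
  enorm `[0, T] `[0, 1] (stepfun st) 2 =
  (\sum_(p <- corner_pts st) \sum_(p' <- corner_pts st)
     p.1 * p'.1 * Num.min p.2.1 p'.2.1 * Num.min p.2.2 p'.2.2)%:E.
Proof.
move=> Hst; have mK : measurable (rectK T : set (measurableTypeR R * measurableTypeR R)) by exact: measurableX.
have inK := corner_pts_in Hst.
rewrite enormE//; last exact: measurable_stepfun.
pose F (p p' : R * (R * R)) (z : R * R) := (p.1 * p'.1 * (\1_(`]0, Num.min p.2.1 p'.2.1]) z.1 * \1_(`]0, Num.min p.2.2 p'.2.2]) z.2))%:E.
have H p p' : p \in corner_pts st -> p' \in corner_pts st ->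
  (leb2 R).-integrable (rectK T) (F p p') /\
  (\int[leb2 R]_(z in rectK T) F p p' z = (p.1 * p'.1 * Num.min p.2.1 p'.2.1 * Num.min p.2.2 p'.2.2)%:E)%E.
  move=> /inK[/=] + + /inK[/=]; rewrite !in_itv/= => /andP[x1 x2] /andP[x3 x4] /andP[x5 x6] /andP[x7 x8].
  by apply: integral_indicX; rewrite ?le_min ?ge_min ?x1 ?x2 ?x3 ?x4 ?x5 ?x7.
have J p : p \in corner_pts st -> (leb2 R).-integrable (rectK T) (fun z => \sum_(p' <- corner_pts st) F p p' z) /\
    (\int[leb2 R]_(z in rectK T) (\sum_(p' <- corner_pts st) F p p' z) =
      (\sum_(p' <- corner_pts st) (p.1 * p'.1 * Num.min p.2.1 p'.2.1 * Num.min p.2.2 p'.2.2))%:E)%E.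
  by move=> ps; apply: integral_sum_in => // p' p's; exact: H.
have J' := @integral_sum_in R _ _ (leb2 R) _ _ _
  (fun p z => (\sum_(p' <- corner_pts st) F p p' z)%E)
  (fun p => \sum_(p' <- corner_pts st) (p.1 * p'.1 * Num.min p.2.1 p'.2.1 * Num.min p.2.2 p'.2.2)) mK J.
have [_ <-] := J'.
apply: eq_integral => z _.
rewrite (stepfun_corners _ _ Hst) expr2 mulr_suml -sumEFin; apply: eq_bigr => p _.
rewrite mulr_sumr -sumEFin; apply: eq_bigr => p' _; rewrite /F -!indic_oc_min; congr EFin; ring.
Qed.

(** * Approximation of the heat kernel by step functions *)

Lemma measure_tail_le (R : realType) d (Om : measurableType d) (P : probability Om R)
    (g : Om -> R) (a c : R) : measurable_fun setT g -> (forall w, 0 <= g w) -> 0 < a ->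
  (\int[P]_w (g w)%:E <= c%:E)%E -> (P [set w | (a < g w)%R] <= (c / a)%:E)%E.
Proof.
move=> mg g0 a0 gc; set A := [set w | a < g w].
have mA : measurable A.
  rewrite (_ : A = setT `&` (g @^-1` `]a, +oo[)); first exact: mg.
  by rewrite setTI; apply/seteqP; split => w /=; rewrite in_itv/= andbT.
rewrite EFinM lee_pdivlMr// muleC -integral_cst//.
apply: le_trans gc.
apply: (@le_trans _ _ (\int[P]_(w in A) (g w)%:E)%E).
  apply: ge0_le_integral => //.
  - by move=> w _; rewrite lee_fin ltW.
  - by apply/measurable_EFinP; exact: measurable_funTS.
  - by move=> w /ltW; rewrite lee_fin.
apply: ge0_subset_integral => //; first by apply/measurable_EFinP.
by move=> w _; rewrite lee_fin.
Qed.

Lemma wstep_tail (R : realType) (T : R) d (Om : measurableType d) (P : probability Om R)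
    (W : Om -> R -> R -> R) (st : seq (rect R)) (e : R) :
  brownian_sheet T P W -> Stdlib.Lists.List.Forall (rect_in T) st -> 0 < e ->
  (P [set w | (e < `|wstep W st w|)%R] <=
    (8 * fine (enorm `[0%R, T] `[0%R, 1%R] (stepfun st) 2) / e ^+ 2)%:E)%E.
Proof.
move=> [mW lawW] Hst e0; set v := enorm _ _ _ _.
have v0 : (0 <= v)%E by apply: integral_ge0 => s _; apply: integral_ge0 => y _; rewrite lee_fin powR_ge0.
have mS : measurable [set x : R | e < `|x|].
  rewrite (_ : [set x | _] = setT `&` (normr @^-1` `]e, +oo[)); first exact: normr_measurable.
  by rewrite setTI; apply/seteqP; split => x /=; rewrite in_itv/= andbT.
apply: le_trans (gauss0_tail (fine_ge0 v0) e0).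
have := lawW (corner_pts st) (corner_pts_in Hst) _ mS.
rewrite /v (enorm_stepfun Hst)/= => <-.
by rewrite le_eqVlt; apply/orP; left; apply/eqP; congr (P _); apply/seteqP; split => w /=; rewrite wstep_corners.
Qed.

Lemma enorm_supp_le (R : realType) (A B A' B' : set R) (h f : R -> R -> R) :
  measurable A -> measurable B -> measurable A' -> measurable B' ->
  measurable_fun setT (fun z : R * R => h z.1 z.2) ->
  measurable_fun setT (fun z : R * R => f z.1 z.2) ->
  (forall s y, A s -> B y -> h s y = 0 \/ [/\ A' s, B' y & `|h s y| <= `|f s y|]) ->
  (enorm A B h 2 <= enorm A' B' f 2)%E.
Proof.
move=> mA mB mA' mB' mh mf H; rewrite !enormE//.
rewrite integral_mkcond [leRHS]integral_mkcond.
have mm (C D : set R) (u : R -> R -> R) : measurable C -> measurable D ->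
    measurable_fun setT (fun z : R * R => u z.1 z.2) ->
    measurable_fun setT ((fun z : R * R => ((u z.1 z.2) ^+ 2)%:E : \bar R) \_ (C `*` D)).
  move=> mC mD mu; have mCD := measurableX mC mD; apply/(measurable_restrictT _ mCD)/measurable_funTS/measurable_EFinP.
  exact: measurable_funX.
have ge0 (C D : set R) (u : R -> R -> R) z :
    (0 <= ((fun z : R * R => ((u z.1 z.2) ^+ 2)%:E : \bar R) \_ (C `*` D)) z)%E.
  by rewrite patchE; case: ifPn => // _; rewrite lee_fin sqr_ge0.
apply: ge0_le_integral => //.
- exact: mm.
- exact: mm.
move=> z _; rewrite [leLHS]patchE; case: ifPn => // /set_mem[Az Bz].
have [->|[A'z B'z hf]] := H _ _ Az Bz; first by rewrite expr0n.
by rewrite patchE mem_set// lee_fin -ler_sqrt ?sqr_ge0// !sqrtr_sqr.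
Qed.

(** Cuts a rectangle down to [s > c], [y > c']; one lying below a threshold degenerates to an empty
    half-open interval, so the list keeps its length and its coefficients. *)
Definition clip (R : realType) (c c' : R) (r : rect R) : rect R :=
  Rect (rc r) (Num.max (ra r) c) (Num.max (rb r) c) (Num.max (ru r) c') (Num.max (rv r) c').

Definition rneg (R : realType) (r : rect R) : rect R := Rect (- rc r) (ra r) (rb r) (ru r) (rv r).

Lemma Forall_map (A B : Type) (P : A -> Prop) (Q : B -> Prop) (f : A -> B) (s : seq A) :
  (forall a, P a -> Q (f a)) -> Stdlib.Lists.List.Forall P s -> Stdlib.Lists.List.Forall Q (map f s).
Proof. by move=> PQ; elim=> [|a l Pa _ IH]; constructor => //; exact: PQ. Qed.

Lemma Forall_cat (A : Type) (P : A -> Prop) (s s' : seq A) :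
  Stdlib.Lists.List.Forall P s -> Stdlib.Lists.List.Forall P s' -> Stdlib.Lists.List.Forall P (s ++ s').
Proof. by elim=> [//|a l Pa _ IH] ps'; constructor => //; exact: IH. Qed.

Lemma rect_in_clip (R : realType) (T c c' : R) (r : rect R) : 0 <= c -> c <= T -> 0 <= c' -> c' <= 1 ->
  rect_in T r -> rect_in T (clip c c' r).
Proof.
move=> c0 cT c'0 c'1 [a0 [ab [bT [u0 [uv v1]]]]]; rewrite /rect_in/=.
by do !split; rewrite ?ge_max ?bT ?cT ?v1 ?c'1// !le_max ?a0 ?u0 ?ab ?uv ?lexx ?orbT.
Qed.

Lemma stepfun_clip (R : realType) (c c' : R) (st : seq (rect R)) (s y : R) :
  stepfun (map (clip c c') st) s y = if (c < s) && (c' < y) then stepfun st s y else 0.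
Proof.
have E (a b z v : R) : \1_(`]Num.max a z, Num.max b z]) v = if z < v then \1_(`]a, b]) v else 0 :> R.
  rewrite !indicE !mem_setE !in_itv/= gt_max le_max.
  by have [_|_] := ltP z v; rewrite ?andbT ?orbF ?andbF.
rewrite /stepfun big_map; case: ifPn => cc.
  by apply: eq_bigr => r _; rewrite !E; move/andP: cc => [-> ->].
rewrite big1// => r _; rewrite !E; move: cc; rewrite negb_and => /orP[]/negbTE ->; ring.
Qed.

Lemma stepfun_cat_neg (R : realType) (st st' : seq (rect R)) (s y : R) :
  stepfun (st ++ map (@rneg R) st') s y = stepfun st s y - stepfun st' s y.
Proof.
rewrite /stepfun big_cat big_map/=; congr (_ + _).
by rewrite -sumrN; apply: eq_bigr => r _; rewrite mulNr.
Qed.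

Lemma wstep_cat_neg (R : realType) d (Om : measurableType d) (W : Om -> R -> R -> R)
    (st st' : seq (rect R)) (w : Om) :
  wstep W (st ++ map (@rneg R) st') w = wstep W st w - wstep W st' w.
Proof.
rewrite /wstep big_cat big_map/=; congr (_ + _).
by rewrite -sumrN; apply: eq_bigr => r _; rewrite mulNr.
Qed.

Lemma measurable_wstep (R : realType) d (Om : measurableType d) (W : Om -> R -> R -> R) (st : seq (rect R)) :
  (forall t x, measurable_fun setT (fun w => W w t x)) -> measurable_fun setT (wstep W st).
Proof.
move=> mW; rewrite (_ : wstep W st = fun w => \sum_(p <- corner_pts st) p.1 * W w p.2.1 p.2.2); last first.
  by apply/funext => w; exact: wstep_corners.
have H (p : R * (R * R)) : measurable_fun setT (fun w => p.1 * W w p.2.1 p.2.2) by exact: measurable_funM.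
exact (measurable_sum _ H).
Qed.

(** The corner decomposition with the iterated integral of [th] in the place of the sheet, which
    gives both sides of the approximation the same form. *)
Lemma wstep_dint (R : realType) (T : R) d (Om : measurableType d) (th : Om -> R -> R -> R) (st : seq (rect R)) (w : Om) :
  Stdlib.Lists.List.Forall (rect_in T) st ->
  measurable_fun setT (fun z : R * R => th w z.1 z.2) ->
  (enorm `[0%R, T] `[0%R, 1%R] (th w) 2 < +oo)%E ->
  dint `[0, T] `[0, 1] (fun s y => stepfun st s y * th w s y) =
  wstep (fun w t x => dint `[0, t] `[0, x] (th w)) st w.
Proof.
move=> Hst mth thL; rewrite wstep_corners.
have mK : measurable (rectK T : set (measurableTypeR R * measurableTypeR R)) by exact: measurableX.
have mst := measurable_stepfun st.
have ith : (leb2 R).-integrable (rectK T) (fun z => (th w z.1 z.2)%:E).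
  have fin1 : (enorm `[0%R, T] `[0%R, 1%R] (fun _ _ => 1%R) 2 < +oo)%E.
    rewrite enormE//; under eq_integral do rewrite expr1n.
    rewrite integral_cst//= mul1e; apply: (@le_lt_trans _ _ (lebesgue_measure `[0%R, T] * lebesgue_measure (`[0%R, 1%R] : set R))%E).
      by rewrite le_eqVlt; apply/orP; left; apply/eqP; exact: product_measure1E.
    by rewrite !lebesgue_measure_itv/=; case: ifP => _; case: ifP => _; rewrite ?mul0e ?mule0 ?oppr0 ?adde0 -?EFinM ltry.
  have := @integrable_mul_L2 R `[0, T] `[0, 1] (fun _ _ => 1) (th w) (measurable_itv _) (measurable_itv _) (measurable_cst _) mth fin1 thL.
  by rewrite (_ : (fun z => (1 * _)%:E) = (fun z => (th w z.1 z.2)%:E))//; apply/funext => z; rewrite mul1r.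
have iX a b : 0 <= a -> a <= T -> 0 <= b -> b <= 1 ->
    (leb2 R).-integrable (rectK T) (fun z => (\1_(`]0, a]) z.1 * \1_(`]0, b]) z.2 * th w z.1 z.2)%:E) /\
    (\int[leb2 R]_(z in rectK T) (\1_(`]0, a]) z.1 * \1_(`]0, b]) z.2 * th w z.1 z.2)%:E =
     (dint `[0%R, a] `[0%R, b] (th w))%:E)%E.
  move=> a0 aT b0 b1; have sub : (`]0, a] `*` `]0, b] : set (R * R)) `<=` rectK T.
    move=> z [] /=; rewrite !in_itv/= => /andP[z0 za] /andP[w0 wb].
    by split; rewrite /= in_itv/= ltW//= ?(le_trans za)// (le_trans wb).
  have mX : measurable (`]0, a] `*` `]0, b] : set (measurableTypeR R * measurableTypeR R)) by exact: measurableX.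
  have iab : (leb2 R).-integrable (`]0, a] `*` `]0, b]) (fun z => (th w z.1 z.2)%:E).
    exact: (integrableS mK mX sub ith).
  have E z : (\1_(`]0, a]) z.1 * \1_(`]0, b]) z.2 * th w z.1 z.2)%:E =
      ((fun z => (th w z.1 z.2)%:E) \_ (`]0, a] `*` `]0, b])) z.
    rewrite patchE in_setX !indicE; case: (z.1 \in _); case: (z.2 \in _);
    by rewrite /= ?mul1r ?mul0r ?mul1r.
  rewrite (_ : (fun z => (_ * th w _ _)%:E) = ((fun z => (th w z.1 z.2)%:E) \_ (`]0, a] `*` `]0, b]))); last exact/funext.
  split.
    by apply/(@integrable_restrict _ _ _ (leb2 R) _ mX _ mK _); rewrite setIidr.
  rewrite -integral_mkcondr setIidr// dint_itv_oc// dintE//.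
  by rewrite /Rintegral fineK//; exact: integrable_fin_num.
rewrite dintE//; last first.
  have fst_ : (enorm `[0%R, T] `[0%R, 1%R] (stepfun st) 2 < +oo)%E by rewrite (enorm_stepfun Hst) ltry.
  exact: (integrable_mul_L2 (measurable_itv _) (measurable_itv _) mst mth fst_ thL).
  exact: measurable_funM.
have [|_ S] := @integral_sum_in R _ _ (leb2 R) (rectK T) _ (corner_pts st)
  (fun p z => (p.1 * (\1_(`]0, p.2.1]) z.1 * \1_(`]0, p.2.2]) z.2 * th w z.1 z.2))%:E)
  (fun p => p.1 * dint `[0%R, p.2.1] `[0%R, p.2.2] (th w)) mK.
  move=> p /(corner_pts_in Hst)[/=]; rewrite !in_itv/= => /andP[x1 x2] /andP[x3 x4].
  have [i1 e1] := iX _ _ x1 x2 x3 x4.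
  by split; [exact: (integrableZl mK p.1 i1)|rewrite EFinM -e1; exact: (integralZl mK i1 p.1)].
rewrite /Rintegral (_ : (\int[_]_(z in _) _)%E = (\sum_(p <- corner_pts st) p.1 * dint `[0%R, p.2.1] `[0%R, p.2.2] (th w))%:E)//.
rewrite -S; apply: eq_integral => z _; rewrite (stepfun_corners _ _ Hst) mulr_suml -sumEFin.
by apply: eq_bigr => p _; rewrite -!mulrA.
Qed.

Lemma enorm_ge0 (R : realType) (A B : set R) (h : R -> R -> R) (p : R) : (0 <= enorm A B h p)%E.
Proof. by apply: integral_ge0 => s _; apply: integral_ge0 => y _; rewrite lee_fin powR_ge0. Qed.

(** [8 * Num.sqrt T] comes from time strips and [8 + 64 * T] from space strips; the sum serves every
    cell. *)
Definition kern_const (R : realType) (T : R) : R := 8 * Num.sqrt T + 8 + 64 * T.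

(* The two bounds come from [enorm_kern_small] on the time strip, whose length is at most
   [T r^k = T s^(16k)], and from [enorm_kern_strip] on the space strip with [e = s^(4l)]. *)
Lemma enorm_kern_cell (R : realType) (T t x s : R) (k l : nat) : 0 < T -> 0 < s -> s < 1 ->
  let r := s ^+ 16 in
  (enorm `[0%R, (T * r ^+ k)%R] `[0%R, 1%R] (kern t x) 2 <= (kern_const T * s ^+ k)%:E)%E /\
  (enorm `[0%R, T] `[0%R, (r ^+ l)%R] (kern t x) 2 <= (kern_const T * s ^+ l)%:E)%E /\
  (enorm `[(T * r ^+ k.+1)%R, (T * r ^+ k)%R] `[(r ^+ l.+1)%R, (r ^+ l)%R] (kern t x) 2
     <= (kern_const T * s ^+ (2 * (k + l)))%:E)%E.
Proof.
move=> T0 s0 s1 r; have mk := measurable_kern t x.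
have p n : 0 < s ^+ n by rewrite exprn_gt0.
have mono m n : (m <= n)%N -> s ^+ n <= s ^+ m by move=> mn; apply: ler_wiXn2l => //; exact: ltW.
have c1 : 8 * Num.sqrt T <= kern_const T by rewrite /kern_const -addrA lerDl; lra.
have sT : 0 <= Num.sqrt T := sqrtr_ge0 T.
have c2 : 8 + 64 * T <= kern_const T by rewrite /kern_const; lra.
have rE n : r ^+ n = s ^+ (16 * n) by rewrite -exprM.
have r1 n : r ^+ n <= 1 by rewrite rE -(expr0 s); exact: mono.
have r0 n : 0 < r ^+ n by rewrite rE.
have A n : (enorm `[0%R, (T * r ^+ n)%R] `[0%R, 1%R] (kern t x) 2 <= (kern_const T * s ^+ (8 * n))%:E)%E.
  apply: (@le_trans _ _ (8 * (Num.sqrt T * s ^+ (8 * n)))%:E).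
    apply: enorm_kern_small => //.
    - by move=> z /=; rewrite in_itv/= => /andP[].
    - by rewrite mulr_ge0// ltW.
    - have -> : (Num.sqrt T * s ^+ (8 * n)) ^+ 2 = T * s ^+ (16 * n).
        by rewrite exprMn sqr_sqrtr ?(ltW T0)// -exprM; congr (_ * _ ^+ _); lia.
      rewrite lebesgue_measure_itv/= rE oppr0 adde0.
      by case: ifP => //; rewrite lee_fin mulr_ge0// ltW.
  by rewrite lee_fin mulrA ler_wpM2r// ltW.
have B n : (enorm `[0%R, T] `[0%R, (r ^+ n)%R] (kern t x) 2 <= (kern_const T * s ^+ (4 * n))%:E)%E.
  apply: (@le_trans _ _ (8 * s ^+ (4 * n) + 64 / (s ^+ (4 * n)) ^+ 2 * (T * r ^+ n))%:E).
    apply: enorm_kern_strip => //.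
    - by move=> z /=; rewrite !in_itv/= => /andP[-> /le_trans -> //].
    - exact: ltW.
    - by rewrite lebesgue_measure_itv/= oppr0 adde0; case: ifP => //; rewrite lee_fin ltW.
  rewrite lee_fin.
  have -> : 64 / (s ^+ (4 * n)) ^+ 2 * (T * r ^+ n) = 64 * T * s ^+ (8 * n).
    rewrite rE (_ : 16 * n = 4 * n + 4 * n + 8 * n)%N; last by lia.
    by rewrite !exprD expr2; field; rewrite gt_eqF.
  apply: (@le_trans _ _ ((8 + 64 * T) * s ^+ (4 * n))); last by rewrite ler_wpM2r// ltW.
  rewrite [leRHS]mulrDl lerD2l ler_wpM2l//; last by apply: mono; lia.
  by rewrite mulr_ge0// ltW.
have C0 : 0 <= kern_const T by apply: le_trans c1; rewrite mulr_ge0.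
have fin a n : (n <= a)%N -> ((kern_const T * s ^+ a)%:E <= (kern_const T * s ^+ n)%:E)%E.
  by move=> na; rewrite lee_fin ler_wpM2l// mono.
split; first by apply: (le_trans (A k)); apply: fin; lia.
split; first by apply: (le_trans (B l)); apply: fin; lia.
(* The cell lies in both strips; the strip of the larger index is used, and that index is at least
   half of [k + l]. *)
case: (leqP l k) => kl.
  apply: (@le_trans _ _ (enorm `[0%R, (T * r ^+ k)%R] `[0%R, 1%R] (kern t x) 2)).
    apply: enorm_subset => //.
    - move=> z /=; rewrite !in_itv/= => /andP[z1 ->]; rewrite andbT; apply: le_trans z1.
      by rewrite mulr_ge0// ltW.
    - move=> z /=; rewrite !in_itv/= => /andP[z1 z2]; rewrite (le_trans _ z1) ?(ltW (r0 _))//.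
      exact: le_trans z2 _.
  by apply: (le_trans (A k)); apply: fin; lia.
apply: (@le_trans _ _ (enorm `[0%R, T] `[0%R, (r ^+ l)%R] (kern t x) 2)).
  apply: enorm_subset => //.
  - move=> z /=; rewrite !in_itv/= => /andP[z1 z2]; rewrite (le_trans _ z1) ?mulr_ge0 ?(ltW (r0 _)) ?(ltW T0)//.
    by apply: (le_trans z2); rewrite -[leRHS]mulr1 ler_wpM2l// ltW.
  - by move=> z /=; rewrite !in_itv/= => /andP[z1 ->]; rewrite andbT; apply: le_trans z1; exact: ltW.
by apply: (le_trans (B l)); apply: fin; lia.
Qed.

Lemma enorm_sqrD_le (R : realType) (A B : set R) (f g h : R -> R -> R) (a b : R) :
  measurable A -> measurable B ->
  measurable_fun setT (fun z : R * R => f z.1 z.2) ->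
  measurable_fun setT (fun z : R * R => g z.1 z.2) ->
  measurable_fun setT (fun z : R * R => h z.1 z.2) ->
  (forall s y, `|h s y| <= `|f s y| + `|g s y|) ->
  (enorm A B f 2 <= a%:E)%E -> (enorm A B g 2 <= b%:E)%E -> (enorm A B h 2 <= (2 * (a + b))%:E)%E.
Proof.
move=> mA mB mf mg mh H fa gb; apply: (le_trans (enorm_sqrD mA mB mf mg mh H)).
by rewrite EFinM lee_pmul2l// EFinD leeD.
Qed.

(** The exponent [3 * L] comes from the cells kept by the cut-off: there [k + l <= 2 * L], so the
    global error already meets the target exponent [L + (k + l)]. Elsewhere [k + l >= L], and the
    kernel's own decay of exponent [2 * (k + l)] suffices. *)
Lemma clip_cell_le (R : realType) (T t x s : R) (st : seq (rect R)) (L k l : nat) :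
  0 < T -> 0 < s -> s < 1 -> let r := s ^+ 16 in
  (enorm `[0%R, T] `[0%R, 1%R] (fun s y => kern t x s y - stepfun st s y)%R 2
     <= (kern_const T * s ^+ (3 * L))%:E)%E ->
  (enorm `[(T * r ^+ k.+1)%R, (T * r ^+ k)%R] `[(r ^+ l.+1)%R, (r ^+ l)%R]
    (fun s y => kern t x s y - stepfun (map (clip (T * r ^+ L.+1) (r ^+ L.+1)) st) s y)%R 2
     <= (4 * kern_const T * s ^+ L * s ^+ (k + l))%:E)%E.
Proof.
move=> T0 s0 s1 r D; have mk := measurable_kern t x.
have C0 : 0 <= kern_const T by rewrite /kern_const !addr_ge0// ?mulr_ge0 ?sqrtr_ge0// ltW.
have mono m n : (m <= n)%N -> s ^+ n <= s ^+ m by move=> mn; apply: ler_wiXn2l => //; exact: ltW.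
have rmono m n : (m <= n)%N -> r ^+ n <= r ^+ m.
  by move=> mn; rewrite /r -!exprM; apply: mono; lia.
have r0 n : 0 < r ^+ n by rewrite /r -exprM exprn_gt0.
have rlt n : r ^+ n.+1 < r ^+ n.
  by rewrite exprS gtr_pMl// /r exprn_ilt1// ltW.
have r1 n : r ^+ n <= 1 by rewrite -(expr0 r) rmono.
have ms st' := @measurable_stepfun R st'.
have md st' : measurable_fun setT (fun z : R * R => kern t x z.1 z.2 - stepfun st' z.1 z.2).
  exact: measurable_funB.
have fin a : (L + (k + l) <= a)%N -> (kern_const T * s ^+ a)%R <= kern_const T * s ^+ L * s ^+ (k + l).
  by move=> na; rewrite -mulrA -exprD ler_wpM2l// mono.
have sub1 : `[(T * r ^+ k.+1)%R, (T * r ^+ k)%R] `<=` (`[0, T] : set R).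
  move=> z /=; rewrite !in_itv/= => /andP[z1 z2]; rewrite (le_trans _ z1) ?mulr_ge0 ?(ltW (r0 _)) ?(ltW T0)//.
  by apply: (le_trans z2); rewrite -[leRHS]mulr1 ler_wpM2l// ltW.
have sub2 : `[(r ^+ l.+1)%R, (r ^+ l)%R] `<=` (`[0, 1] : set R).
  by move=> z /=; rewrite !in_itv/= => /andP[z1 z2]; rewrite (le_trans _ z1) ?(ltW (r0 _))// (le_trans z2).
have [_ [_]] := enorm_kern_cell t x k l T0 s0 s1; rewrite -/r => cell.
have f0 : 0 <= kern_const T * s ^+ L * s ^+ (k + l) by rewrite !mulr_ge0 ?exprn_ge0// ltW.
(* Beyond the cut-off the clipped step function vanishes, so the error is the kernel itself. *)
have [|out] := boolP ((k <= L) && (l <= L))%N; last first.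
  apply: (@le_trans _ _ (kern_const T * s ^+ L * s ^+ (k + l))%:E); last first.
    by rewrite lee_fin -!(mulrA 4) ler_peMl// ler1n.
  have kl : (L <= k + l)%N by move: out; rewrite negb_and -!ltnNge; lia.
  apply: (@le_trans _ _ (kern_const T * s ^+ (2 * (k + l)))%:E); last by rewrite lee_fin; apply: fin; lia.
  apply: le_trans cell; apply: enorm_supp_le => // z y /= Az By; right; split => //.
  rewrite stepfun_clip ifF ?subr0//; apply/negbTE; rewrite negb_and -!leNgt.
  move: Az By; rewrite !in_itv/= => /andP[_ zk] /andP[_ yl].
  move: out; rewrite negb_and -!ltnNge => /orP[kL|lL]; apply/orP; [left|right].
    by apply: (le_trans zk); rewrite ler_wpM2l ?(ltW T0)// rmono.
  by apply: (le_trans yl); rewrite rmono.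
move=> /andP[kL lL].
have D' : (enorm `[(T * r ^+ k.+1)%R, (T * r ^+ k)%R] `[(r ^+ l.+1)%R, (r ^+ l)%R]
    (fun s y => kern t x s y - stepfun st s y)%R 2 <= (kern_const T * s ^+ L * s ^+ (k + l))%:E)%E.
  apply: (@le_trans _ _ (kern_const T * s ^+ (3 * L))%:E); last by rewrite lee_fin; apply: fin; lia.
  by apply: le_trans D; apply: enorm_subset.
(* For [k = L] or [l = L] the closed cell meets the cut-off line, where the clipped function is zero
   since the test is strict. Adding the bounds for both alternatives replaces a null-set argument
   and costs the factor 4. *)
have [|edge] := boolP ((k < L) && (l < L))%N.
  move=> /andP[kL' lL'].
  apply: (@le_trans _ _ (kern_const T * s ^+ L * s ^+ (k + l))%:E); last first.
    by rewrite lee_fin -!(mulrA 4) ler_peMl// ler1n.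
  apply: le_trans D'; apply: enorm_supp_le => // z y Az By; right; split => //.
  rewrite stepfun_clip ifT//; apply/andP.
  move: Az By => /=; rewrite !in_itv/= => /andP[zk _] /andP[yl _]; split.
    by apply: lt_le_trans zk; rewrite ltr_pM2l//; apply: lt_le_trans (rlt L) _; apply: rmono.
  by apply: lt_le_trans yl; apply: lt_le_trans (rlt L) _; apply: rmono.
have kl : (L <= k + l)%N by move: edge; rewrite negb_and -!leqNgt; lia.
rewrite (_ : 4 * kern_const T * _ * _ = 2 * (kern_const T * s ^+ L * s ^+ (k + l) + kern_const T * s ^+ L * s ^+ (k + l))); last by ring.
have cell' : (enorm `[(T * r ^+ k.+1)%R, (T * r ^+ k)%R] `[(r ^+ l.+1)%R, (r ^+ l)%R] (kern t x) 2
    <= (kern_const T * s ^+ L * s ^+ (k + l))%:E)%E.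
  by apply: (le_trans cell); rewrite lee_fin; apply: fin; lia.
refine (enorm_sqrD_le (measurable_itv _) (measurable_itv _) (md st) mk (md _) _ D' cell').
move=> z y; rewrite stepfun_clip; case: ifP => _; first by rewrite lerDl.
by rewrite subr0 lerDr.
Qed.

(** On the removed strips |st| <= |kern - st| + |kern|, so the removed mass is controlled by the
    approximation error and by the kernel near the axes; 10 is 2 (1 + 2 (1 + 1)). By the isometry
    this mass is the variance of what the cut-off takes away from [wstep]. *)
Lemma clip_diff_le (R : realType) (T t x s : R) (st : seq (rect R)) (L : nat) :
  0 < T -> 0 < s -> s < 1 -> let r := s ^+ 16 in
  (enorm `[0%R, T] `[0%R, 1%R] (fun s y => kern t x s y - stepfun st s y)%R 2
     <= (kern_const T * s ^+ (3 * L))%:E)%E ->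
  (enorm `[0%R, T] `[0%R, 1%R]
    (stepfun (st ++ map (@rneg R) (map (clip (T * r ^+ L.+1) (r ^+ L.+1)) st))) 2
     <= (10 * kern_const T * s ^+ L)%:E)%E.
Proof.
move=> T0 s0 s1 r D; have mk := measurable_kern t x.
have C0 : 0 <= kern_const T by rewrite /kern_const !addr_ge0// ?mulr_ge0 ?sqrtr_ge0// ltW.
have mono m n : (m <= n)%N -> s ^+ n <= s ^+ m by move=> mn; apply: ler_wiXn2l => //; exact: ltW.
have ms st' := @measurable_stepfun R st'.
have md : measurable_fun setT (fun z : R * R => kern t x z.1 z.2 - stepfun st z.1 z.2).
  exact: measurable_funB.
set c := T * r ^+ L.+1; set c' := r ^+ L.+1.
have [+ [+ _]] := enorm_kern_cell t x L.+1 L.+1 T0 s0 s1; rewrite -/r => g1 g2.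
pose h1 s y := \1_(`]-oo, c]) s * kern t x s y.
pose h2 s y := \1_(`]-oo, c']) y * kern t x s y.
have mh1 : measurable_fun setT (fun z : R * R => h1 z.1 z.2).
  apply: measurable_funM => //; apply: measurableT_comp; [exact: measurable_indic|exact: measurable_fst].
have mh2 : measurable_fun setT (fun z : R * R => h2 z.1 z.2).
  apply: measurable_funM => //; apply: measurableT_comp; [exact: measurable_indic|exact: measurable_snd].
have mh : measurable_fun setT (fun z : R * R => `|h1 z.1 z.2| + `|h2 z.1 z.2|).
  by apply: measurable_funD; exact: measurableT_comp.
have b1 : (enorm `[0%R, T] `[0%R, 1%R] h1 2 <= (kern_const T * s ^+ L)%:E)%E.
  apply: (@le_trans _ _ (kern_const T * s ^+ L.+1)%:E); last by rewrite lee_fin ler_wpM2l// mono.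
  apply: le_trans g1; apply: enorm_supp_le => // z y /= Az By; rewrite /h1 indicE mem_setE in_itv/=.
  have [zc|_] := leP z c; last by left; rewrite mul0r.
  by right; rewrite mul1r; split => //=; move: Az; rewrite !in_itv/= => /andP[-> _].
have b2 : (enorm `[0%R, T] `[0%R, 1%R] h2 2 <= (kern_const T * s ^+ L)%:E)%E.
  apply: (@le_trans _ _ (kern_const T * s ^+ L.+1)%:E); last by rewrite lee_fin ler_wpM2l// mono.
  apply: le_trans g2; apply: enorm_supp_le => // z y /= Az By; rewrite /h2 indicE mem_setE in_itv/=.
  have [zc|_] := leP y c'; last by left; rewrite mul0r.
  by right; rewrite mul1r; split => //=; move: By; rewrite !in_itv/= => /andP[-> _].
rewrite (_ : 10 * kern_const T * _ = 2 * (kern_const T * s ^+ L + 2 * (kern_const T * s ^+ L + kern_const T * s ^+ L))); last by ring.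
have D' : (enorm `[0%R, T] `[0%R, 1%R] (fun s y => kern t x s y - stepfun st s y)%R 2
    <= (kern_const T * s ^+ L)%:E)%E.
  by apply: (le_trans D); rewrite lee_fin ler_wpM2l// mono// leq_pmull.
have b12 : (enorm `[0%R, T] `[0%R, 1%R] (fun s y => `|h1 s y| + `|h2 s y|)%R 2
    <= (2 * (kern_const T * s ^+ L + kern_const T * s ^+ L))%:E)%E.
  refine (enorm_sqrD_le (measurable_itv _) (measurable_itv _) mh1 mh2 mh _ b1 b2).
  by move=> z y; rewrite ger0_norm.
refine (enorm_sqrD_le (measurable_itv _) (measurable_itv _) md mh (ms _) _ D' b12).
move=> z y; rewrite stepfun_cat_neg stepfun_clip /h1 /h2 !indicE !mem_setE !in_itv/=.
have [|] := boolP ((c < z) && (c' < y)) => [_|]; first by rewrite subrr normr0.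
rewrite negb_and -!leNgt subr0 [X in _ <= _ + X]ger0_norm ?addr_ge0// => zy.
apply: (@le_trans _ _ (`|kern t x z y - stepfun st z y| + `|kern t x z y|)).
  by rewrite distrC; apply: le_trans (ler_normD _ _); rewrite subrK.
rewrite lerD2l; case/orP: zy => ->; rewrite mul1r; [rewrite lerDl|rewrite lerDr]; exact: normr_ge0.
Qed.

Lemma cvge0_le (R : realType) (u : nat -> \bar R) (a : R) : u @ \oo --> 0%E -> 0 < a ->
  \forall j \near \oo, (u j <= a%:E)%E.
Proof.
move=> uc a0; have H : nbhs 0%E [set y : \bar R | (y < a%:E)%E].
  by apply: open_nbhs_nbhs; split; [exact: open_ereal_lt_ereal|rewrite /= lte_fin].
have [N _ HN] := uc _ H; exists N => // j Nj; apply: ltW; exact: HN.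
Qed.

Lemma exists_expr_le (R : realType) (s e : R) : 0 < s -> s < 1 -> 0 < e -> exists L : nat, s ^+ L <= e.
Proof.
move=> s0 s1 e0; have sn : `|s| < 1 by rewrite ger0_norm ?ltW.
have /cvgrPdist_le/(_ e e0)[L _ HL] := cvg_expr sn.
exists L; have := HL L (leqnn L); rewrite /= sub0r normrN ger0_norm ?exprn_ge0 ?(ltW s0)//.
Qed.

Lemma clip_level (R : realType) (s c del lam : R) : 0 < s -> s < 1 -> 0 < c -> 0 < del -> 0 < lam ->
  exists L : nat, 4 * c * s ^+ L <= del /\ 8 * (10 * c * s ^+ L) / (lam / 2) ^+ 2 <= del / 2.
Proof.
move=> s0 s1 c0 d0 l0.
have q0 : 0 < ((lam / 2) ^+ 2)^-1 by rewrite invr_gt0 exprn_gt0// divr_gt0.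
set q := _^-1 in q0 *.
have K0 : 0 < 4 * c + 80 * (c * q) by rewrite addr_gt0// mulr_gt0// mulr_gt0.
have [L sL] := exists_expr_le s0 s1 (divr_gt0 (divr_gt0 d0 (ltr0n R 2)) K0).
exists L; move: sL; rewrite ler_pdivlMr//; have := exprn_gt0 L s0.
move: (s ^+ L) => v v0 H.
have a1 : 0 < v * c by rewrite mulr_gt0.
have a2 : 0 < v * (c * q) by rewrite !mulr_gt0.
have -> : 4 * c * v = 4 * (v * c) by ring.
have -> : 8 * (10 * c * v) * q = 80 * (v * (c * q)) by ring.
have : v * (4 * c + 80 * (c * q)) = 4 * (v * c) + 80 * (v * (c * q)) by ring.
by move=> E; rewrite E in H; lra.
Qed.

Lemma measurable_norm_gt (R : realType) d (Om : measurableType d) (f : Om -> R) (e : R) :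
  measurable_fun setT f -> measurable [set w | e < `|f w|].
Proof.
move=> mf; have mn : measurable_fun setT (fun w => `|f w|) by exact: measurableT_comp.
rewrite (_ : [set w | _] = setT `&` ((fun w => `|f w|) @^-1` `]e, +oo[)); first exact: mn.
by rewrite setTI; apply/seteqP; split => w /=; rewrite in_itv/= andbT.
Qed.

Lemma norm_tail_split (R : realType) d (Om : measurableType d) (P : probability Om R)
    (f g : Om -> R) (e a b : R) : measurable_fun setT f -> measurable_fun setT g ->
  (P [set w | (e / 2 < `|f w|)%R] <= a%:E)%E -> (P [set w | (e / 2 < `|g w|)%R] <= b%:E)%E ->
  (P [set w | (e < `|f w + g w|)%R] <= (a + b)%:E)%E.
Proof.
move=> mf mg fa gb; rewrite EFinD; apply: le_trans (leeD fa gb).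
have mF := measurable_norm_gt (e / 2) mf; have mG := measurable_norm_gt (e / 2) mg.
apply: le_trans (measureU2 P mF mG); apply: le_measure; rewrite ?inE.
- by apply: measurable_norm_gt; exact: measurable_funD.
- exact: measurableU.
move=> w /= fg; have [fe|fe] := ltP (e / 2) `|f w|; first by left.
right; rewrite ltNge; apply/negP => ge; have := ler_normD (f w) (g w); lra.
Qed.

(* The cut-off level [L] is chosen first, and only then the step function, because its squared error
   has to be at most [kern_const T * s ^+ (3 * L)]. *)
Lemma kern_step_approx (R : realType) (T t x sg del lam : R) d (Om : measurableType d)
    (P : probability Om R) (W : Om -> R -> R -> R) (Z : Om -> R) :
  0 < T -> 0 < sg -> sg < 1 -> let r := (sg ^+ 4) ^+ 16 in
  brownian_sheet T P W -> wiener_integral T P W (kern t x) Z -> measurable_fun setT Z ->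
  0 < del -> 0 < lam ->
  exists st, [/\ Stdlib.Lists.List.Forall (rect_in T) st,
    (forall k l : nat, enorm `[(T * r ^+ k.+1)%R, (T * r ^+ k)%R] `[(r ^+ l.+1)%R, (r ^+ l)%R]
       (fun s y => kern t x s y - stepfun st s y)%R 2 <= (del * sg ^+ (4 * (k + l)))%:E)%E &
    (P [set w | (lam < `|Z w - wstep W st w|)%R] <= del%:E)%E].
Proof.
move=> T0 sg0 sg1 r bW [_ [st [Hst [Dcv Zcv]]]] mZ del0 lam0.
pose s := sg ^+ 4.
have s0 : 0 < s by rewrite exprn_gt0.
have s1 : s < 1 by rewrite exprn_ilt1// ltW.
have C0 : 0 < kern_const T.
  by rewrite /kern_const ltr_wpDr ?mulr_ge0 ?(ltW T0)// ltr_wpDl ?mulr_ge0 ?sqrtr_ge0.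
have [L [L1 L2]] := clip_level s0 s1 C0 del0 lam0.
have l20 : 0 < (lam / 2) ^+ 2 by rewrite exprn_gt0// divr_gt0.
have e1 : 0 < kern_const T * s ^+ (3 * L) by rewrite mulr_gt0// exprn_gt0.
have e2 : 0 < del / 2 * (lam / 2) ^+ 2 by rewrite mulr_gt0// divr_gt0.
have [j [Dj Zj]] := filter_ex (filterI (cvge0_le Dcv e1) (cvge0_le Zcv e2)).
pose stc := map (clip (T * r ^+ L.+1) (r ^+ L.+1)) (st j).
have mW : forall t x, measurable_fun setT (fun w => W w t x) by case: bW.
have mw st' := @measurable_wstep R _ _ W st' mW.
have r0 : 0 <= r ^+ L.+1 by rewrite !exprn_ge0// ltW.
have r1 : r ^+ L.+1 <= 1 by rewrite exprn_ile1// ?exprn_ge0 ?exprn_ile1// ?exprn_ge0 ?(ltW sg0) ?(ltW sg1)// exprn_ile1// ltW.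
have Hstc : Stdlib.Lists.List.Forall (rect_in T) stc.
  apply: Forall_map (Hst j) => rr; apply: rect_in_clip => //.
  - by rewrite mulr_ge0// ltW.
  - by rewrite -[leRHS]mulr1 ler_wpM2l// ltW.
have Hneg : Stdlib.Lists.List.Forall (rect_in T) (st j ++ map (@rneg R) stc).
  by apply: Forall_cat => //; apply: Forall_map Hstc.
exists stc; split => //.
  move=> k l; apply: le_trans (clip_cell_le k l T0 s0 s1 Dj) _.
  by rewrite lee_fin exprM ler_wpM2r// exprn_ge0// ltW.
(* The error splits into the mean-square error in the definition of the Wiener integral, handled by
   Chebyshev, and the Gaussian removed by the cut-off, handled by its variance. *)
rewrite (_ : [set w | (lam < _)%R] =
    [set w | (lam < `|(Z w - wstep W (st j) w) + wstep W (st j ++ map (@rneg R) stc) w|)%R]); last first.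
  by apply/seteqP; split => w /=; rewrite wstep_cat_neg addrA subrK.
rewrite (_ : del = del / 2 + del / 2); last by field.
apply: norm_tail_split => //; first exact: measurable_funB.
  rewrite (_ : [set w | _] = [set w | ((lam / 2) ^+ 2 < (Z w - wstep W (st j) w) ^+ 2)%R]); last first.
    apply/seteqP; split => w /=; rewrite -[X in _ -> X]/(is_true _) -[(Z w - _) ^+ 2]real_normK ?num_real// ltr_sqr ?nnegrE//;
    by rewrite divr_ge0// ltW.
  rewrite -[X in X%:E](mulfK (lt0r_neq0 l20)); apply: measure_tail_le => //.
  - by apply: measurable_funX; exact: measurable_funB.
  - by move=> w; exact: sqr_ge0.
apply: le_trans (wstep_tail bW Hneg (divr_gt0 lam0 (ltr0n R 2))) _.
rewrite lee_fin; apply: le_trans L2.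
rewrite ler_wpM2r ?invr_ge0 ?(ltW l20)// ler_wpM2l//.
have := clip_diff_le T0 s0 s1 Dj; rewrite -/r -/stc => vle.
rewrite -lee_fin fineK// ge0_fin_numE ?enorm_ge0//; exact: le_lt_trans vle (ltry _).
Qed.

(** * Finite-dimensional laws of the convolution *)

(** When all coordinates are within [lam] the Lipschitz bound applies; the complementary event has
    probability at most [k * del] by a union bound, and there the difference is at most [2 * M]. *)
Lemma lip_row_expect_close (R : realType) d (Om : measurableType d) (P : probability Om R) (k : nat)
    (U V : 'I_k -> Om -> R) (g : 'rV[R]_k -> R) (L M lam del : R) :
  (forall i, measurable_fun setT (U i)) -> (forall i, measurable_fun setT (V i)) ->
  0 <= L -> lip_row L g -> (forall v, `|g v| <= M) -> 0 <= lam ->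
  (forall i, P [set w | (lam < `|U i w - V i w|)%R] <= del%:E)%E ->
  `|\int[P]_w g (\row_i U i w) - \int[P]_w g (\row_i V i w)| <= L * lam + 2 * M * (k%:R * del).
Proof.
move=> mU mV L0 Lg Mg lam0 H.
have M0 : 0 <= M := le_trans (normr_ge0 _) (Mg 0).
have gc := lip_row_continuous L0 Lg.
have mrow (X : 'I_k -> Om -> R) : (forall i, measurable_fun setT (X i)) ->
    measurable_fun setT (fun w => g (\row_i X i w)).
  by move=> mX; exact: measurable_continuous_row.
have irow (X : 'I_k -> Om -> R) : (forall i, measurable_fun setT (X i)) ->
    P.-integrable setT (EFin \o (fun w => g (\row_i X i w))).
  by move=> mX; apply: (@integrable_bounded _ _ _ _ _ M) => //; exact: mrow.
rewrite -RintegralB//; try exact: irow.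
pose A i := [set w | (lam < `|U i w - V i w|)%R].
have mA i : measurable (A i) by apply: measurable_norm_gt; exact: measurable_funB.
have mS : measurable_fun setT (fun w => \sum_(i < k) (\1_(A i) w : R)%:E)%E.
  by apply: emeasurable_sum => i; apply/measurable_EFinP; exact: measurable_indic.
apply: (@Rintegral_norm_le _ _ _ _ _ (fun w => (L * lam)%:E + (2 * M)%:E * \sum_(i < k) (\1_(A i) w : R)%:E)%E).
- rewrite (_ : EFin \o _ = (EFin \o (fun w => g (\row_i U i w))) \- (EFin \o (fun w => g (\row_i V i w))))%E.
    by apply: integrableB => //; exact: irow.
  by apply/funext.
- by apply: emeasurable_funD => //; apply: emeasurable_funM => //.
- move=> w; rewrite sumEFin -EFinM -EFinD lee_fin.
  have [/existsP[i Ai]|no] := boolP [exists i, (lam < `|U i w - V i w|)].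
    apply: (@le_trans _ _ (2 * M)).
      rewrite mulr2n mulrDl mul1r; apply: le_trans (ler_normB _ _) _; exact: lerD.
    rewrite (bigD1 i)//= [X in _ * (X + _)]indicE mem_set// mulrDr mulr1 [leRHS]addrCA lerDl addr_ge0 ?mulr_ge0 ?sumr_ge0//.
  apply: (@le_trans _ _ (L * lam)).
    apply: Lg => // i; rewrite !mxE leNgt; apply/negP => Ai; move/negP: no; apply; apply/existsP; by exists i.
  by rewrite lerDl mulr_ge0 ?mulr_ge0 ?sumr_ge0.
rewrite ge0_integralD//; first last.
- by apply: emeasurable_funM => //.
- by move=> w _; rewrite mule_ge0 ?sume_ge0// lee_fin// mulr_ge0.
- by move=> w _; rewrite lee_fin mulr_ge0.
rewrite integral_cst// [X in (_ * X)%E](_ : _ = 1%E) ?mule1; last exact: probability_setT.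
rewrite ge0_integralZl_EFin ?mulr_ge0//; first last.
by move=> w _; rewrite sume_ge0.
rewrite [X in (_ + _ * X <= _)%E](_ : _ = \sum_(i < k) P (A i))%E; last first.
  rewrite ge0_integral_sum//; last by move=> i; apply/measurable_EFinP; exact: measurable_indic.
  by apply: eq_bigr => i _; rewrite integral_indic// setIT.
rewrite EFinD; apply: leeD => //; rewrite [X in (_ <= X)%E]EFinM; apply: lee_wpmul2l; first by rewrite lee_fin mulr_ge0.
have -> : k%:R * del = \sum_(i < k) del by rewrite sumr_const card_ord mulr_natl.
rewrite -sumEFin; by apply: lee_sum => i _; exact: H.
Qed.

Lemma lip_row_lincomb (R : realType) (k N : nat) (q : 'I_k -> seq (R * 'I_N)) (g : 'rV[R]_k -> R) (L : R) :
  0 <= L -> lip_row L g ->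
  exists2 L', 0 <= L' & lip_row L' (fun v : 'rV[R]_N => g (\row_i \sum_(c <- q i) c.1 * v 0 c.2)).
Proof.
move=> L0 Lg; pose S := \sum_(i < k) \sum_(c <- q i) `|c.1|.
have S0 i : 0 <= \sum_(c <- q i) `|c.1| by apply: sumr_ge0.
exists (L * S); first by rewrite mulr_ge0// sumr_ge0.
move=> v v' d d0 vv; rewrite -mulrA; apply: Lg; first by rewrite mulr_ge0// sumr_ge0.
move=> i; rewrite !mxE -sumrB; apply: le_trans (ler_norm_sum _ _ _) _.
apply: (@le_trans _ _ (\sum_(c <- q i) `|c.1| * d)).
  by apply: ler_sum => c _; rewrite -mulrBr normrM ler_wpM2l.
by rewrite -mulr_suml ler_wpM2r// /S (bigD1 i)//= lerDl sumr_ge0.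
Qed.

(** (H1) speaks of one finite family of points, so the points of all the combinations are gathered
    in a single list and looked up by index. The leading [(0, 0)] makes the list nonempty, as
    [inord] requires. *)
Lemma fdd_cvg_lincomb (R : realType) (T : R) (d : nat -> measure_display)
    (Om : forall n, measurableType (d n)) (P : forall n, probability (Om n) R)
    (Z : forall n, Om n -> R -> R -> R)
    dW (OmW : measurableType dW) (PW : probability OmW R) (W : OmW -> R -> R -> R)
    (k : nat) (q : 'I_k -> seq (R * (R * R))) (g : 'rV[R]_k -> R) (L M : R) :
  0 < T -> fdd_cvg T P Z PW W -> (forall i c, c \in q i -> rectK T c.2) ->
  0 <= L -> lip_row L g -> (forall v, `|g v| <= M) ->
  (fun n => \int[P n]_w g (\row_i \sum_(c <- q i) c.1 * Z n w c.2.1 c.2.2)) @ \oo -->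
    \int[PW]_w g (\row_i \sum_(c <- q i) c.1 * W w c.2.1 c.2.2).
Proof.
move=> T0 H qK L0 Lg Mg.
pose l := flatten [seq [seq c.2 | c <- q i] | i <- enum 'I_k].
pose pts := (0, 0) :: l.
pose p (j : 'I_(size l).+1) := nth (0, 0) pts j.
have pK j : rectK T (p j).
  have : p j \in pts by apply: mem_nth; exact: ltn_ord.
  rewrite inE => /orP[/eqP ->|/flattenP[s /mapP[i _ ->] /mapP[c ci ->]]]; last exact: (qK i).
  by split; rewrite /= in_itv/= lexx ?ler01 ?ltW.
pose q' i := [seq (c.1, inord (index c.2 pts) : 'I_(size l).+1) | c <- q i].
have qE (F : R -> R -> R) : \row_i (\sum_(c <- q i) c.1 * F c.2.1 c.2.2) =
    \row_i (\sum_(c <- q' i) c.1 * (\row_j F (p j).1 (p j).2) 0 c.2) :> 'rV[R]_k.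
  apply/rowP => i; rewrite !mxE /q' big_map big_seq [RHS]big_seq; apply: eq_bigr => c ci.
  have cl : c.2 \in pts.
    rewrite inE; apply/orP; right; apply/flattenP; exists [seq c.2 | c <- q i].
      by apply: map_f; rewrite mem_enum.
    exact: map_f.
  by rewrite mxE/= /p inordK ?nth_index//; move: cl; rewrite -index_mem.
have [L' L'0 Lg'] := lip_row_lincomb q' L0 Lg.
under eq_cvg do under eq_Rintegral do rewrite qE.
under eq_Rintegral do rewrite qE.
apply: (H _ p pK (fun v => g (\row_i (\sum_(c <- q' i) c.1 * v 0 c.2)))).
  exact: lip_row_continuous L'0 Lg'.
by exists M => v; exact: Mg.
Qed.

Lemma dint_mulB (R : realType) (T : R) (f g th : R -> R -> R) :
  measurable_fun setT (fun z : R * R => f z.1 z.2) ->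
  measurable_fun setT (fun z : R * R => g z.1 z.2) ->
  measurable_fun setT (fun z : R * R => th z.1 z.2) ->
  (enorm `[0%R, T] `[0%R, 1%R] f 2 < +oo)%E -> (enorm `[0%R, T] `[0%R, 1%R] g 2 < +oo)%E ->
  (enorm `[0%R, T] `[0%R, 1%R] th 2 < +oo)%E ->
  dint `[0, T] `[0, 1] (fun s y => f s y * th s y) - dint `[0, T] `[0, 1] (fun s y => g s y * th s y) =
  dint `[0, T] `[0, 1] (fun s y => (f s y - g s y) * th s y).
Proof.
move=> mf mg mt fL gL tL.
have mK : measurable (rectK T : set (measurableTypeR R * measurableTypeR R)) by exact: measurableX.
have If := @integrable_mul_L2 R `[0, T] `[0, 1] f th (measurable_itv _) (measurable_itv _) mf mt fL tL.
have Ig := @integrable_mul_L2 R `[0, T] `[0, 1] g th (measurable_itv _) (measurable_itv _) mg mt gL tL.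
have Id : (leb2 R).-integrable (rectK T) (fun z => ((f z.1 z.2 - g z.1 z.2) * th z.1 z.2)%:E).
  rewrite (_ : (fun z => _) = (fun z => (f z.1 z.2 * th z.1 z.2)%:E - (g z.1 z.2 * th z.1 z.2)%:E)%E).
    exact: (integrableB mK If Ig).
  by apply/funext => z; rewrite mulrBl EFinB.
rewrite !dintE//; try by apply: measurable_funM => //; exact: measurable_funB.
rewrite -RintegralB//.
by apply: eq_Rintegral => z _; rewrite mulrBl.
Qed.

Lemma enorm_kern_fin (R : realType) (T t x : R) : 0 < T -> (enorm `[0%R, T] `[0%R, 1%R] (kern t x) 2 < +oo)%E.
Proof.
move=> T0; apply: le_lt_trans (@enorm_kern_small R t x (Num.sqrt T) `[0, T] _ _ _ _) (ltry _) => //.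
- by move=> s /=; rewrite in_itv/= => /andP[].
- by rewrite sqr_sqrtr ?(ltW T0)// lebesgue_measure_itv/= oppr0 adde0; case: ifP => _; rewrite lee_fin ?lexx ?(ltW T0).
Qed.

Lemma enorm_stepfun_fin (R : realType) (T : R) (st : seq (rect R)) :
  Stdlib.Lists.List.Forall (rect_in T) st -> (enorm `[0%R, T] `[0%R, 1%R] (stepfun st) 2 < +oo)%E.
Proof. by move=> Hst; rewrite (enorm_stepfun Hst) ltry. Qed.

Lemma enormB_fin (R : realType) (A B : set R) (f g : R -> R -> R) :
  measurable A -> measurable B ->
  measurable_fun setT (fun z : R * R => f z.1 z.2) ->
  measurable_fun setT (fun z : R * R => g z.1 z.2) ->
  (enorm A B f 2 < +oo)%E -> (enorm A B g 2 < +oo)%E -> (enorm A B (fun s y => f s y - g s y)%R 2 < +oo)%E.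
Proof.
move=> mA mB mf mg fL gL.
have mfg : measurable_fun setT (fun z : R * R => f z.1 z.2 - g z.1 z.2) by exact: measurable_funB.
apply: le_lt_trans (enorm_sqrD mA mB mf mg mfg _) _.
  by move=> s y; exact: ler_normB.
have fin (a b : \bar R) : (0 <= a -> 0 <= b -> a < +oo -> b < +oo -> 2%:E * (a + b) < +oo)%E.
  by case: a b => [a| |] [b| |]//= _ _ _ _; rewrite -EFinD -EFinM ltry.
exact: fin (enorm_ge0 _ _ _ _) (enorm_ge0 _ _ _ _) fL gL.
Qed.

Lemma ae_integral_norm_powR (R : realType) d (Om : measurableType d) (P : probability Om R)
    (f g : Om -> R) (m : R) : measurable_fun setT f -> measurable_fun setT g ->
  {ae P, forall w, f w = g w} ->
  (\int[P]_w ((`|f w| `^ m)%:E) = \int[P]_w ((`|g w| `^ m)%:E))%E.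
Proof.
move=> mf mg fg.
have mp (h : Om -> R) : measurable_fun setT h -> measurable_fun setT (fun w => (`|h w| `^ m)%:E).
  move=> mh; apply/measurable_EFinP.
  by apply: (@measurableT_comp _ _ _ _ _ _ (fun u : R => u `^ m)) => //; exact: measurableT_comp.
apply: ae_eq_integral => //; [exact: mp|exact: mp|].
by apply: filterS fg => w -> _.
Qed.

Lemma norm_tail_moment (R : realType) d (Om : measurableType d) (P : probability Om R)
    (f : Om -> R) (m lam c : R) : measurable_fun setT f -> 0 < m -> 0 < lam ->
  (\int[P]_w ((`|f w| `^ m)%:E) <= c%:E)%E -> (P [set w | (lam < `|f w|)%R] <= (c / lam `^ m)%:E)%E.
Proof.
move=> mf m0 lam0 fc.
rewrite (_ : [set w | _] = [set w | (lam `^ m < `|f w| `^ m)%R]); last first.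
  apply/seteqP; split => w /= H; first by rewrite gt0_ltr_powR// nnegrE// ltW.
  by rewrite ltNge; apply/negP => fl; move: H; rewrite ltNge ge0_ler_powR ?nnegrE ?(ltW m0) ?(ltW lam0).
apply: measure_tail_le => //; last by rewrite powR_gt0.
by apply: (@measurableT_comp _ _ _ _ _ _ (fun u : R => u `^ m)) => //; exact: measurableT_comp.
Qed.

Lemma eps_split (R : realType) (e L M k : R) : 0 < e -> 0 <= L -> 0 <= M -> 0 <= k ->
  L * (e / (8 * (L + 1))) + 2 * M * (k * (e / (16 * (M + 1) * (k + 1)))) <= e / 4.
Proof.
move=> e0 L0 M0 k0.
have F (a : R) : 0 <= a -> 0 <= a / (a + 1) <= 1.
  by move=> a0; rewrite divr_ge0 ?addr_ge0//= ler_pdivrMr ?mul1r ?lerDl// ltr_wpDl.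
have [/andP[_ l1] /andP[p0 p1] /andP[q0 q1]] := And3 (F L L0) (F M M0) (F k k0).
have [n1 n2 n3] : [/\ L + 1 != 0, M + 1 != 0 & k + 1 != 0] by split; rewrite gt_eqF// ltr_wpDl.
have -> : L * (e / (8 * (L + 1))) = e / 8 * (L / (L + 1)) by field.
have -> : 2 * M * (k * (e / (16 * (M + 1) * (k + 1)))) = e / 8 * (M / (M + 1) * (k / (k + 1))).
  by field; apply/andP.
rewrite (_ : e / 4 = e / 8 * 1 + e / 8 * 1); last by field.
by rewrite lerD// ler_pM2l ?divr_gt0// mulr_ile1.
Qed.

Lemma exists_small_powR (R : realType) (c p a b : R) : 0 <= c -> 0 < p -> 0 < a -> 0 < b ->
  exists2 G, 0 < G & G <= a /\ c * G `^ p <= b.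
Proof.
move=> c0 p0 a0 b0; have c1 : 0 < c + 1 by rewrite ltr_wpDl.
have q0 : 0 < b / (c + 1) by rewrite divr_gt0.
exists (Num.min a ((b / (c + 1)) `^ p^-1)); first by rewrite lt_min a0 powR_gt0.
split; first by rewrite ge_min lexx.
apply: (@le_trans _ _ (c * (b / (c + 1)))).
  rewrite ler_wpM2l// -[leRHS]powRr1 ?(ltW q0)// -(mulVf (lt0r_neq0 p0)) powRrM ge0_ler_powR ?(ltW p0)//.
  - by rewrite nnegrE le_min (ltW a0) powR_ge0.
  - by rewrite nnegrE powR_ge0.
  - by rewrite ge_min lexx orbT.
by rewrite mulrA ler_pdivrMr// mulrC ler_wpM2l ?(ltW b0)// lerDl.
Qed.

Lemma dist_chain (R : realType) (a b c y e : R) : `|y - b| <= e / 4 -> `|b - c| <= e / 4 ->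
  `|a - c| <= e / 4 -> `|y - a| <= e.
Proof.
by rewrite !ler_norml => /andP[a1 a2] /andP[b1 b2] /andP[c1 c2]; apply/andP; split; lra.
Qed.

Section fdd_kern.
Variables (R : realType) (T m C sg : R) (d : nat -> measure_display)
  (Om : forall n, measurableType (d n)) (P : forall n, probability (Om n) R)
  (th X : forall n, Om n -> R -> R -> R)
  (dW : measure_display) (OmW : measurableType dW) (PW : probability OmW R)
  (W Y : OmW -> R -> R -> R).
Arguments X : clear implicits.
Arguments th : clear implicits.
Let r := (sg ^+ 4) ^+ 16.
Hypotheses (T0 : 0 < T) (m1 : 1 <= m) (C0 : 0 <= C) (sg0 : 0 < sg) (sg1 : sg < 1) (r2 : 1 < 2 * r).
Hypothesis mth : forall n, measurable_fun setT (fun z : Om n * (R * R) => th n z.1 z.2.1 z.2.2).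
Hypothesis thL : forall n w, (enorm `[0%R, T] `[0%R, 1%R] (th n w) 2 < +oo)%E.
Hypothesis hth : forall n, (0 < n)%N -> moment_hyp T m C (P n) (th n).
Hypothesis mX : forall n t x, measurable_fun setT (fun w => X n w t x).
Hypothesis verX : forall n t x, rectK T (t, x) ->
  {ae P n, forall w, X n w t x = dint `[0, T] `[0, 1] (fun s y => kern t x s y * th n w s y)}.

Let r1 : r < 1.
Proof. by rewrite !exprn_ilt1 ?exprn_ge0// ltW. Qed.

(** Stated for a general [f] because it serves twice: with a step function for the
    finite-dimensional laws, and with another kernel for the increments. The decay rate [sg'] is
    separate from the [sg] that fixes the cells, since increments decay more slowly. *)
Lemma kern_diff_moment (n : nat) (t x : R) (V : Om n -> R) (f : R -> R -> R) (G sg' : R) :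
  (0 < n)%N -> rectK T (t, x) -> measurable_fun setT V ->
  measurable_fun setT (fun z : R * R => f z.1 z.2) ->
  (enorm `[0%R, T] `[0%R, 1%R] f 2 < +oo)%E ->
  {ae P n, forall w, V w = dint `[0, T] `[0, 1] (fun s y => f s y * th n w s y)} ->
  0 <= G -> 0 < sg' -> sg' < 1 ->
  (forall k l : nat, enorm `[(T * r ^+ k.+1)%R, (T * r ^+ k)%R] `[(r ^+ l.+1)%R, (r ^+ l)%R]
    (fun s y => kern t x s y - f s y)%R 2 <= (G * sg' ^+ (4 * (k + l)))%:E)%E ->
  (\int[P n]_w ((`| X n w t x - V w | `^ m)%:E) <= (C * cell_const sg' m * G `^ (m / 2))%:E)%E.
Proof.
move=> n0 tx mV mf fL verV G0 s0 s1 cells.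
have mk := measurable_kern t x; have kL := enorm_kern_fin t x T0.
have mfk : measurable_fun setT (fun z : R * R => kern t x z.1 z.2 - f z.1 z.2) by exact: measurable_funB.
have fkL := enormB_fin (measurable_itv `[0, T]) (measurable_itv `[0, 1]) mk mf kL fL.
rewrite (@ae_integral_norm_powR _ _ _ _ _ (fun w => dint `[0, T] `[0, 1] (fun s y => (kern t x s y - f s y) * th n w s y))).
- refine (moment_bound (f := fun s y => kern t x s y - f s y) (r := r) T0 m1 C0 s0 s1 r2 r1 (@mth n) (@thL n) (hth n0) mfk fkL G0 cells).
- exact: measurable_funB.
- exact: (@measurable_dint_mul R _ _ (th n) (fun s y => kern t x s y - f s y)).
apply: filterS2 (verX n tx) verV => w -> ->.
have mtw : measurable_fun setT (fun z : R * R => th n w z.1 z.2).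
  refine (@measurable_fun_pair2 _ _ _ _ _ _ (fun z : Om n * (R * R) => th n z.1 z.2.1 z.2.2) w (@mth n)).
exact: (dint_mulB (f := kern t x) (g := f) (th := th n w) mk mf mtw kL fL (@thL n w)).
Qed.

Hypothesis H1 : fdd_cvg T P (fun n w t x => dint `[0%R, t] `[0%R, x] (th n w)) PW W.
Hypothesis bW : brownian_sheet T PW W.
Hypothesis mY : forall t x, measurable_fun setT (fun w => Y w t x).
Hypothesis verY : forall t x, rectK T (t, x) -> wiener_integral T PW W (kern t x) (fun w => Y w t x).

(** The step functions are chosen from [e] and the points alone, so the error on the side of [X] is
    uniform in [n], and (H1) is applied to a fixed family of linear combinations. *)
Lemma kern_fdd_lip_cvg : fdd_lip_cvg T P X PW Y.
Proof.
move=> k p pK g L M L0 Lg Mg.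
have M0 : 0 <= M := le_trans (normr_ge0 _) (Mg 0).
pose zeta n (w : Om n) t x := dint `[0%R, t] `[0%R, x] (th n w).
have mzeta n t x : measurable_fun setT (fun w => zeta n w t x).
  by apply: (@measurable_dint R _ _ (th n)).
have mW : forall t x, measurable_fun setT (fun w => W w t x) by case: bW.
have m0 : 0 < m := lt_le_trans ltr01 m1.
apply/cvgrPdist_le => e e0.
pose lam := e / (8 * (L + 1)).
have lam0 : 0 < lam by rewrite divr_gt0// mulr_gt0// ltr_wpDl.
pose del := e / (16 * (M + 1) * (k%:R + 1)).
have del0 : 0 < del by rewrite divr_gt0// !mulr_gt0// ltr_wpDl.
have small : L * lam + 2 * M * (k%:R * del) <= e / 4 by exact: eps_split.
pose cc := C * cell_const sg m.
(* [G] measures the cell errors: at most [del] for the tail on the side of [Y], and so small that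
   the moment bound with Markov's inequality gives probability at most [del] on the side of [X]. *)
have [G G0 [Gd Gm]] : exists2 G, 0 < G & G <= del /\ cc * G `^ (m / 2) / lam `^ m <= del.
  have cc0 : 0 <= cc by rewrite mulr_ge0// mulr_ge0 ?powR_ge0// sqr_ge0.
  have lm0 : 0 < lam `^ m by rewrite powR_gt0.
  have [G G0 [h1 h2]] := exists_small_powR cc0 (divr_gt0 m0 (ltr0n R 2)) del0 (mulr_gt0 del0 lm0).
  by exists G => //; split => //; rewrite ler_pdivrMr.
have /choice[st Hst] : forall i, exists st, [/\ Stdlib.Lists.List.Forall (rect_in T) st,
    (forall k l : nat, enorm `[(T * r ^+ k.+1)%R, (T * r ^+ k)%R] `[(r ^+ l.+1)%R, (r ^+ l)%R]
       (fun s y => kern (p i).1 (p i).2 s y - stepfun st s y)%R 2 <= (G * sg ^+ (4 * (k + l)))%:E)%E &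
    (PW [set w | (lam < `|Y w (p i).1 (p i).2 - wstep W st w|)%R] <= del%:E)%E].
  move=> i; have pi : rectK T ((p i).1, (p i).2) by case: (p i) (pK i).
  have [st [h1 h2 h3]] := kern_step_approx T0 sg0 sg1 bW (verY pi) (mY _ _) G0 lam0.
  exists st; split => //; apply: le_trans h3 _; by rewrite lee_fin.
have middle : (fun n => \int[P n]_w g (\row_i wstep (zeta n) (st i) w)) @ \oo -->
    \int[PW]_w g (\row_i wstep W (st i) w).
  under eq_cvg do under eq_Rintegral do (under eq_mx do rewrite wstep_corners).
  under eq_Rintegral do under eq_mx do rewrite wstep_corners.
  apply: (fdd_cvg_lincomb (q := fun i => corner_pts (st i)) T0 H1 _ L0 Lg Mg) => i c.
  by have [h _ _] := Hst i; exact: corner_pts_in.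
have e4 : 0 < e / 4 by rewrite divr_gt0.
have /cvgrPdist_le/(_ _ e4) mid := middle.
have pos : \forall n \near \oo, (0 < n)%N by exists 1%N.
apply: filterS2 mid pos => n mid n0.
have cX : `|\int[P n]_w g (\row_i X n w (p i).1 (p i).2) - \int[P n]_w g (\row_i wstep (zeta n) (st i) w)| <= e / 4.
  apply: le_trans small; apply: (lip_row_expect_close (U := fun i w => X n w (p i).1 (p i).2)
    (V := fun i w => wstep (zeta n) (st i) w)) => //.
  - by move=> i; exact: measurable_wstep.
  - exact: ltW.
  move=> i; have [h1 h2 _] := Hst i; have pi : rectK T ((p i).1, (p i).2) by case: (p i) (pK i).
  apply: (@le_trans _ _ (cc * G `^ (m / 2) / lam `^ m)%:E); last by rewrite lee_fin.
  apply: norm_tail_moment => //; first by apply: measurable_funB => //; exact: measurable_wstep.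
  apply: (kern_diff_moment n0 pi _ (measurable_stepfun (st i)) (enorm_stepfun_fin h1) _ (ltW G0) sg0 sg1 h2).
    exact: measurable_wstep.
  apply: aeW => w; rewrite wstep_dint//.
  refine (@measurable_fun_pair2 _ _ _ _ _ _ (fun z : Om n * (R * R) => th n z.1 z.2.1 z.2.2) w (@mth n)).
have cY : `|\int[PW]_w g (\row_i Y w (p i).1 (p i).2) - \int[PW]_w g (\row_i wstep W (st i) w)| <= e / 4.
  apply: le_trans small; apply: (lip_row_expect_close (U := fun i w => Y w (p i).1 (p i).2)
    (V := fun i w => wstep W (st i) w)) => //.
  - by move=> i; exact: measurable_wstep.
  - exact: ltW.
  by move=> i; have [_ _] := Hst i.
exact: dist_chain cY mid cX.
Qed.
End fdd_kern.

(** * Dyadic increments of the convolution *)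

Lemma tnode_half_dist (R : realType) (T : R) (j a : nat) : 0 <= T ->
  `|tnode T j.+1 a - tnode T j a./2| <= T / (2 ^ j)%:R.
Proof.
move=> T0; have q0 : 0 < (2 ^ j)%:R :> R by rewrite ltr0n expn_gt0.
pose u : R := (minn a (2 ^ j.+1))%:R; pose v : R := (minn a./2 (2 ^ j))%:R.
have h : 0 <= u - 2 * v <= 2.
  have h1 : (2 * minn a./2 (2 ^ j) <= minn a (2 ^ j.+1) <= 2 * minn a./2 (2 ^ j) + 2)%N.
    by rewrite expnS; move: (2 ^ j)%N => q; have := odd_double_half a; case: (odd a) => /=; lia.
  move/andP: h1 => [h1 h2]; by rewrite /u /v subr_ge0 -natrM ler_nat h1/= lerBlDl -natrD ler_nat.
move/andP: h => [h1 h2]; rewrite /tnode -/u -/v expnS natrM.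
have -> : T * (u / (2 * (2 ^ j)%:R)) - T * (v / (2 ^ j)%:R) = T / (2 ^ j)%:R * ((u - 2 * v) / 2).
  by field; rewrite gt_eqF.
rewrite ger0_norm ?mulr_ge0 ?invr_ge0 ?(ltW q0)// -[leRHS]mulr1 ler_wpM2l//.
  by rewrite divr_ge0// ltW.
by rewrite ler_pdivrMr// mul1r.
Qed.

Lemma le_powR_interp (R : realType) (y D E a : R) : 0 <= y -> y <= D -> y <= E -> 0 < a -> a < 1 ->
  y <= D `^ (1 - a) * E `^ a.
Proof.
move=> y0 yD yE a0 a1; have a1' : 0 < 1 - a by rewrite subr_gt0.
have -> : y = y `^ (1 - a) * y `^ a by rewrite -powRD ?subrK ?powRr1// oner_eq0.
by apply: ler_pM; rewrite ?powR_ge0//; apply: ge0_ler_powR; rewrite ?nnegrE ?(ltW a0) ?(ltW a1')// (le_trans y0).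
Qed.

(* [h ^ 2 = 1 / 2]: the squared [L2]-modulus of the heat kernel over a dyadic step is of order [h ^ j]. *)
Lemma kern_dyadic_incr (R : realType) (T : R) (j a b : nat) : 0 < T ->
  (enorm `[0%R, T] `[0%R, 1%R] (fun s y => kern (tnode T j.+1 a) (tnode 1 j.+1 b) s y -
     kern (tnode T j a./2) (tnode 1 j b./2) s y)%R 2
   <= (16 * (1 + Num.sqrt (2 * T)) * (Num.sqrt 2^-1) ^+ j)%:E)%E.
Proof.
move=> T0; set h := Num.sqrt 2^-1.
have h0 : 0 < h by rewrite sqrtr_gt0 invr_gt0.
have h1 : h <= 1 by rewrite -[leRHS]sqrtr1 ler_wsqrtr// invf_le1// ler1n.
have hE : ((2 ^ j)%:R)^-1 = h ^+ j * h ^+ j :> R.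
  by rewrite natrX -exprVn -exprMn -expr2 sqr_sqrtr// invr_ge0.
have hj : 0 <= h ^+ j by rewrite exprn_ge0// ltW.
apply: (le_trans (enorm_kern_incr _ _ _ _ (measurable_itv _) _)).
  by move=> s /=; rewrite in_itv/= => /andP[].
rewrite (_ : 16 * (1 + _) * _ = 16 * (h ^+ j + Num.sqrt (2 * T) * h ^+ j)); last by ring.
rewrite lee_fin ler_pM2l//; apply: lerD.
  apply: (le_trans (tnode_half_dist j b ler01)).
  by rewrite mul1r hE ler_piMl// exprn_ile1// ltW.
apply: (@le_trans _ _ (Num.sqrt (2 * T * (h ^+ j) ^+ 2))); last first.
  by rewrite sqrtrM ?mulr_ge0 ?(ltW T0)// sqrtr_sqr ger0_norm.
rewrite ler_wsqrtr// -mulrA ler_pM2l//; apply: (le_trans (tnode_half_dist j a (ltW T0))).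
by rewrite hE expr2.
Qed.

(** The increment on a cell is at most [D], which is small but does not decay, and at most the sum
    of the two kernels' bounds, which decays but is not small. Their geometric mean with exponents 1
    - a and a has both properties. *)
Lemma kern_incr_cell (R : realType) (T t x t' x' s D a : R) (k l : nat) :
  0 < T -> 0 < s -> s < 1 -> 0 < a -> a < 1 -> let r := s ^+ 16 in
  (enorm `[0%R, T] `[0%R, 1%R] (fun s y => kern t x s y - kern t' x' s y)%R 2 <= D%:E)%E ->
  (enorm `[(T * r ^+ k.+1)%R, (T * r ^+ k)%R] `[(r ^+ l.+1)%R, (r ^+ l)%R]
     (fun s y => kern t x s y - kern t' x' s y)%R 2
   <= (D `^ (1 - a) * (4 * kern_const T) `^ a * (s `^ (a / 2)) ^+ (4 * (k + l)))%:E)%E.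
Proof.
move=> T0 s0 s1 a0 a1 r HD.
have mk := @measurable_kern R.
have md : measurable_fun setT (fun z : R * R => kern t x z.1 z.2 - kern t' x' z.1 z.2).
  exact: measurable_funB (mk _ _) (mk _ _).
have r0 n : 0 < r ^+ n by rewrite /r -exprM exprn_gt0.
have r1 n : r ^+ n <= 1 by rewrite /r -exprM exprn_ile1// ltW.
have C0 : 0 <= kern_const T by rewrite /kern_const !addr_ge0// ?mulr_ge0 ?sqrtr_ge0// ltW.
have sub1 : `[(T * r ^+ k.+1)%R, (T * r ^+ k)%R] `<=` (`[0, T] : set R).
  move=> z /=; rewrite !in_itv/= => /andP[z1 z2]; rewrite (le_trans _ z1) ?mulr_ge0 ?(ltW (r0 _)) ?(ltW T0)//.
  by apply: (le_trans z2); rewrite -[leRHS]mulr1 ler_wpM2l// ltW.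
have sub2 : `[(r ^+ l.+1)%R, (r ^+ l)%R] `<=` (`[0, 1] : set R).
  by move=> z /=; rewrite !in_itv/= => /andP[z1 z2]; rewrite (le_trans _ z1) ?(ltW (r0 _))// (le_trans z2).
have [_ [_]] := enorm_kern_cell t x k l T0 s0 s1; rewrite -/r => c1.
have [_ [_]] := enorm_kern_cell t' x' k l T0 s0 s1; rewrite -/r => c2.
set E := enorm _ _ _ _.
have E1 : (E <= D%:E)%E.
  apply: le_trans HD; exact: (enorm_subset (measurable_itv _) (measurable_itv _) (measurable_itv _) (measurable_itv _) md sub1 sub2).
have E2 : (E <= (4 * kern_const T * s ^+ (2 * (k + l)))%:E)%E.
  rewrite (_ : 4 * _ * _ = 2 * (kern_const T * s ^+ (2 * (k + l)) + kern_const T * s ^+ (2 * (k + l)))); last by ring.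
  refine (enorm_sqrD_le (measurable_itv _) (measurable_itv _) (mk t x) (mk t' x') md _ c1 c2).
  by move=> z y; exact: ler_normB.
have E0 : (0 <= E)%E by exact: enorm_ge0.
have Ef : E \is a fin_num by rewrite ge0_fin_numE//; exact: le_lt_trans E1 (ltry _).
move: E0 E1 E2; rewrite -(fineK Ef) !lee_fin => y0 y1 y2.
apply: (le_trans (le_powR_interp y0 y1 y2 a0 a1)).
rewrite -[leRHS]mulrA ler_wpM2l ?powR_ge0// powRM ?mulr_ge0// ?exprn_ge0 ?(ltW s0)// ler_wpM2l ?powR_ge0//.
rewrite -!powR_mulrn ?powR_ge0 ?(ltW s0)// -!powRrM le_eqVlt; apply/orP; left; apply/eqP; congr (_ `^ _).
by rewrite !natrM; field.
Qed.

(** With a = (1 - 8/m)/2 the exponent (1 - a) m/2 equals m/4 + 2, which exceeds 4 because m > 8. As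
    h^4 = 1/4, the power of [h] is below 1/4, and [nu] is defined by nu^m = 4 h^((1-a) m/2). *)
Lemma dyadic_exponent (R : realType) (m h : R) : 8 < m -> h = Num.sqrt 2^-1 ->
  exists a nu : R, [/\ 0 < a < 1, 0 < nu < 1 & h `^ ((1 - a) * (m / 2)) = nu `^ m / 4].
Proof.
move=> m8 hE; have m0 : 0 < m := lt_trans (ltr0n R 8) m8.
have h0 : 0 < h by rewrite hE sqrtr_gt0 invr_gt0.
have h1 : h < 1 by rewrite hE -[ltRHS]sqrtr1 ltr_sqrt// invf_lt1// ltr1n.
have h4 : h ^+ 4 = 4^-1.
  by rewrite hE (_ : 4 = 2 * 2)%N// exprM sqr_sqrtr ?invr_ge0// expr2 -invfM -natrM.
have lt1 (x c : R) : 0 < x -> x < 1 -> 0 < c -> x `^ c < 1.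
  move=> x0 x1 c0; apply: (@lt_le_trans _ _ (1 `^ c)); last by rewrite powR1.
  by apply: gt0_ltr_powR; rewrite ?nnegrE ?(ltW x0).
pose a := (1 - 8 / m) / 2.
have m8' : 8 / m < 1 by rewrite ltr_pdivrMr// mul1r.
have m80 : 0 < 8 / m by rewrite divr_gt0.
exists a, ((4 * h `^ ((1 - a) * (m / 2))) `^ m^-1).
have p0 : 0 < 4 * h `^ ((1 - a) * (m / 2)) by rewrite mulr_gt0// powR_gt0.
have p1 : 4 * h `^ ((1 - a) * (m / 2)) < 1.
  rewrite mulrC -ltr_pdivlMr// mul1r -h4 -powR_mulrn ?(ltW h0)//.
  have -> : (1 - a) * (m / 2) = 4 + (m / 4 - 2) by rewrite /a; field; rewrite gt_eqF.
  rewrite powRD; last by rewrite (gt_eqF h0) implybT.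
  rewrite gtr_pMr ?powR_gt0//; apply: lt1 => //.
  by rewrite subr_gt0 ltr_pdivlMr// -natrM.
split.
- by rewrite /a; apply/andP; split; lra.
- rewrite powR_gt0//=; by apply: lt1; rewrite ?invr_gt0.
- by rewrite -powRrM mulVf ?gt_eqF// powRr1 ?(ltW p0)//; field.
Qed.

(** Repeated squaring with short rational lower bounds, so that each step is small arithmetic; the
    actual value of (99/100)^64 is about 0.5256. *)
Lemma ratio_gt_half (R : realType) : 1 < 2 * ((99 / 100 : R) ^+ 4) ^+ 16.
Proof.
have S (z y x : R) : 0 <= y -> z <= y * y -> y <= x -> z <= x ^+ 2.
  by move=> y0 zy yx; apply: (le_trans zy); rewrite expr2 ler_pM.
set x := _ ^+ 4.
have x1 : 9605 / 10000 <= x by rewrite /x; lra.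
clearbody x.
have x2 : 922 / 1000 <= x ^+ 2 by apply: S x1; lra.
move: (x ^+ 2) x2 (exprM x 2 8) => y y2 E.
have y4 : 85 / 100 <= y ^+ 2 by apply: S y2; lra.
have y8 : 722 / 1000 <= (y ^+ 2) ^+ 2 by apply: S y4; lra.
have y16 : 521 / 1000 <= ((y ^+ 2) ^+ 2) ^+ 2 by apply: S y8; lra.
by move: y16; rewrite E -!exprM; move: (y ^+ _) => z z1; lra.
Qed.

(** * Modification on null sets and conclusion *)

Lemma measurable_integral_param (R : realType) d (Y : measurableType d) (h : Y * R -> \bar R) (B : set R) :
  measurable B -> measurable_fun setT h -> (forall z, (0 <= h z)%E) ->
  measurable_fun setT (fun w => \int[lebesgue_measure]_(y in B) h (w, y))%E.
Proof.
move=> mB mh h0; pose G (z : Y * R) := (h z * (\1_B z.2 : R)%:E)%E.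
rewrite (_ : (fun w => _) = fubini_F lebesgue_measure G); last first.
  apply/funext => w; rewrite integral_mkcond; apply: eq_integral => y _.
  by rewrite patchE /G indicE; case: ifPn => _; rewrite ?mule1 ?mule0.
apply: measurable_fun_fubini_tonelli_F.
  apply: emeasurable_funM => //; apply/measurable_EFinP; apply: measurableT_comp => //.
by move=> z; rewrite mule_ge0// lee_fin.
Qed.

Lemma measurable_enorm (R : realType) d (Om : measurableType d) (th : Om -> R -> R -> R) (A B : set R) (p : R) :
  measurable A -> measurable B ->
  measurable_fun setT (fun z : Om * (R * R) => th z.1 z.2.1 z.2.2) ->
  measurable_fun setT (fun w => enorm A B (th w) p).
Proof.
move=> mA mB mth; rewrite /enorm.
apply: (@measurable_integral_param R _ _ (fun z : Om * R =>
  \int[lebesgue_measure]_(y in B) ((`|th z.1 z.2 y| `^ p)%:E))%E) => //; last first.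
  by move=> z; apply: integral_ge0 => y _; rewrite lee_fin powR_ge0.
apply: (@measurable_integral_param R _ _ (fun z : (Om * R) * R => (`|th z.1.1 z.1.2 z.2| `^ p)%:E)) => //.
apply/measurable_EFinP; apply: (@measurableT_comp _ _ _ _ _ _ (fun u : R => u `^ p)) => //.
apply: measurableT_comp => //.
pose g (z : (Om * R) * R) := (z.1.1, (z.1.2, z.2)).
rewrite (_ : (fun z : (Om * R) * R => _) = (fun z : Om * (R * R) => th z.1 z.2.1 z.2.2) \o g)//.
apply: measurableT_comp => //.
apply: measurable_fun_pair; first exact: measurableT_comp.
apply: measurable_fun_pair => //; exact: measurableT_comp.
Qed.

(** The paths of [theta] are square integrable only almost surely. Setting the exceptional ones to
    zero makes every path so, and the result stays jointly measurable because the norm is measurable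
    in [w]. *)
Definition trunc_L2 (R : realType) (T : R) (Om : Type) (th : Om -> R -> R -> R) (w : Om) (s y : R) : R :=
  if (enorm `[0%R, T] `[0%R, 1%R] (th w) 2 < +oo)%E then th w s y else 0.

Lemma trunc_L2_fin (R : realType) (T : R) (Om : Type) (th : Om -> R -> R -> R) (w : Om) :
  (enorm `[0%R, T] `[0%R, 1%R] (trunc_L2 T th w) 2 < +oo)%E.
Proof.
have [h|h] : (enorm `[0%R, T] `[0%R, 1%R] (th w) 2 < +oo)%E \/ ~~ (enorm `[0%R, T] `[0%R, 1%R] (th w) 2 < +oo)%E.
  by apply/orP; exact: orbN.
  by rewrite (_ : trunc_L2 T th w = th w)//; apply/funext => s; apply/funext => y; rewrite /trunc_L2 h.
rewrite (_ : trunc_L2 T th w = fun _ _ => 0); last first.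
  by apply/funext => s; apply/funext => y; rewrite /trunc_L2 (negbTE h).
rewrite enormE//; under eq_integral do rewrite expr0n/=.
by rewrite integral0 ltry.
Qed.

Lemma measurable_trunc_L2 (R : realType) (T : R) d (Om : measurableType d) (th : Om -> R -> R -> R) :
  measurable_fun setT (fun z : Om * (R * R) => th z.1 z.2.1 z.2.2) ->
  measurable_fun setT (fun z : Om * (R * R) => trunc_L2 T th z.1 z.2.1 z.2.2).
Proof.
move=> mth; pose A := [set w | (enorm `[0%R, T] `[0%R, 1%R] (th w) 2 < +oo)%E].
have mA : measurable A.
  have mE := measurable_enorm 2 (measurable_itv `[0, T]) (measurable_itv `[0, 1]) mth.
  by have := emeasurable_fun_infty_o measurableT mE +oo%E; rewrite setTI.
rewrite (_ : (fun z => _) = fun z : Om * (R * R) => \1_A z.1 * th z.1 z.2.1 z.2.2); last first.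
  apply/funext => z; rewrite /trunc_L2 indicE; case: ifPn => zA.
    by rewrite mem_set// mul1r.
  by rewrite memNset ?mul0r//; exact/negP.
apply: measurable_funM => //; apply: measurableT_comp; [exact: measurable_indic|exact: measurable_fst].
Qed.

Lemma trunc_L2_ae (R : realType) (T : R) d (Om : measurableType d) (P : probability Om R) (th : Om -> R -> R -> R) :
  {ae P, forall w, (enorm `[0%R, T] `[0%R, 1%R] (th w) 2 < +oo)%E} ->
  {ae P, forall w, trunc_L2 T th w = th w}.
Proof. by apply: filterS => w wL; apply/funext => s; apply/funext => y; rewrite /trunc_L2 wL. Qed.

(** The integrands may differ at [s = t], where [green] is taken at time 0; passing to the half-open
    interval drops this single time, and [kern] vanishes afterwards. *)
Lemma dint_green_kern (R : realType) (T t x : R) (h : R -> R -> R) :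
  0 <= t -> t <= T -> measurable_fun setT (fun z : R * R => h z.1 z.2) ->
  dint `[0, t] `[0, 1] (fun s y => green (t - s) x y * h s y) =
  dint `[0, T] `[0, 1] (fun s y => kern t x s y * h s y).
Proof.
move=> t0 tT mh; rewrite /dint.
pose F s := \int[lebesgue_measure]_(y in `[0, 1]) (kern t x s y * h s y).
have mF : measurable_fun setT F.
  apply: (@measurable_Rintegral_param R _ _ (fun z : R * R => kern t x z.1 z.2 * h z.1 z.2)) => //.
  by apply: measurable_funM => //; exact: measurable_kern.
have F0 s : t <= s -> F s = 0.
  move=> ts; rewrite /F /Rintegral integral0_eq// => y _.
  by rewrite /kern ltNge ts/= mul0r.
have FE s : s < t -> \int[lebesgue_measure]_(y in `[0, 1]) (green (t - s) x y * h s y) = F s.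
  by move=> st; rewrite /F; apply: eq_Rintegral => y _; rewrite /kern st.
rewrite -/F /Rintegral; congr fine.
rewrite -integral_itv_bndo_bndc; last first.
  apply: (@eq_measurable_fun _ _ _ _ _ (EFin \o F)); last by apply/measurable_EFinP; exact: measurable_funTS.
  by move=> s; rewrite inE/= in_itv/= => /andP[_ st]; congr EFin; exact/esym/FE.
have E : (\int[lebesgue_measure]_(s in `[0%R, t[) (F s)%:E = \int[lebesgue_measure]_(s in `[0%R, T]) (F s)%:E)%E.
  rewrite [LHS]integral_mkcond [RHS]integral_mkcond; apply: eq_integral => s _.
  rewrite !patchE !mem_setE !in_itv/=; have [st|st] := ltP s t; rewrite ?andbT ?andbF.
    by rewrite (ltW (lt_le_trans st tT)) andbT.
  by rewrite (F0 _ st); case: ifP.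
rewrite -E; apply: eq_integral => s; rewrite inE/= in_itv/= => /andP[_ st]; congr EFin; exact: FE.
Qed.

Lemma powR_scale_split (R : realType) (D h E a p : R) (j : nat) : 0 <= D -> 0 <= h ->
  ((D * h ^+ j) `^ (1 - a) * E `^ a) `^ p =
  (D `^ (1 - a) * E `^ a) `^ p * (h `^ ((1 - a) * p)) ^+ j.
Proof.
move=> D0 h0; have hj : 0 <= h ^+ j by rewrite exprn_ge0.
rewrite (powRM _ D0 hj) -mulrA (mulrC ((h ^+ j) `^ _)) mulrA powRM ?mulr_ge0 ?powR_ge0//.
congr (_ * _); rewrite -powRrM -!powR_mulrn ?powR_ge0// -!powRrM; congr (_ `^ _); ring.
Qed.

Lemma dyadic_incr_moment (R : realType) (T m C sg : R) (d : nat -> measure_display)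
    (Om : forall n, measurableType (d n)) (P : forall n, probability (Om n) R)
    (th X : forall n, Om n -> R -> R -> R) :
  0 < T -> 8 < m -> 0 <= C -> 0 < sg -> sg < 1 -> 1 < 2 * (sg ^+ 4) ^+ 16 ->
  (forall n, measurable_fun setT (fun z : Om n * (R * R) => th n z.1 z.2.1 z.2.2)) ->
  (forall n w, (enorm `[0%R, T] `[0%R, 1%R] (th n w) 2 < +oo)%E) ->
  (forall n, (0 < n)%N -> moment_hyp T m C (P n) (th n)) ->
  (forall n t x, measurable_fun setT (fun w => X n w t x)) ->
  (forall n t x, rectK T (t, x) ->
    {ae P n, forall w, X n w t x = dint `[0, T] `[0, 1] (fun s y => kern t x s y * th n w s y)}) ->
  exists nu K : R, [/\ 0 < nu < 1, 0 <= K & forall n j a b : nat, (0 < n)%N ->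
    (\int[P n]_w ((`| X n w (tnode T j.+1 a) (tnode 1 j.+1 b) -
        X n w (tnode T j a./2) (tnode 1 j b./2) | `^ m)%:E) <= (K * (nu `^ m / 4) ^+ j)%:E)%E].
Proof.
move=> T0 m8 C0 sg0 sg1 r2 mth thL hth mX verX.
pose h : R := Num.sqrt 2^-1.
have h0 : 0 < h by rewrite sqrtr_gt0 invr_gt0.
have [a [nu [/andP[a0 a1] nu01 hnu]]] := @dyadic_exponent R m h m8 erefl.
have m0 : 0 < m := lt_trans (ltr0n R 8) m8.
have m1 : 1 <= m by apply: le_trans (ltW m8); rewrite ler1n.
pose s := sg ^+ 4.
have s0 : 0 < s by rewrite exprn_gt0.
have s1 : s < 1 by rewrite exprn_ilt1// ltW.
(* Interpolation keeps the share [a] of the decay s^(2(k+l)), that is (s^(a/2))^(4(k+l)); the cells,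
   of ratio s^16, are unchanged. *)
pose sg' := s `^ (a / 2).
have a2 : 0 < a / 2 by rewrite divr_gt0.
have sg'0 : 0 < sg' by rewrite powR_gt0.
have sg'1 : sg' < 1.
  apply: (@lt_le_trans _ _ (1 `^ (a / 2))); last by rewrite powR1.
  by apply: gt0_ltr_powR; rewrite ?nnegrE ?(ltW s0).
pose D0 := 16 * (1 + Num.sqrt (2 * T)).
have D00 : 0 <= D0 by rewrite mulr_ge0// addr_ge0// sqrtr_ge0.
have k0 : 0 <= 4 * kern_const T.
  by rewrite mulr_ge0// /kern_const !addr_ge0// ?mulr_ge0 ?sqrtr_ge0// ltW.
pose B := D0 `^ (1 - a) * (4 * kern_const T) `^ a.
have cc0 : 0 <= C * cell_const sg' m by rewrite mulr_ge0// mulr_ge0 ?powR_ge0// sqr_ge0.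
exists nu, (C * cell_const sg' m * B `^ (m / 2)); split => //; first by rewrite mulr_ge0 ?powR_ge0.
move=> n j i b n0.
have hj : 0 <= h ^+ j by rewrite exprn_ge0// ltW.
pose G := (D0 * h ^+ j) `^ (1 - a) * (4 * kern_const T) `^ a.
have cells := fun k l => kern_incr_cell k l T0 s0 s1 a0 a1 (kern_dyadic_incr j i b T0).
have main := kern_diff_moment T0 m1 C0 sg0 sg1 r2 mth thL hth mX verX n0
  (rectK_tnode j.+1 i b (ltW T0)) (mX n _ _) (measurable_kern (tnode T j i./2) (tnode 1 j b./2))
  (enorm_kern_fin _ _ T0) (verX n _ _ (rectK_tnode j i./2 b./2 (ltW T0)))
  (mulr_ge0 (powR_ge0 _ _) (powR_ge0 _ _)) sg'0 sg'1 cells.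
have E := powR_scale_split (4 * kern_const T) a (m / 2) j D00 (ltW h0).
apply: (le_trans main); rewrite lee_fin -hnu.
by rewrite le_eqVlt; apply/orP; left; apply/eqP; rewrite -[RHS]mulrA -E.
Qed.

Lemma fdd_cvg_ae (R : realType) (T : R) (d : nat -> measure_display)
    (Om : forall n, measurableType (d n)) (P : forall n, probability (Om n) R)
    (Z Z' : forall n, Om n -> R -> R -> R)
    dW (OmW : measurableType dW) (PW : probability OmW R) (W : OmW -> R -> R -> R) :
  (forall n t x, measurable_fun setT (fun w => Z n w t x)) ->
  (forall n t x, measurable_fun setT (fun w => Z' n w t x)) ->
  (forall n, {ae P n, forall w, Z n w = Z' n w}) ->
  fdd_cvg T P Z PW W -> fdd_cvg T P Z' PW W.
Proof.
move=> mZ mZ' ZZ' H k p pK g gc gM.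
have mg n (V : Om n -> R -> R -> R) : (forall t x, measurable_fun setT (fun w => V w t x)) ->
    measurable_fun setT (fun w => (g (\row_i V w (p i).1 (p i).2))%:E).
  move=> mV; apply/measurable_EFinP.
  exact: (measurable_continuous_row (Y := fun i w => V w (p i).1 (p i).2) (fun i => mV _ _) gc).
suff <- : (fun n => \int[P n]_w g (\row_i Z n w (p i).1 (p i).2)) =
    (fun n => \int[P n]_w g (\row_i Z' n w (p i).1 (p i).2)) by exact: H.
apply/funext => n; rewrite /Rintegral; congr fine.
have e : ae_eq (P n) setT (fun w => (g (\row_i Z n w (p i).1 (p i).2))%:E)
    (fun w => (g (\row_i Z' n w (p i).1 (p i).2))%:E).
  by apply: filterS (ZZ' n) => w ->.
exact: (ae_eq_integral _ _ measurableT (mg n (Z n) (mZ n)) (mg n (Z' n) (mZ' n)) e).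
Qed.

Unset Implicit Arguments.
Set Strict Implicit.

Theorem theorem3p4 (R : realType) (T : R) (hT : 0 < T)
  (d : nat -> measure_display) (Om : forall n, measurableType (d n))
  (P : forall n, probability (Om n) R)
  (theta : forall n, Om n -> R -> R -> R)
  (htheta_meas : forall n,
      measurable_fun setT (fun z : Om n * (R * R) => theta n z.1 z.2.1 z.2.2))
  (htheta_L2 : forall n,
      {ae P n, forall w, (enorm `[0%R, T] `[0%R, 1%R] (theta n w) 2 < +oo)%E})
  (dW : measure_display) (OmW : measurableType dW) (PW : probability OmW R)
  (W : OmW -> R -> R -> R) (hW : brownian_sheet T PW W)
  (H1 : fdd_cvg T P
          (fun n w t x => dint `[0%R, t] `[0%R, x] (theta n w)) PW W)
  (q : R) (hq2 : 2 <= q) (hq3 : q < 3) (Cq : R) (hCq : 0 < Cq)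
  (H2 : forall n : nat, (1 <= n)%N ->
     forall f : R -> R -> R, in_Lp `[0%R, T] `[0%R, 1%R] q f ->
       (\int[P n]_w
          ((dint `[0%R, T] `[0%R, 1%R] (fun s y => f s y * theta n w s y)) ^+ 2)%:E
        <= (Cq * fine (enorm `[0%R, T] `[0%R, 1%R] f q) `^ (2 / q))%:E)%E)
  (m : R) (hm : 8 < m) (C : R) (hC : 0 < C)
  (H3 : forall s0 s0' x0 x0' : R,
     0 < s0 -> s0 < s0' -> s0' < 2 * s0 -> s0' <= T ->
     0 < x0 -> x0 < x0' -> x0' < 2 * x0 -> x0' <= 1 ->
     forall f : R -> R -> R, in_Lp `[0%R, T] `[0%R, 1%R] 2 f ->
     forall n : nat, (1 <= n)%N ->
       (\int[P n]_w
          ((`| dint `[s0, s0'] `[x0, x0'] (fun s y => f s y * theta n w s y) |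
              `^ m)%:E)
        <= (C * fine (enorm `[s0, s0'] `[x0, x0'] f 2) `^ (m / 2))%:E)%E)
  (Xn : forall n, Om n -> R -> R -> R)
  (hXn_meas : forall n t x, measurable_fun setT (fun w => Xn n w t x))
  (hXn_cont : forall n w, contK T (Xn n w))
  (hXn_ver : forall n t x, rectK T (t, x) ->
     {ae P n, forall w, Xn n w t x =
        dint `[0%R, t] `[0%R, 1%R] (fun s y => green (t - s) x y * theta n w s y)})
  (X : OmW -> R -> R -> R)
  (hX_meas : forall t x, measurable_fun setT (fun w => X w t x))
  (hX_cont : forall w, contK T (X w))
  (hX_ver : forall t x, rectK T (t, x) ->
     wiener_integral T PW W
       (fun s y => if s < t then green (t - s) x y else 0)
       (fun w => X w t x)) :
  cvg_law_C T P Xn PW X.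
Proof.
(* Each property of [theta] used below is an integral or a law, hence passes to the modification
   [th]. *)
pose th n := trunc_L2 T (theta n).
have aeth n : {ae P n, forall w, th n w = theta n w} := trunc_L2_ae (htheta_L2 n).
have mth n : measurable_fun setT (fun z : Om n * (R * R) => th n z.1 z.2.1 z.2.2).
  exact: measurable_trunc_L2 (htheta_meas n).
have thL n w : (enorm `[0%R, T] `[0%R, 1%R] (th n w) 2 < +oo)%E by exact: trunc_L2_fin.
have hth n : (0 < n)%N -> moment_hyp T m C (P n) (th n).
  move=> n0 s0 s0' x0 x0' a1 a2 a3 a4 a5 a6 a7 a8 f mf fL.
  rewrite (@ae_integral_norm_powR _ _ _ _ _ (fun w => dint `[s0, s0'] `[x0, x0'] (fun s y => f s y * theta n w s y))).
  - by apply: H3 => //; split => //; exact: measurable_funTS.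
  - exact: measurable_dint_mul.
  - exact: measurable_dint_mul.
  - by apply: filterS (aeth n) => w ->.
have mtheta n w : measurable_fun setT (fun z : R * R => theta n w z.1 z.2).
  exact: (@measurable_fun_pair2 _ _ _ _ _ _ (fun z : Om n * (R * R) => theta n z.1 z.2.1 z.2.2) w (htheta_meas n)).
have verX n t x : rectK T (t, x) ->
    {ae P n, forall w, Xn n w t x = dint `[0, T] `[0, 1] (fun s y => kern t x s y * th n w s y)}.
  move=> tx; apply: filterS2 (hXn_ver n t x tx) (aeth n) => w -> ->.
  by apply: dint_green_kern => //; case: tx => /=; rewrite in_itv/= => /andP[].
have H1' : fdd_cvg T P (fun n w t x => dint `[0%R, t] `[0%R, x] (th n w)) PW W.
  apply: (fdd_cvg_ae _ _ _ H1).
  - by move=> n t x; apply: (@measurable_dint R _ _ (theta n)).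
  - by move=> n t x; apply: (@measurable_dint R _ _ (th n)).
  - by move=> n; apply: filterS (aeth n) => w ->.
(* The cell ratio is [sg ^+ 64]: the fourth power is the decay that [moment_bound] asks for, the
   sixteenth that of [enorm_kern_cell]. So [sg] must be close enough to 1 for the ratio to exceed
   1/2. *)
have sg0 : 0 < 99 / 100 :> R by rewrite divr_gt0.
have sg1 : 99 / 100 < 1 :> R by rewrite ltr_pdivrMr// mul1r ltr_nat.
have m1 : 1 <= m by apply: le_trans (ltW hm); rewrite ler1n.
have r2 := ratio_gt_half R.
have [nu [K [/andP[nu0 nu1] K0 inc]]] :=
  dyadic_incr_moment hT hm (ltW hC) sg0 sg1 r2 mth thL hth hXn_meas verX.
apply: (tight_fdd_cvg_law hT m1 nu0 nu1 K0 hXn_meas hXn_cont hX_meas hX_cont inc).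
exact: (kern_fdd_lip_cvg hT m1 (ltW hC) sg0 sg1 r2 mth thL hth hXn_meas verX H1' hW hX_meas hX_ver).
Qed.
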